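(* Let $1\le l\le m$, let $\mathcal T$ be an $m$-linear operator, let $\vec b=(b_1,\dots,b_l)\in \mathrm{BMO}(\mathbb R^n)^l$, and suppose that the iterated commutator $\mathcal T_{\vec b}$ satisfies the sparse domination hypothesis (SD) of the context with constants $C,\eta$. Let $\vec w=(w_1,\dots,w_m)\in A_{\vec 1}$ and $u=\prod_{i=1}^mw_i^{1/m}$. Then for all bounded compactly supported $f_1,\dots,f_m$, $$\big\|\mathcal T_{\vec b}(\vec f)\big\|_{L^{\frac1m,\infty}(u)}\le C'\,(2[u]_{A_1})^{2^{n+7}m[u]_{A_1}}\prod_{s=1}^l\|b_s\|_{\mathrm{BMO}}\big\|\mathcal M_{L(\log L)}(\vec f)\big\|_{L^{\frac1m,\infty}(u)},$$ where $C'$ depends only on $n,m,l,C,\eta$.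
   Context: Cubes have sides parallel to the axes. $\langle g\rangle_Q=\frac1{|Q|}\int_Q g$. $\|b\|_{\mathrm{BMO}}=\sup_Q\langle|b-\langle b\rangle_Q|\rangle_Q$. $\|g\|_{L^{q,\infty}(u)}=\sup_{\lambda>0}\lambda\,u(\{|g|>\lambda\})^{1/q}$, $u(E)=\int_Eu$. Weights. $[w]_{A_1}$ is the least constant with $\langle w\rangle_Q\le [w]_{A_1}\operatorname{ess\,inf}_Qw$ for all cubes $Q$. $\vec w\in A_{\vec 1}$ means $\sup_Q\big(\frac1{|Q|}\int_Q\prod_{i=1}^mw_i^{1/m}\big)\prod_{i=1}^m(\operatorname{ess\,inf}_Qw_i)^{-1/m}<\infty$. Iterated commutator. For an $m$-linear operator $\mathcal T$ acting on (suitable) functions on $\mathbb R^n$, and $\vec b=(b_1,\dots,b_l)$, set $[\mathcal T,\vec b]_{e_i}(\vec f)(x)=b_i(x)\mathcal T(f_1,\dots,f_m)(x)-\mathcal T(f_1,\dots,b_if_i,\dots,f_m)(x)$ and $\mathcal T_{\vec b}=[\cdots[[\mathcal T,\vec b]_{e_1},\vec b]_{e_2}\cdots,\vec b]_{e_l}$. Dyadic lattice: a collection $\mathcal D$ of cubes such that (i) if $Q\in\mathcal D$ then all dyadic descendants of $Q$ are in $\mathcal D$; (ii) any two $Q_1,Q_2\in\mathcal D$ have a common ancestor in $\mathcal D$; (iii) every compact set is contained in some $Q\in\mathcal D$. A subfamily $\mathcal S$ of a dyadic lattice is $\eta$-sparse, $\eta\in(0,1)$, if $|\bigcup_{P\in\mathcal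 S,P\subsetneq Q}P|\le(1-\eta)|Q|$ for all $Q\in\mathcal S$. Hypothesis (SD). There are constants $C>0$, $\eta\in(0,1)$ such that for all bounded compactly supported $f_1,\dots,f_m$ there are $3^n$ $\eta$-sparse families $\mathcal S_1,\dots,\mathcal S_{3^n}$ (each in a dyadic lattice) with, for a.e. $x\in\mathbb R^n$, $$|\mathcal T_{\vec b}(\vec f)(x)|\le C\sum_{j=1}^{3^n}\sum_{\vec\gamma\in\{1,2\}^l}\sum_{Q\in\mathcal S_j}\Big(\prod_{s=1}^l\mathcal U(b_s,f_s,Q,\gamma_s)(x)\Big)\Big(\prod_{s=l+1}^m\langle|f_s|\rangle_Q\Big)\chi_Q(x),$$ where $\mathcal U(b,f,Q,1)(x)=|b(x)-\langle b\rangle_Q|\langle|f|\rangle_Q$ and $\mathcal U(b,f,Q,2)(x)=\langle|(b-\langle b\rangle_Q)f|\rangle_Q$. Maximal function. $\|f\|_{L(\log L),Q}=\inf\{\lambda>0:\frac1{|Q|}\int_Q\phi(|f|/\lambda)\le1\}$ with $\phi(t)=t\log(e+t)$; $\mathcal M_{L(\log L)}(\vec f)(x)=\sup_{Q\ni x}\prod_{i=1}^m\|f_i\|_{L(\log L),Q}$. *)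

(* Defs.v *)
From HB Require Import structures.
From mathcomp Require Import all_boot all_order all_algebra.
From mathcomp Require Import all_classical all_reals all_analysis.
From mathcomp Require Import ess_sup_inf.

Set Implicit Arguments.
Unset Strict Implicit.
Unset Printing Implicit Defensive.

Import Order.TTheory GRing.Theory Num.Theory.
Import numFieldNormedType.Exports.

Local Open Scope classical_set_scope.
Local Open Scope ring_scope.

(* Lebesgue measure on R^n: the outer measure given by countable coverings by
   half-open boxes, restricted to its Caratheodory-measurable sets, so that
   "measurable" means Lebesgue (not merely Borel) measurable. *)

Section lebesgue_outer.
Context {R : realType} {n : nat}.
Implicit Types (p : 'rV[R]_n * 'rV[R]_n) (A : set 'rV[R]_n).

Definition box p : set 'rV[R]_n :=
  [set x | forall i, p.1 ord0 i <= x ord0 i < p.2 ord0 i].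

Definition box_vol p : R :=
  \prod_(i < n) Num.max 0 (p.2 ord0 i - p.1 ord0 i).

(* [None] stands for the empty set, so that finite families are included. *)
Definition obox (o : option ('rV[R]_n * 'rV[R]_n)) : set 'rV[R]_n :=
  if o is Some p then box p else set0.

Definition obox_vol (o : option ('rV[R]_n * 'rV[R]_n)) : \bar R :=
  (if o is Some p then box_vol p else 0)%:E.

Definition leb_outer A : \bar R :=
  ereal_inf [set (\sum_(0 <= k <oo) obox_vol (F k))%E
            | F in [set F | A `<=` \bigcup_k obox (F k)]].

Local Open Scope ereal_scope.

Lemma obox_vol_ge0 o : 0 <= obox_vol o.
Proof.
case: o => [p|] //=; rewrite lee_fin; apply: prodr_ge0 => i _.
by rewrite le_max lexx.
Qed.

Lemma leb_outer_ge0 A : 0 <= leb_outer A.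
Proof.
apply: le_ereal_inf_tmp => _ [F _ <-]; apply: nneseries_ge0 => k _ _.
exact: obox_vol_ge0.
Qed.

Lemma leb_outer0 : leb_outer set0 = 0.
Proof.
apply/eqP; rewrite eq_le leb_outer_ge0 andbT; apply: ereal_inf_lbound.
by exists (fun=> None) => //; rewrite eseries0.
Qed.

Lemma le_leb_outer : {homo leb_outer : A B / A `<=` B >-> A <= B}.
Proof.
move=> A B AB; apply: ereal_inf_le_tmp => _ [F BF <-]; exists F => //.
exact: subset_trans BF.
Qed.

Lemma leb_outer_sigma_subadditive : sigma_subadditive leb_outer.
Proof.
move=> A.
have [[i ioo]|] := pselect (exists i, leb_outer (A i) = +oo).
  rewrite (eseries_pinfty _ _ ioo) ?leey// => j _.
  by rewrite gt_eqF// (lt_le_trans _ (leb_outer_ge0 _)).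
rewrite -forallNE => Afin.
apply/lee_addgt0Pr => _/posnumP[e].
rewrite (le_trans _ (epsilon_trick _ _ _))//; last first.
  by move=> i; exact: leb_outer_ge0.
pose P i (G : nat -> option ('rV[R]_n * 'rV[R]_n)) :=
  A i `<=` \bigcup_k obox (G k) /\ \sum_(0 <= k <oo) obox_vol (G k) <=
    leb_outer (A i) + (e%:num / (2 ^ i.+1)%:R)%:E.
have [G PG] : {G & forall i, P i (G i)}.
  apply: (@choice _ _ P) => i.
  have fA : leb_outer (A i) \is a fin_num.
    by rewrite ge0_fin_numE ?leb_outer_ge0// ltey; apply/eqP; exact: Afin.
  have e0 : (0 < e%:num / (2 ^ i.+1)%:R)%R by rewrite divr_gt0// ltr0n expn_gt0.
  have [_ [G AG <-] ltG] := lb_ereal_inf_adherent e0 fA.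
  by exists G; split => //; exact: ltW.
pose vG := fun ij : nat * nat => obox_vol (G ij.1 ij.2).
have vG0 ij : 0 <= vG ij by exact: obox_vol_ge0.
apply: (@le_trans _ _ (\esum_(ij in [set: nat * nat]) vG ij)).
  apply: ereal_inf_lbound => /=.
  have /card_esym/ppcard_eqP[f] := card_nat2.
  exists (fun k => G (f k).1 (f k).2).
    move=> x [i _ /((PG i).1) [j _ xij]].
    by exists (f^-1%FUN (i, j)) => //=; rewrite invK ?inE.
  by rewrite -(esum_pred_image vG _ xpredT) ?[fun=> _]set_true// image_eq.
rewrite (_ : esum _ _ = \sum_(0 <= i <oo) \sum_(0 <= j <oo) vG (i, j)); last first.
  pose J : nat -> set (nat * nat) := fun i => [set (i, j) | j in setT].
  rewrite (_ : setT = \bigcup_k J k); last first.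
    by rewrite predeqE => -[a b]; split => // _; exists a => //; exists b.
  rewrite esum_bigcupT//=; last first.
    apply/trivIsetP => i j _ _ ij.
    rewrite predeqE => -[a b] /=; split => //= -[] [_] _ [<-{a} _].
    by move=> [b' _] [] /esym/eqP; rewrite (negbTE ij).
  rewrite -(image_id [set: nat]) -fun_true esum_pred_image//; last first.
    by move=> i _; exact: esum_ge0.
  apply: eq_eseriesr => /= j _.
  rewrite -(esum_pred_image vG (pair j) predT)//=; last first.
    by move=> ? ? _ _; exact: (@can_inj _ _ _ snd).
  by congr esum; rewrite predeqE => -[a b]; split; move=> [i _ <-]; exists i.
apply: lee_nneseries => i *; last exact: (PG i).2.
by apply: nneseries_ge0 => j *; exact: obox_vol_ge0.
Qed.

HB.instance Definition _ := isOuterMeasure.Build R _ leb_outer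
  leb_outer0 leb_outer_ge0 le_leb_outer leb_outer_sigma_subadditive.

End lebesgue_outer.

(* R^n with its Lebesgue-measurable sets; convertible to ['rV[R]_n]. *)
Notation Rn R n := (caratheodory_type (@leb_outer R n)).

Definition leb {R : realType} {n : nat} : set (Rn R n) -> \bar R :=
  @leb_outer R n.

Section leb_measure.
Context (R : realType) (n : nat).
Let mu : {outer_measure set 'rV[R]_n -> \bar R} := @leb_outer R n.

HB.instance Definition _ := isMeasure.Build _ (Rn R n) R (@leb R n)
  (@caratheodory_measure0 _ _ mu) (@caratheodory_measure_ge0 _ _ mu)
  (@caratheodory_measure_sigma_additive _ _ mu).

End leb_measure.

Section analysis.
Context {R : realType} {n : nat}.
Local Notation V := 'rV[R]_n.
Implicit Types (Q P : set V) (f g b w u : V -> R) (D S : set (set V)).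

Definition meas_fun f := measurable_fun [set: Rn R n] (f : Rn R n -> R).

(* Half-open cubes: the convention under which dyadic children partition
   their parent. *)
Definition cube (a : V) (h : R) : set V :=
  [set x | forall i, a ord0 i <= x ord0 i < a ord0 i + h].

Definition is_cube Q := exists a h, 0 < h /\ Q = cube a h.

Definition eavg Q (g : V -> \bar R) : \bar R :=
  ((leb Q)^-1 * \int[leb]_(x in Q) g x)%E.

Definition avg Q g : R := fine (eavg Q (EFin \o g)).

Definition loc_integrable f := meas_fun f /\
  forall K : set V, compact K -> (\int[leb]_(x in K) `|f x|%:E < +oo)%E.

Definition bounded_compact_support f :=
  [/\ meas_fun f, exists M, forall x, `|f x| <= M &
      exists2 K : set V, compact K & forall x, ~ K x -> f x = 0].

Definition bmo_norm b : \bar R :=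
  ereal_sup [set eavg Q (fun x => `|b x - avg Q b|%:E) | Q in is_cube].

Definition BMO b := loc_integrable b /\ (bmo_norm b < +oo)%E.

Definition weight_meas u (E : set V) : \bar R := (\int[leb]_(x in E) (u x)%:E)%E.

Definition weak_norm (q : R) u (g : V -> \bar R) : \bar R :=
  ereal_sup [set (t%:E * poweR (weight_meas u [set x | t%:E < `|g x|]) q^-1)%E
            | t in [set t : R | 0 < t]].

Definition ess_inf_on Q w : \bar R :=
  ess_inf leb (fun x : Rn R n => if x \in Q then (w x)%:E else +oo%E).

(* Finite when [w] is an A_1 weight, in particular for [geom_mean_weight w]
   under [A1_vec w]. *)
Definition A1_const w : \bar R :=
  ereal_inf [set c%:E | c in [set c : R | forall Q, is_cube Q ->
    (eavg Q (EFin \o w) <= c%:E * ess_inf_on Q w)%E]].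

Definition weight w :=
  [/\ meas_fun w, forall x, 0 <= w x & \forall x \ae leb, 0 < w x].

Definition geom_mean_weight m (w : 'I_m -> V -> R) : V -> R :=
  fun x => \prod_(i < m) (w i x) `^ (m%:R^-1).

(* The inverse is the extended-real one, with [0^-1 = +oo]. *)
Definition A1_vec m (w : 'I_m -> V -> R) := (forall i, weight (w i)) /\
  (ereal_sup [set eavg Q (EFin \o geom_mean_weight w) *
                  \prod_(i < m) (poweR (ess_inf_on Q (w i)) m%:R^-1)^-1
             | Q in is_cube] < +oo)%E.

Definition dyadic_descendants Q : set (set V) :=
  [set P | exists a h k (j : 'I_n -> 'I_(2 ^ k)),
     [/\ 0 < h, Q = cube a h &
         P = cube (\row_i (a ord0 i + (j i)%:R * (h / 2 ^+ k))) (h / 2 ^+ k)]].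

Definition dyadic_lattice D :=
  [/\ D `<=` is_cube,
      forall Q, D Q -> dyadic_descendants Q `<=` D,
      forall Q1 Q2, D Q1 -> D Q2 -> exists2 Q, D Q &
        dyadic_descendants Q Q1 /\ dyadic_descendants Q Q2 &
      forall K : set V, compact K -> exists2 Q, D Q & K `<=` Q].

Definition sparse (eta : R) S :=
  (exists2 D, dyadic_lattice D & S `<=` D) /\
  forall Q, S Q ->
    (leb (\bigcup_(P in [set P | S P /\ P `<` Q]) P) <= (1 - eta)%:E * leb Q)%E.

Definition phi (t : R) : R := t * ln (expR 1 + t).

Definition LlogL_norm f Q : \bar R :=
  ereal_inf [set t%:E | t in [set t : R | 0 < t /\
    (eavg Q (fun x => (phi (`|f x| / t))%:E) <= 1)%E]].

Definition max_LlogL m (f : 'I_m -> V -> R) (x : V) : \bar R :=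
  ereal_sup [set (\prod_(i < m) LlogL_norm (f i) Q)%E
            | Q in [set Q | is_cube Q /\ Q x]].

Section operators.
Variable m : nat.
Implicit Types (F : 'I_m -> V -> R) (T : ('I_m -> V -> R) -> V -> R).

Definition subst_arg F (i : 'I_m) g : 'I_m -> V -> R :=
  fun j => if j == i then g else F j.

(* [X] is the class of functions on which [T] is meaningful; outside of [X]
   the values of [T] are junk. *)
Definition multilinear_operator (X : set (V -> R)) T :=
  [/\ X `<=` meas_fun,
      X (cst 0),
      forall (c : R) g h, X g -> X h -> X (fun x => c * g x + h x),
      forall F, (forall i, X (F i)) -> meas_fun (T F) &
      forall F i (c : R) g h, (forall j, X (F j)) -> X g -> X h ->
        \forall x \ae leb,
          T (subst_arg F i (fun y => c * g y + h y)) x =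
          c * T (subst_arg F i g) x + T (subst_arg F i h) x].

Definition commutator T b (i : 'I_m) : ('I_m -> V -> R) -> V -> R :=
  fun F x => b x * T F x - T (subst_arg F i (fun y => b y * F i y)) x.

Variables (l : nat) (hlm : (l <= m)%N).

Definition iterated_commutator T (b : 'I_l -> V -> R) :=
  foldl (fun T' s => commutator T' (b s) (widen_ord hlm s)) T (enum 'I_l).

(* [false] and [true] encode the values 1 and 2 of the exponent gamma. *)
Definition sparse_factor b f Q (gamma : bool) (x : V) : \bar R :=
  (if gamma then eavg Q (fun y => `|(b y - avg Q b) * f y|%:E)
   else `|b x - avg Q b|%:E * eavg Q (fun y => `|f y|%:E))%E.

Definition sparse_form (b : 'I_l -> V -> R) F S (gamma : {ffun 'I_l -> bool})
    (x : V) : \bar R :=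
  (\esum_(Q in S)
    ((\prod_(s < l) sparse_factor (b s) (F (widen_ord hlm s)) Q (gamma s) x)
     * (\prod_(s < m | (l <= s)%N) eavg Q (fun y => `|F s y|%:E))
     * (\1_Q x)%:E))%E.

Definition sparse_domination T (b : 'I_l -> V -> R) (C eta : R) :=
  forall F, (forall i, bounded_compact_support (F i)) ->
  exists2 S : 'I_(3 ^ n) -> set (set V), (forall j, sparse eta (S j)) &
    \forall x \ae leb,
      (`|iterated_commutator T b F x|%:E <=
       C%:E * \sum_(j < 3 ^ n) \sum_(gamma : {ffun 'I_l -> bool})
         sparse_form b F (S j) gamma x)%E.

End operators.

End analysis.

(* Main.v *)
(** By the generalised Hoelder inequality and John-Nirenberg, every term of the
    sparse bound is at most a constant times the product of the BMO norms times
    [h_Q A_Q 1_Q], where [A_Q] is the product of the L(log L) averages over [Q],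
    which [M_{L(log L)}] dominates on [Q], and [h_Q] is a product of normalised
    oscillations [c + |b_s - <b_s>_Q| / ||b_s||]. The measure [u dx] only enters
    through [u(Q) |E| <= [u]_{A_1} |Q| u(E)] for [E] inside a cube [Q]; this
    suffices for a weighted John-Nirenberg inequality, hence for
    [int_Q h_Q^2 u <= H u(Q)], and for the Carleson packing of sparse families.
    To bound [u {sum_Q h_Q A_Q 1_Q > 3 lam}], remove the cubes with [A_Q > lam],
    which lie in [{M > lam}], and sort the others by [A_Q ~ 16^-k lam]. On level
    [k], [h_Q <= 2^k + 2^-k h_Q^2], and the overlap function [N_k] satisfies
    [N_k <= 4^k + 4^-k N_k^2]; the constants add up to at most [2 lam], while
    the quadratic remainders have integral controlled by
    [sum_k 32^-k u {M > 16^-(k+1) lam} <= sum_k 32^-k 16^(k+1) (N / lam)^(1/m)],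
    with [N] the weak norm of [M] and because [m >= 1]. All constants are
    polynomial in [[u]_{A_1}], so the exponential factor of the statement
    absorbs them. *)

From HB Require Import structures.
Require Import Defs.
From mathcomp Require Import all_boot all_order all_algebra.
From mathcomp Require Import all_classical all_reals all_analysis.
From mathcomp Require Import ess_sup_inf measurable_realfun ring lra.

Set Implicit Arguments.
Unset Strict Implicit.
Unset Printing Implicit Defensive.

Import Order.TTheory GRing.Theory Num.Theory.
Import numFieldNormedType.Exports.

Local Open Scope classical_set_scope.
Local Open Scope ring_scope.

(** * Countable sums and densities *)

(** As [1/m <= 1], the target is only quasi-normed and the sum over cubes cannot be estimated term
    by term; hence all levels are gathered into one exceptional set. The base 16 only has to exceed
    [2 * 4]: linearising [h_Q] costs [2^k] and linearising [N_k] costs [4^k], so the main part of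
    level [k] is [(8/16)^k = 2^-k], while both quadratic remainders carry [32^-k], which beats the
    growth [16^k] of the level sets by [2^-k]. The comparison of [u] with Lebesgue measure combines
    [u(Q) <= a ess_inf_Q(u) |Q|] with [ess_inf_Q(u) |E| <= u(E)]; that [u] is an A_1 weight at all
    follows because the product of the essential infima of the [w_i^(1/m)] is at most the essential
    infimum of [u]. Two degenerate situations are split off. A vanishing BMO norm cannot be divided
    by, but then the sparse form is zero almost everywhere. Positivity of the measure of cubes is
    carried as the hypothesis [leb_cube_gt0] and settled by a dichotomy at the very end. *)

Section countable_families.
Local Open Scope ereal_scope.
Context {R : realType} {I : pointedType}.
Implicit Types (S : set I) (a : I -> \bar R).

Lemma countable_enum S : countable S ->
  exists (D : set nat) (e : nat -> I), set_bij D S e.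
Proof.
move=> /countable_bijP[B] /card_esym /card_set_bijP[e eB].
by exists B, e.
Qed.

(** The bridge from sums over families of cubes to series over [nat], for which sigma-additivity and
    monotone convergence are available. *)
Lemma esum_enum S (D : set nat) (e : nat -> I) a : set_bij D S e ->
  (forall i, S i -> 0 <= a i) ->
  \esum_(i in S) a i = \sum_(k <oo | k \in D) a (e k).
Proof.
move=> De a0; rewrite (reindex_esum D S e)// nneseries_esum ?set_mem_set//.
by move=> k; rewrite inE => /(set_bij_homo De); exact: a0.
Qed.

Context d (T : measurableType d).
Implicit Types (mu : {measure set T -> \bar R}) (f : I -> T -> \bar R).

Lemma measurable_esum (A : set T) S f : measurable A -> countable S ->
  (forall i x, S i -> 0 <= f i x) ->
  (forall i, S i -> measurable_fun A (f i)) ->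
  measurable_fun A (fun x => \esum_(i in S) f i x).
Proof.
move=> mA /countable_enum[D [e De]] f0 mf.
apply: (eq_measurable_fun (fun x => \sum_(k <oo | k \in D) f (e k) x)).
  by move=> x _; rewrite (esum_enum De)// => i; exact: f0.
apply: ge0_emeasurable_sum => [k x _|k]; rewrite inE => /(set_bij_homo De) Sk.
  exact: f0.
exact: mf.
Qed.

Lemma integral_esum mu (A : set T) S f : measurable A -> countable S ->
  (forall i x, S i -> 0 <= f i x) ->
  (forall i, S i -> measurable_fun A (f i)) ->
  \int[mu]_(x in A) (\esum_(i in S) f i x) =
  \esum_(i in S) \int[mu]_(x in A) f i x.
Proof.
move=> mA /countable_enum[D [e De]] f0 mf.
rewrite (esum_enum De); last first.
  by move=> i Si; apply: integral_ge0 => x _; exact: f0.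
transitivity (\int[mu]_(x in A)
    \sum_(k <oo) (if k \in D then f (e k) x else 0)).
  apply: eq_integral => x _; rewrite (esum_enum De) ?[LHS]eseries_mkcond//.
  by move=> i Si; exact: f0.
rewrite integral_nneseries//.
- rewrite [RHS]eseries_mkcond; apply: eq_eseriesr => k _.
  by case: ifPn => // _; rewrite integral0.
- move=> k; have [|_] := boolP (k \in D); last exact: measurable_cst.
  rewrite inE => /(set_bij_homo De); exact: mf.
- move=> k x _; case: ifPn => //; rewrite inE => /(set_bij_homo De) Sk.
  exact: f0.
Qed.

Lemma countable_bigcup_measurable S (F : I -> set T) : countable S ->
  (forall i, S i -> measurable (F i)) -> measurable (\bigcup_(i in S) F i).
Proof.
move=> /countable_enum[D [e De]] mF.
rewrite (_ : \bigcup_(i in S) F i = \bigcup_(k in D) F (e k)).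
  by apply: bigcup_measurable => k /(set_bij_homo De); exact: mF.
apply/seteqP; split=> x [i].
  by move=> /(set_bij_surj De)[k Dk <-] Fx; exists k.
by move=> /(set_bij_homo De) Sk Fx; exists (e i).
Qed.

Lemma measure_countable_bigcup mu S (F : I -> set T) : countable S ->
  (forall i, S i -> measurable (F i)) -> trivIset S F ->
  mu (\bigcup_(i in S) F i) = \esum_(i in S) mu (F i).
Proof.
move=> /countable_enum[D [e De]] mF tF.
rewrite (esum_enum De)//.
rewrite (_ : \bigcup_(i in S) F i = \bigcup_(k in D) F (e k)).
  rewrite measure_bigcup//; first by move=> k /(set_bij_homo De); exact: mF.
  move=> j k Dj Dk jk; apply: (set_bij_inj De); rewrite ?inE//.
  by apply: tF => //; exact: (set_bij_homo De).
apply/seteqP; split=> x [i].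
  by move=> /(set_bij_surj De)[k Dk <-] Fx; exists k.
by move=> /(set_bij_homo De) Sk Fx; exists (e i).
Qed.

Lemma esumZl S a (c : R) : countable S -> (0 <= c)%R ->
    (forall i, S i -> 0 <= a i) ->
  \esum_(i in S) (c%:E * a i) = c%:E * \esum_(i in S) a i.
Proof.
move=> /countable_enum[D [e De]] c0 a0.
rewrite !(esum_enum De)//; last by move=> i Si; rewrite mule_ge0 ?lee_fin ?a0.
by rewrite nneseriesZl// => k; rewrite inE => /(set_bij_homo De); exact: a0.
Qed.

Lemma measure_countable_bigcup_le mu S (F : I -> set T) : countable S ->
  (forall i, S i -> measurable (F i)) ->
  mu (\bigcup_(i in S) F i) <= \esum_(i in S) mu (F i).
Proof.
move=> /countable_enum[D [e De]] mF; rewrite (esum_enum De)//.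
pose G k := if k \in D then F (e k) else set0.
have mG k : measurable (G k).
  by rewrite /G; case: ifPn => //; rewrite inE => /(set_bij_homo De); exact: mF.
rewrite (_ : \bigcup_(i in S) F i = \bigcup_k G k).
  rewrite [leRHS]eseries_mkcond.
  have -> : \sum_(k <oo) (if k \in D then mu (F (e k)) else 0) =
            \sum_(k <oo) mu (G k).
    by apply: eq_eseriesr => k _; rewrite /G; case: ifPn; rewrite ?measure0.
  by apply: measure_sigma_subadditive => //; exact: bigcupT_measurable.
apply/seteqP; split=> x [i].
  by move=> /(set_bij_surj De)[k Dk <-] Fx; exists k => //; rewrite /G mem_set.
rewrite /G; case: ifPn => //; rewrite inE => /(set_bij_homo De) Sk _ Fx.
by exists (e i).
Qed.

End countable_families.

Section integral_domination.
Local Open Scope ereal_scope.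
Context d (T : measurableType d) {R : realType}.
Variable mu : {measure set T -> \bar R}.
Implicit Types f g : T -> \bar R.

(* Neither function is assumed measurable: the integral of a nonnegative
   function is a supremum over the simple functions below it. *)
Lemma ge0_le_integralT f g : (forall x, 0 <= f x) -> (forall x, f x <= g x) ->
  \int[mu]_x f x <= \int[mu]_x g x.
Proof.
move=> f0 fg; rewrite !ge0_integralTE//; last first.
  by move=> x; exact: le_trans (fg x).
apply: ge_ereal_sup => _ [h hf <-]; apply: ereal_sup_ubound; exists h => // x.
exact: le_trans (fg x).
Qed.

Lemma ge0_le_integral_on (A : set T) f g : (forall x, A x -> 0 <= f x) ->
  (forall x, A x -> f x <= g x) ->
  \int[mu]_(x in A) f x <= \int[mu]_(x in A) g x.
Proof.
move=> f0 fg; rewrite integral_mkcond [leRHS]integral_mkcond.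
by apply: ge0_le_integralT => x; rewrite /patch; case: ifPn => //;
  rewrite inE; [exact: f0|exact: fg].
Qed.

Lemma ge0_le_integral_set (A B : set T) f : (forall x, 0 <= f x) ->
  A `<=` B -> \int[mu]_(x in A) f x <= \int[mu]_(x in B) f x.
Proof.
move=> f0 AB; rewrite integral_mkcond [leRHS]integral_mkcond.
apply: ge0_le_integralT => x; rewrite /patch; first by case: ifPn.
case: ifPn => //; last by case: ifPn.
by rewrite inE => /AB Bx; rewrite mem_set.
Qed.

End integral_domination.

Section density_measure.
Local Open Scope ereal_scope.
Context d (T : measurableType d) {R : realType}.
Variables (mu : {measure set T -> \bar R}) (u : T -> R).
Hypotheses (mu_u : measurable_fun [set: T] u) (u0 : forall x, (0 <= u x)%R).

Definition density (A : set T) : \bar R := \int[mu]_(x in A) (u x)%:E.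

Let density0 : density set0 = 0. Proof. exact: integral_set0. Qed.

Let density_ge0 A : 0 <= density A.
Proof. by apply: integral_ge0 => x _; rewrite lee_fin. Qed.

Let density_sigma_additive : semi_sigma_additive density.
Proof.
move=> F mF tF mUF; rewrite /density ge0_integral_bigcup//.
- apply: is_cvg_ereal_nneg_natsum_cond => k _ _; exact: density_ge0.
- by apply/measurable_EFinP; exact: measurable_funTS.
- by move=> x _; rewrite lee_fin.
Qed.

(** Packing [u dx] as a measure lets the John-Nirenberg and Carleson arguments be written once, for
    an abstract [nu]. *)
Definition density_measure : {measure set T -> \bar R} :=
  HB.pack density (isMeasure.Build _ _ _ density density0 density_ge0
    density_sigma_additive).

End density_measure.

(** * Boxes and cubes *)

Section boxes.
Context {R : realType} {n : nat}.
Local Notation V := 'rV[R]_n.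
Implicit Types (p : V * V) (a b x y : V) (h c : R) (Q E : set V).

Definition half_space (i : 'I_n) c : set V := [set x | x ord0 i < c].

Let clip_upper p i c : V * V :=
  (p.1, \row_j if j == i then Num.min (p.2 ord0 i) c else p.2 ord0 j).

Let clip_lower p i c : V * V :=
  (\row_j if j == i then Num.max (p.1 ord0 i) c else p.1 ord0 j, p.2).

Let box_clip_upper p i c : box p `&` half_space i c `<=`
  box (clip_upper p i c).
Proof.
move=> x [xp /= xc] j; rewrite /= mxE; have /andP[-> xq] := xp j.
by case: eqP => [->|//]; rewrite lt_min xc; have /andP[_ ->] := xp i.
Qed.

Let box_clip_lower p i c : box p `\` half_space i c `<=`
  box (clip_lower p i c).
Proof.
move=> x [xp /= /negP]; rewrite -leNgt => cx j; rewrite /= mxE.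
have /andP[xq ->] := xp j; rewrite andbT.
by case: eqP => [->|//]; rewrite ge_max cx; have /andP[-> _] := xp i.
Qed.

Let box_vol_clip p i c :
  box_vol (clip_upper p i c) + box_vol (clip_lower p i c) <= box_vol p.
Proof.
rewrite /box_vol (bigD1 i)//= [X in _ + X <= _](bigD1 i)//=.
rewrite [leRHS](bigD1 i)//= !mxE eqxx.
rewrite (eq_bigr (fun j => Num.max 0 (p.2 ord0 j - p.1 ord0 j))); last first.
  by move=> j /negPf ji; rewrite mxE ji.
rewrite [X in _ + _ * X <= _](eq_bigr
    (fun j => Num.max 0 (p.2 ord0 j - p.1 ord0 j))); last first.
  by move=> j /negPf ji; rewrite mxE ji.
rewrite -mulrDl ler_wpM2r//.
  by apply: prodr_ge0 => j _; rewrite le_max lexx.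
move: (p.1 ord0 i) (p.2 ord0 i) => s t; rewrite /Num.max /Num.min.
by repeat case: ifPn => //; rewrite -?leNgt => *; lra.
Qed.

(** Caratheodory's criterion, tested on coverings: the hyperplane cuts every box into two boxes
    whose volumes add up to at most that of the original. *)
Lemma half_space_measurable (i : 'I_n) c :
  measurable (half_space i c : set (Rn R n)).
Proof.
apply: le_caratheodory_measurable => X; rewrite /= {3}/leb_outer.
apply: le_ereal_inf_tmp => _ [F XF <-].
pose U k := omap (fun p => clip_upper p i c) (F k).
pose L k := omap (fun p => clip_lower p i c) (F k).
have XU : (leb_outer (X `&` half_space i c) <=
    \sum_(0 <= k <oo) obox_vol (U k))%E.
  apply: ereal_inf_lbound; exists U => // x [Xx xc].
  have [k _ Fx] := XF _ Xx; exists k => //; move: Fx.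
  by rewrite /U; case: (F k) => //= p px; apply: box_clip_upper.
have XL : (leb_outer (X `&` ~` half_space i c) <=
    \sum_(0 <= k <oo) obox_vol (L k))%E.
  apply: ereal_inf_lbound; exists L => // x [Xx xc].
  have [k _ Fx] := XF _ Xx; exists k => //; move: Fx.
  by rewrite /L; case: (F k) => //= p px; apply: box_clip_lower.
apply: (le_trans (leeD XU XL)).
rewrite -nneseriesD; [|by move=> *; exact: obox_vol_ge0..].
apply: lee_nneseries => [k _ _|k _].
  by rewrite adde_ge0// obox_vol_ge0.
rewrite /U /L; case: (F k) => [p|] /=; last by rewrite adde0.
by rewrite -EFinD lee_fin.
Qed.

Lemma box_measurable p : measurable (box p : set (Rn R n)).
Proof.
rewrite (_ : box p = \bigcap_(i in [set: 'I_n])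
  (half_space i (p.2 ord0 i) `\` half_space i (p.1 ord0 i))).
  apply: fin_bigcap_measurable => // i _.
  by apply: measurableD; exact: half_space_measurable.
apply/seteqP; split=> x xp i.
  by have /andP[pi iq] := xp i; split => //=; apply/negP; rewrite -leNgt.
by have [iq /= /negP] := xp i I; rewrite -leNgt iq => ->.
Qed.

Lemma leb_box_le p : (leb (box p) <= (box_vol p)%:E)%E.
Proof.
apply: ereal_inf_lbound; exists (fun k => if k == 0%N then Some p else None).
  by move=> x px; exists 0%N.
rewrite nneseries_recl//; last by move=> k _; apply: obox_vol_ge0.
rewrite /= eseries0 ?adde0//; by case.
Qed.

Lemma cube_box a h : cube a h = box (a, a + const_mx h).
Proof. by apply/seteqP; split=> x xa i; have := xa i; rewrite /= !mxE. Qed.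

Lemma leb_cube_fin a h : (leb (cube a h) < +oo)%E.
Proof. by rewrite cube_box (le_lt_trans (leb_box_le _))// ltry. Qed.

Lemma leb_cube_translate a b h : leb (cube a h) = leb (cube b h).
Proof.
suff H : forall a b, (leb (cube a h) <= leb (cube b h))%E.
  by apply/eqP; rewrite eq_le !H.
move=> {}a {}b; apply: le_ereal_inf_tmp => _ [F bF <-].
pose G k := omap (fun p => (p.1 + (a - b), p.2 + (a - b))) (F k).
rewrite (_ : (\sum_(0 <= k <oo) _)%E = \sum_(0 <= k <oo) obox_vol (G k))%E.
  apply: ereal_inf_lbound; exists G => // x xa.
  have /bF[k _ Fk] : cube b h (x - (a - b)).
    by move=> i; have := xa i; rewrite !mxE => /andP[? ?]; apply/andP; split; lra.
  exists k => //; rewrite /G; move: Fk; case: (F k) => //= p xp i.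
  by have := xp i; rewrite !mxE => /andP[? ?]; apply/andP; split; lra.
apply: eq_eseriesr => k _; rewrite /G; case: (F k) => //= p.
congr (_%:E); apply: eq_bigr => i _; rewrite !mxE; congr Num.max.
by rewrite opprD addrACA subrr addr0.
Qed.

Lemma cube_measurable a h : measurable (cube a h : set (Rn R n)).
Proof. by rewrite cube_box; exact: box_measurable. Qed.

(** The [2^n] dyadic children cover the cube and are translates of each other, so translation
    invariance replaces a computation of volumes. *)
Lemma leb_cube_half a b h :
  (leb (cube a h) <= (2 ^ n)%:R%:E * leb (cube b (h / 2)))%E.
Proof.
pose N := #|{ffun 'I_n -> bool}|.
pose c (k : 'I_N) : V := \row_i (a ord0 i + (enum_val k i)%:R * (h / 2)).
pose F k := if (insub k : option 'I_N) is Some i then cube (c i) (h / 2) else set0.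
have mF k : measurable (F k : set (Rn R n)).
  by rewrite /F; case: insubP => // *; exact: cube_measurable.
have aF : cube a h `<=` \big[setU/set0]_(k < N) F k.
  move=> x xa; pose e := [ffun i => a ord0 i + h / 2 <= x ord0 i].
  rewrite -bigcup_mkord; exists (enum_rank e : nat) => /=; first exact: ltn_ord.
  rewrite /F insubT//= => ltN; rewrite (_ : Sub _ _ = enum_rank e); last first.
    exact: val_inj.
  move=> i; rewrite mxE enum_rankK ffunE; have := xa i.
  by case: (leP (a ord0 i + h / 2) (x ord0 i)) => /= ? /andP[? ?]; rewrite ?mulr1n ?mulr0n;
    apply/andP; split; lra.
apply: (le_trans (@content_subadditive _ _ _ leb _ _ _ _ (cube_measurable _ _) aF)).
  by move=> k _; exact: mF.
rewrite (eq_bigr (fun=> 1%:E * leb (cube b (h / 2))))%E; last first.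
  by move=> k _; rewrite /F insubT//= => kN; rewrite mul1e; exact: leb_cube_translate.
rewrite -ge0_sume_distrl; last by move=> *; exact: lee01.
by rewrite sumEFin sumr_const card_ord /N card_ffun card_bool card_ord.
Qed.

Hypothesis n0 : (0 < n)%N.

(** The corner is the coordinatewise least point, and the open upper faces reveal the side; in
    dimension 0 the side would be lost. This recovers the parameters hidden by the existentials of
    [is_cube] and [dyadic_descendants]. *)
Lemma cube_inj a b (h h' : R) : 0 < h -> 0 < h' -> cube a h = cube b h' ->
  a = b /\ h = h'.
Proof.
move=> h0 h'0 ab.
have ba : a = b.
  have aa : cube b h' a by rewrite -ab => i; rewrite lexx ltrDl.
  have bb : cube a h b by rewrite ab => i; rewrite lexx ltrDl.
  apply/rowP => i; have /andP[ba _] := aa i; have /andP[{}ab _] := bb i.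
  by apply/eqP; rewrite eq_le ab ba.
split=> //; subst b.
suff H s t : 0 < s -> s < t -> cube a s <> cube a t.
  apply/eqP; rewrite eq_le !leNgt; apply/andP; split; apply/negP => hh.
    exact: (H _ _ h'0 hh).
  exact: (H _ _ h0 hh).
move=> s0 st /seteqP[_ /(_ (a + const_mx s)) ts].
have /ts/(_ (Ordinal n0)) : cube a t (a + const_mx s).
  by move=> i; rewrite !mxE; apply/andP; split; lra.
by rewrite !mxE ltxx andbF.
Qed.

End boxes.

(** * Dyadic grids *)

Section dyadic_grid.
Context {R : realType} {n : nat}.
Local Notation V := 'rV[R]_n.
Implicit Types (x y z : V) (i : 'I_n) (k l : nat) (P Q : set V).

Section grid.
Variables (a : V) (h : R).
Hypothesis h0 : 0 < h.

Definition grid_side k : R := h / 2 ^+ k.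

Definition grid_index k x i : int :=
  Num.floor ((x ord0 i - a ord0 i) / grid_side k).

(** Cells are classes of points with equal integer parts, over the grid of all of [R^n] and not only
    inside [cube a h]; nestedness becomes a statement about [floor]. *)
Definition grid_cell k x : set V :=
  [set y | forall i, grid_index k y i = grid_index k x i].

Definition grid_corner k x : V :=
  \row_i (a ord0 i + (grid_index k x i)%:~R * grid_side k).

Lemma grid_side_gt0 k : 0 < grid_side k.
Proof. by rewrite divr_gt0// exprn_gt0. Qed.

Lemma grid_sideS k : grid_side k.+1 = grid_side k / 2.
Proof. by rewrite /grid_side exprSr invfM mulrA. Qed.

Lemma grid_indexP k x i (j : int) : (grid_index k x i == j) =
  (a ord0 i + j%:~R * grid_side k <= x ord0 i <
   a ord0 i + j%:~R * grid_side k + grid_side k).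
Proof.
rewrite /grid_index floor_eq ler_pdivlMr ?ltr_pdivrMr ?grid_side_gt0//.
by rewrite lerBrDl ltrBlDl intrD mulrDl mul1r addrA.
Qed.

Lemma grid_cellE k x : grid_cell k x = cube (grid_corner k x) (grid_side k).
Proof.
apply/seteqP; split=> y xy i.
  by rewrite mxE -grid_indexP; exact/eqP.
by apply/eqP; rewrite grid_indexP; have := xy i; rewrite mxE.
Qed.

Lemma grid_cell_is_cube k x : is_cube (grid_cell k x).
Proof.
exists (grid_corner k x), (grid_side k); split; first exact: grid_side_gt0.
exact: grid_cellE.
Qed.

Lemma grid_cell0 x : cube a h x -> grid_cell 0 x = cube a h.
Proof.
move=> xa; rewrite grid_cellE; congr cube; last by rewrite /grid_side divr1.
apply/rowP => i; rewrite mxE (_ : grid_index 0 x i = 0) ?mul0r ?addr0//.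
by apply/eqP; rewrite grid_indexP mul0r addr0 /grid_side divr1; exact: xa.
Qed.

Lemma grid_cell_refl k x : grid_cell k x x. Proof. by []. Qed.

Lemma grid_cell_eq k x y : grid_cell k x y -> grid_cell k y = grid_cell k x.
Proof. by move=> xy; apply/seteqP; split=> z zy i; rewrite zy xy. Qed.

(** [floor (2 v)] determines [floor v], because [2 floor v <= floor (2 v) < 2 (floor v + 1)]. *)
Lemma grid_cellS k x : grid_cell k.+1 x `<=` grid_cell k x.
Proof.
move=> y xy i; apply/eqP; rewrite /grid_index floor_eq.
have E z : 2 * ((z ord0 i - a ord0 i) / grid_side k) =
           (z ord0 i - a ord0 i) / grid_side k.+1.
  by rewrite grid_sideS (invf_div (grid_side k) 2) [RHS]mulrCA.
have := xy i; rewrite /grid_index -!E.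
move: ((y ord0 i - _) / _) ((x ord0 i - _) / _) => u v yxE.
have two : (2 : int)%:~R = 2 :> R by [].
apply/andP; split.
  have : 2 * Num.floor v <= Num.floor (2 * v).
    by rewrite floor_ge_int intrM two ler_pM2l// floor_le.
  by rewrite -yxE floor_ge_int intrM two ler_pM2l.
have : Num.floor (2 * v) < 2 * (Num.floor v + 1).
  by rewrite floor_lt_int intrM two ltr_pM2l// floorD1_gt.
by rewrite -yxE floor_lt_int intrM two ltr_pM2l.
Qed.

Lemma grid_cell_le k l x : (k <= l)%N -> grid_cell l x `<=` grid_cell k x.
Proof.
move=> /subnK <-; elim: (l - k)%N => // j ih.
exact: subset_trans (@grid_cellS _ _) ih.
Qed.

Lemma grid_cell_nested k l x y z : (k <= l)%N ->
  grid_cell k x z -> grid_cell l y z -> grid_cell l y `<=` grid_cell k x.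
Proof.
by move=> kl /grid_cell_eq <- /grid_cell_eq <-; exact: grid_cell_le.
Qed.

Lemma grid_cell_countable : countable [set P | exists k x, P = grid_cell k x].
Proof.
pose f (s : nat * {ffun 'I_n -> int}) : set V :=
  [set y | forall i, grid_index s.1 y i = s.2 i].
apply: (@sub_countable _ _ _ [set: nat * {ffun 'I_n -> int}]); last first.
  exact: countableP.
apply: (card_le_trans _ (card_image_le f _)); apply: subset_card_le.
move=> _ [k [x ->]]; exists (k, [ffun i => grid_index k x i]) => //.
by apply/seteqP; split=> y xy i; have := xy i; rewrite /= ffunE.
Qed.

Lemma grid_cell_small x (d : R) : 0 < d ->
  exists k, forall y, grid_cell k x y -> forall i, `|y ord0 i - x ord0 i| < d.
Proof.
move=> d0.
have [k kd] : exists k, grid_side k < d.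
  have [k] := ltr_add_invr (divr_gt0 d0 h0).
  rewrite add0r => kd; exists k.+1; rewrite /grid_side ltr_pdivrMr ?exprn_gt0//.
  move: kd; rewrite ltr_pdivlMr// mulrC ltr_pdivrMr// => /lt_le_trans; apply.
  rewrite ler_pM2l// -natrX ler_nat; exact/ltnW/ltn_expl.
exists k => y; rewrite grid_cellE => yx i.
have := grid_cell_refl k x; rewrite grid_cellE => /(_ i) /andP[x1 x2].
have /andP[y1 y2] := yx i; rewrite ltr_distl; apply/andP; split; lra.
Qed.

End grid.

Lemma dyadic_descendants_grid (n0 : (0 < n)%N) a h P : 0 < h ->
  dyadic_descendants (cube a h) P -> exists k x, P = grid_cell a h k x.
Proof.
move=> h0 [b [h' [k [j [h'0 /(cube_inj n0 h0 h'0)[<- <-] ->]]]]].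
exists k; set c := (\row__ _); exists c.
rewrite grid_cellE//; congr cube; apply/rowP => i; rewrite !mxE.
congr (_ + _ * _); rewrite pmulrn; congr (_%:~R); apply/esym/eqP.
by rewrite grid_indexP// mxE /grid_side lexx ltrDl grid_side_gt0.
Qed.

(** Both cubes are cells of the grid of a common ancestor, where comparing levels decides. *)
Lemma dyadic_lattice_nested (n0 : (0 < n)%N) D P Q : dyadic_lattice D ->
  D P -> D Q -> [\/ P `<=` Q, Q `<=` P | P `&` Q = set0].
Proof.
move=> [Dcube _ anc _] DP DQ; have [Z DZ [ZP ZQ]] := anc _ _ DP DQ.
have [a [h [h0 Zah]]] := Dcube _ DZ; rewrite Zah in ZP ZQ.
have [k [x Px]] := dyadic_descendants_grid n0 h0 ZP.
have [l [y Qy]] := dyadic_descendants_grid n0 h0 ZQ.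
have [->|/set0P[z [Pz Qz]]] := eqVneq (P `&` Q) set0; first by constructor 3.
rewrite Px in Pz *; rewrite Qy in Qz *.
have [kl|/ltnW lk] := leqP k l.
  by constructor 2; exact: (grid_cell_nested kl Pz Qz).
by constructor 1; exact: (grid_cell_nested lk Qz Pz).
Qed.

End dyadic_grid.

(** * Outer regularity and stopping cubes *)

Section regularity.
Context {R : realType} {n : nat}.
Local Notation V := 'rV[R]_n.
Implicit Types (x y z : V) (i : 'I_n) (k l : nat) (P Q E O : set V).

(** A Lipschitz bound for the product at shift 0: lengthening all sides of a box by [d] changes its
    volume by [O(d)]. *)
Let prod_shift (I : Type) (s : seq I) (f : I -> R) : (forall j, 0 <= f j) ->
  exists2 C, 0 <= C & forall d, 0 <= d <= 1 ->
    \prod_(j <- s) (f j + d) <= \prod_(j <- s) f j + C * d.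
Proof.
move=> f0; elim: s => [|i s [C C0 ih]].
  by exists 0 => // d _; rewrite !big_nil mul0r addr0.
have P0 : 0 <= \prod_(j <- s) f j by exact: prodr_ge0.
exists (\prod_(j <- s) f j + f i * C + C).
  by rewrite !addr_ge0// mulr_ge0.
move=> d d01; rewrite !big_cons; have /andP[d0 d1] := d01.
have fi0 := f0 i.
apply: (le_trans (ler_wpM2l (addr_ge0 fi0 d0) (ih _ d01))).
have : C * d * d <= C * d * 1 by rewrite ler_wpM2l// mulr_ge0.
move: (\prod_(j <- s) f j) P0 => p P0; nra.
Qed.

Let box_vol_widen (p : V * V) (e : R) : 0 < e ->
  exists2 d, 0 < d & box_vol (p.1 - const_mx d, p.2) <= box_vol p + e.
Proof.
move=> e0.
have [|C C0 HC] := prod_shift (index_enum 'I_n)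
    (f := fun i => Num.max 0 (p.2 ord0 i - p.1 ord0 i)).
  by move=> i; rewrite le_max lexx.
exists (Num.min 1 (e / (C + 1))).
  by rewrite lt_min ltr01 divr_gt0// ltr_pwDr.
set d := Num.min _ _.
have d0 : 0 <= d by rewrite le_min ler01 divr_ge0// ?ltW// ltr_pwDr.
have d1 : d <= 1 by rewrite ge_min lexx.
have dC : C * d <= e.
  have : d <= e / (C + 1) by rewrite ge_min lexx orbT.
  rewrite ler_pdivlMr ?ltr_pwDr// => dCe; nra.
rewrite /box_vol; apply: (@le_trans _ _
    (\prod_(i < n) (Num.max 0 (p.2 ord0 i - p.1 ord0 i) + d))).
  apply: ler_prod => i _; rewrite le_max lexx/= !mxE.
  rewrite ge_max; apply/andP; split; first by rewrite addr_ge0// le_max lexx.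
  by rewrite opprB addrCA addrC lerD2r le_max lexx orbT.
by rewrite (le_trans (HC d _)) ?d0//; rewrite lerD2l.
Qed.

Section open_cover.
Variables (a : V) (h : R).
Hypothesis h0 : 0 < h.

(** Openness tested on the cells of one grid: it makes [O] a countable union of cells and is what
    the stopping argument asks of a neighbourhood. *)
Definition grid_open O := forall x, O x -> exists k, grid_cell a h k x `<=` O.

Lemma grid_open_measurable O : grid_open O -> measurable (O : set (Rn R n)).
Proof.
move=> Oo; pose S := [set P | (exists k x, P = grid_cell a h k x) /\ P `<=` O].
rewrite (_ : O = \bigcup_(P in S) P).
  apply: (@countable_bigcup_measurable _ _ (Rn R n) S (fun P => P)).
    by apply: sub_countable (grid_cell_countable a h); apply: subset_card_le => P [].
  by move=> _ [[k [x ->]] _]; rewrite grid_cellE//; exact: cube_measurable.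
apply/seteqP; split=> x; last by move=> [P [_]]; exact.
by move=> /Oo[k xO]; exists (grid_cell a h k x) => //; split => //; exists k, x.
Qed.

(** Widen the boxes of a nearly optimal covering. Only the lower faces move, since the upper faces
    of a half-open box are open already. One half of [e] pays for the covering, the other for the
    widening. *)
Lemma leb_outer_regular E (e : R) : 0 < e -> (leb_outer E < +oo)%E ->
  exists O, [/\ grid_open O, E `<=` O & (leb_outer O <= leb_outer E + e%:E)%E].
Proof.
move=> e0 Efin.
have fE : leb_outer E \is a fin_num by rewrite ge0_fin_numE ?leb_outer_ge0.
have [_ [F EF <-] ltF] := lb_ereal_inf_adherent (divr_gt0 e0 (ltr0Sn R 1)) fE.
pose r k := e / 2 / (2 ^ k.+1)%:R.
have r0 k : 0 < r k by rewrite !divr_gt0// ltr0n expn_gt0.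
have [d dP] : {d : nat -> R & forall k, 0 < d k /\
    forall p, F k = Some p ->
    box_vol (p.1 - const_mx (d k), p.2) <= box_vol p + r k}.
  apply: (@choice _ _ (fun k d => 0 < d /\ forall p, F k = Some p ->
    box_vol (p.1 - const_mx d, p.2) <= box_vol p + r k)) => k.
  case: (F k) => [p|]; last by exists 1.
  by have [d d0 dP] := box_vol_widen p (r0 k); exists d; split => // _ [<-].
pose U k := [set x : V | exists2 p, F k = Some p &
  forall i, p.1 ord0 i - d k < x ord0 i < p.2 ord0 i].
exists (\bigcup_k U k); split.
- move=> x [k _ [p Fk px]].
  pose g i := Num.min (x ord0 i - (p.1 ord0 i - d k)) (p.2 ord0 i - x ord0 i).
  pose m := \big[Num.min/1]_(i < n) g i.
  have m0 : 0 < m.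
    rewrite /m; elim/big_ind: _ => // [s t s0 t0|i _]; first by rewrite lt_min s0.
    by have /andP[? ?] := px i; rewrite /g lt_min !subr_gt0; apply/andP.
  have [l xl] := grid_cell_small a h0 x m0.
  exists l => y /xl yx; exists k => //; exists p => // i.
  have : `|y ord0 i - x ord0 i| < g i.
    by apply: (lt_le_trans (yx i)); exact: bigmin_le_cond.
  rewrite /g lt_min !ltr_norml => /andP[/andP[? ?] /andP[? ?]].
  by apply/andP; split; lra.
- move=> x /EF[k _ Fkx]; exists k => //; move: Fkx; rewrite /U/=.
  case Fk: (F k) => [p|//] px; exists p => // i.
  have /andP[? ->] := px i; have [? _] := dP k; rewrite andbT; lra.
pose G k := omap (fun p => (p.1 - const_mx (d k), p.2)) (F k).
apply: (@le_trans _ _ (\sum_(0 <= k <oo) obox_vol (G k))%E).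
  apply: ereal_inf_lbound; exists G => // x [k _ [p Fk px]].
  exists k => //; rewrite /G Fk => i /=; have /andP[+ ->] := px i.
  by rewrite !mxE => /ltW ->.
apply: (@le_trans _ _ (\sum_(0 <= k <oo) (obox_vol (F k) + (r k)%:E))%E).
  apply: lee_nneseries => [k _ _|k _]; first exact: obox_vol_ge0.
  rewrite /G; have [_] := dP k; case: (F k) => [p|] /= Hp.
    by rewrite -EFinD lee_fin; exact: Hp.
  by rewrite add0e lee_fin ltW.
have e20 : 0 <= e / 2 by rewrite divr_ge0// ltW.
apply: (le_trans (epsilon_trick xpredT _ e20)).
  by move=> k; exact: obox_vol_ge0.
apply: (le_trans (leeD2r _ (ltW ltF))).
by rewrite -addeA -EFinD leeD2l// lee_fin; lra.
Qed.

End open_cover.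

Section stopping.
Hypothesis leb_cube_gt0 : forall P, is_cube P -> (0 < leb P)%E.

Let leb_cube_fin P : is_cube P -> leb P \is a fin_num.
Proof.
by move=> [a [h [_ ->]]]; rewrite ge0_fin_numE ?leb_cube_fin// leb_outer_ge0.
Qed.

(* The cubes are the maximal grid cells filled at least half by a grid-open
   neighbourhood of [E]; no differentiation theorem is needed. *)
Lemma stopping_cubes Q E : is_cube Q -> measurable (E : set (Rn R n)) ->
  E `<=` Q -> (8%:E * leb E <= leb Q)%E ->
  exists S : set (set V),
  [/\ countable S, trivIset S id, E `<=` \bigcup_(P in S) P,
      (2%:E * leb (\bigcup_(P in S) P) <= leb Q)%E &
      forall P, S P -> [/\ is_cube P, P `<=` Q & exists P',
        [/\ is_cube P', P `<=` P', P' `<=` Q, (leb P' <= (2 ^ n)%:R%:E * leb P)%E &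
            (2%:E * leb (P' `&` E) <= leb P')%E]]].
Proof.
move=> [a [h [h0 Qah]]] mE EQ E8; have cQ : is_cube Q by exists a, h.
have Q0 := leb_cube_gt0 cQ; have Qf := leb_cube_fin cQ.
have Ef : leb E \is a fin_num.
  rewrite ge0_fin_numE ?leb_outer_ge0//.
  by apply: (le_lt_trans (le_leb_outer EQ)); rewrite ltey_eq Qf.
(* An error of [|Q| / 8] on top of [|E| <= |Q| / 8] leaves [|O| <= |Q| / 4]. *)
have q80 : 0 < fine (leb Q) / 8 by rewrite divr_gt0// fine_gt0// Q0 ltey_eq Qf.
have [|O [Oo EO leO]] := leb_outer_regular a h0 q80 (E := E).
  by rewrite ltey_eq Ef.
have mO := grid_open_measurable h0 Oo.
have O4 : (4%:E * leb O <= leb Q)%E.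
  have Of : leb O \is a fin_num.
    rewrite ge0_fin_numE ?leb_outer_ge0//; apply: (le_lt_trans leO).
    by rewrite lte_add_pinfty ?ltry// ltey_eq Ef.
  move: E8 leO; rewrite -/leb -[leb E]fineK// -[leb O]fineK// -[leb Q]fineK//.
  by rewrite -EFinD -!EFinM !lee_fin => ? ?; lra.
pose cell := grid_cell a h.
have ccell k x : is_cube (cell k x) by exact: grid_cell_is_cube.
have mcell k x : measurable (cell k x : set (Rn R n)).
  by have [b [r [_ ->]]] := ccell k x; exact: cube_measurable.
pose heavy k x := (leb (cell k x) < 2%:E * leb (cell k x `&` O))%E.
(* The cell of level 0 is [Q] itself. As it is not heavy, the first heavy level is some [k.+1], and
   a parent that is not heavy exists. *)
have heavy0 x : Q x -> ~ heavy 0%N x.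
  rewrite /heavy /cell Qah => /(grid_cell0 h0) ->; rewrite -Qah; apply/negP.
  rewrite -leNgt (le_trans _ O4)//.
  apply: (@le_trans _ _ (2%:E * leb O)%E).
    by rewrite lee_wpmul2l ?lee_fin//; exact: le_leb_outer.
  by rewrite lee_wpmul2r ?leb_outer_ge0// lee_fin; lra.
have heavy_eq k x y : cell k x y -> heavy k y = heavy k x.
  by move=> /grid_cell_eq xy; rewrite /heavy /cell xy.
pose S := [set P | exists k x, [/\ Q x, P = cell k.+1 x, heavy k.+1 x &
  forall j, (j <= k)%N -> ~ heavy j x]].
have cS : countable S.
  apply: sub_countable (grid_cell_countable a h); apply: subset_card_le.
  by move=> P [k [x [_ -> _ _]]]; exists k.+1, x.
have mS P : S P -> measurable (P : set (Rn R n)).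
  by move=> [k [x [_ -> _ _]]]; exact: mcell.
have tS : trivIset S id.
  suff H k x l y : (k <= l)%N -> heavy k.+1 x ->
      (forall j, (j <= l)%N -> ~ heavy j y) ->
      cell k.+1 x `&` cell l.+1 y !=set0 -> cell k.+1 x = cell l.+1 y.
    move=> _ _ [k [x [_ -> hx nx]]] [l [y [_ -> hy ny]]] xy.
    have [kl|/ltnW lk] := leqP k l; first exact: H xy.
    by apply/esym/H; rewrite // setIC.
  move=> kl hx ny [z [xz yz]].
  have yz' : cell k.+1 y z by move: z yz {xz}; exact: grid_cell_le.
  have [lk|kl'] := leqP l k.
    have {kl lk} -> : l = k by apply/eqP; rewrite eqn_leq lk.
    by rewrite /cell -(grid_cell_eq xz) -(grid_cell_eq yz').
  by case: (ny _ kl'); rewrite -(heavy_eq _ _ _ yz') (heavy_eq _ _ _ xz).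
exists S; split => //.
- move=> x Ex; have Qx := EQ _ Ex.
  have hx : exists k, `[< heavy k x >].
    (* A small cell lies inside [O] and has positive measure, hence is heavy; so every point of [E]
       is covered, without an exceptional set. *)
    have [k kO] := Oo _ (EO _ Ex); exists k; apply/asboolP; rewrite /heavy.
    rewrite setIidl//; have := leb_cube_gt0 (ccell k x).
    have := leb_cube_fin (ccell k x); case: (leb _) => // r _.
    by rewrite -EFinM !lte_fin => ?; lra.
  case: (ex_minnP hx) => -[/asboolP /(heavy0 _ Qx)//|k] /asboolP hk kmin.
  exists (cell k.+1 x); last by [].
  exists k, x; split => // j jk /asboolP /kmin; by rewrite ltnNge jk.
- rewrite (measure_countable_bigcup leb cS mS tS).
  (* Each stopping cell has less than twice the measure of its trace on [O], and the disjoint traces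
     add up to at most [|O| <= |Q| / 4]. *)
  apply: (@le_trans _ _ (2%:E * (2%:E * leb O))%E); last first.
    by rewrite muleA -EFinM (_ : 2 * 2 = 4 :> R)//; lra.
  rewrite lee_wpmul2l ?lee_fin//.
  apply: (@le_trans _ _ (\esum_(P in S) (2%:E * leb (P `&` O)))%E).
    by apply: le_esum => _ [k [x [_ -> hx _]]]; exact: ltW.
  rewrite esumZl//.
  rewrite lee_wpmul2l ?lee_fin//.
  rewrite -(measure_countable_bigcup leb cS (F := fun P => P `&` O)).
  + by apply: le_leb_outer => x [P _ []].
  + by move=> P SP; apply: measurableI => //; exact: mS.
  + by move=> P P' SP SP' [x [[Px _] [P'x _]]]; apply: tS => //; exists x.
- move=> P [k [x [Qx Pkx hx nx]]]; rewrite Pkx; split => //.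
    rewrite Qah -(grid_cell0 h0 (x := x)) -?Qah//; exact: grid_cell_le.
  exists (cell k x); split => //.
  + exact: grid_cellS.
  + rewrite Qah -(grid_cell0 h0 (x := x)) -?Qah//; exact: grid_cell_le.
  + by rewrite /cell !grid_cellE// grid_sideS; exact: leb_cube_half.
  (* The parent is not heavy, so [O], and a fortiori [E], fills at most half of it. *)
  + have /negP := nx k (leqnn k); rewrite -leNgt; apply: le_trans.
    by rewrite lee_wpmul2l ?lee_fin//; apply: le_leb_outer; exact: setIS.
Qed.

End stopping.
End regularity.

(** * The John-Nirenberg inequality for A_1 measures *)

Section A1_measures.
Context {R : realType} {n : nat}.
Local Notation V := 'rV[R]_n.
Implicit Types (Q P E : set V) (b : V -> R).

Definition A1_measure (a : R) (nu : {measure set (Rn R n) -> \bar R}) :=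
  forall Q, is_cube Q -> (nu Q < +oo)%E /\
  forall E, measurable (E : set (Rn R n)) -> E `<=` Q ->
    (nu Q * leb E <= a%:E * leb Q * nu E)%E.

(** Makes the unweighted John-Nirenberg inequality, used for the L(log L) averages, the case [a = 1]
    of the weighted one. *)
Lemma leb_A1_measure : A1_measure 1 leb.
Proof.
move=> _ [a [h [_ ->]]]; split=> [|E _ _]; first exact: leb_cube_fin.
by rewrite mul1e.
Qed.

Lemma is_cube_measurable Q : is_cube Q -> measurable (Q : set (Rn R n)).
Proof. by move=> [a [h [_ ->]]]; exact: cube_measurable. Qed.

Lemma leb_is_cube_fin Q : is_cube Q -> leb Q \is a fin_num.
Proof.
by move=> [a [h [_ ->]]]; rewrite ge0_fin_numE ?leb_cube_fin// leb_outer_ge0.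
Qed.

Lemma meas_fun_dist b (c : R) (D : set (Rn R n)) : meas_fun b ->
  measurable_fun D (fun x => `|b x - c|).
Proof.
move=> mb; apply: measurable_funTS.
have mbc := @measurable_funB _ (Rn R n) R setT b (cst c) mb (measurable_cst c).
exact: (measurableT_comp (@normr_measurable R setT) mbc).
Qed.

Lemma sub_fin_num (nu : {measure set (Rn R n) -> \bar R}) Q E :
  measurable (E : set (Rn R n)) -> measurable (Q : set (Rn R n)) -> E `<=` Q ->
  (nu Q < +oo)%E -> nu E \is a fin_num.
Proof.
move=> mE mQ EQ Qfin; rewrite ge0_fin_numE//; apply: le_lt_trans Qfin.
by apply: le_measure; rewrite ?inE.
Qed.

Section positive_cubes.
Hypothesis leb_cube_gt0 : forall Q, is_cube Q -> (0 < leb Q)%E.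

Lemma fine_leb_cube_gt0 Q : is_cube Q -> 0 < fine (leb Q).
Proof.
by move=> cQ; rewrite fine_gt0// leb_cube_gt0//= ltey_eq leb_is_cube_fin.
Qed.

(** The A_1 comparison is applied to the complement [Q \ E], which has at least half of the Lebesgue
    measure and therefore at least the fraction [1 / (2 a)] of [nu Q]. *)
Lemma A1_measure_half (a : R) nu Q E : 0 < a -> A1_measure a nu -> is_cube Q ->
  measurable (E : set (Rn R n)) -> E `<=` Q -> (2%:E * leb E <= leb Q)%E ->
  (nu E <= (1 - (2 * a)^-1)%:E * nu Q)%E.
Proof.
move=> a0 A1 cQ mE EQ EQ2; have [nuQ {}A1] := A1 _ cQ.
have mQ := is_cube_measurable cQ.
have mD : measurable (Q `\` E : set (Rn R n)) by exact: measurableD.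
have lQ := leb_is_cube_fin cQ; have lQ0 := fine_leb_cube_gt0 cQ.
have lE : leb E \is a fin_num.
  by apply: (@sub_fin_num leb Q) => //; rewrite ltey_eq lQ.
have nE := sub_fin_num mE mQ EQ nuQ.
have nQ : nu Q \is a fin_num by rewrite ge0_fin_numE.
have := A1 _ mD (@subDsetl _ _ _).
have DE (mu : {measure set (Rn R n) -> \bar R}) : (mu Q < +oo)%E ->
    mu (Q `\` E) = (mu Q - mu E)%E.
  by move=> Qoo; rewrite (measureD mQ mE Qoo); congr (_ - mu _)%E; exact/setIidr.
have DEl : leb (Q `\` E) = (leb Q - leb E)%E by apply: (DE leb); rewrite ltey_eq lQ.
rewrite (DE nu)// DEl.
move: lQ0 EQ2; rewrite -[nu Q]fineK// -[leb Q]fineK// -[leb E]fineK// -[nu E]fineK//=.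
rewrite -!EFinB -!EFinM !lee_fin.
have := fine_ge0 (measure_ge0 nu Q).
move: (fine (leb Q)) (fine (leb E)) (fine (nu Q)) (fine (nu E)).
move=> L e N f N0 L0 eL NL.
have {}NL : N * (L / 2) <= a * L * (N - f).
  by apply: (le_trans _ NL); rewrite ler_wpM2l//; lra.
have {}NL : N / 2 <= a * (N - f).
  by rewrite -(ler_pM2r L0); move: NL; congr (_ <= _); ring.
have : N / (2 * a) <= N - f.
  rewrite ler_pdivrMr ?mulr_gt0//; lra.
by rewrite mulrBl mul1r [_^-1 * _]mulrC; lra.
Qed.

End positive_cubes.
End A1_measures.

(* If [P'] is the grid parent of a stopping cube [P] of [Q], then
   [|<b>_P - <b>_P'| <= 2^n B] and [|<b>_P' - <b>_Q| <= 10 B]. *)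
Definition osc_step {R : realType} (n : nat) : R := 10 + (2 ^ n)%:R.

Section mean_oscillation.
Context {R : realType} {n : nat}.
Local Notation V := 'rV[R]_n.
Implicit Types (Q P E : set V) (b : V -> R).
Hypothesis leb_cube_gt0 : forall Q, is_cube Q -> (0 < leb Q)%E.

Lemma loc_integrable_cube b Q : loc_integrable b -> is_cube Q ->
  leb.-integrable (Q : set (Rn R n)) (EFin \o b).
Proof.
move=> [mb ib] [a [h [h0 ->]]]; apply/integrableP; split.
  by apply/measurable_EFinP; exact: measurable_funTS.
pose A i : set R := `[a ord0 i, a ord0 i + h]%classic.
have /ib : compact ([set x | forall i, A i (x ord0 i)] : set V).
  by apply: rV_compact => i; exact: segment_compact.
apply: le_lt_trans; apply: ge0_le_integral_set => // x xa i /=.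
by have /andP[? ?] := xa i; rewrite /A/= in_itv/=; apply/andP; split => //; exact: ltW.
Qed.

(** The [fine] inside [avg] loses nothing here: the integral is finite and [leb Q] is a positive
    real. *)
Lemma avgE b Q : loc_integrable b -> is_cube Q ->
  ((avg Q b)%:E * leb Q = \int[leb]_(x in Q) (b x)%:E)%E.
Proof.
move=> ib cQ; have /(integral_fune_fin_num (is_cube_measurable cQ)) :=
  loc_integrable_cube ib cQ.
rewrite /avg /eavg /comp; case: (integral _ _ _) => // r _.
have := fine_leb_cube_gt0 leb_cube_gt0 cQ; have := leb_is_cube_fin cQ.
case: (leb Q) => //= s _ s0; rewrite inver gt_eqF// -!EFinM/=.
by rewrite mulrC mulrA divff ?gt_eqF// mul1r.
Qed.

Lemma avg_dist_le b Q (c : R) : loc_integrable b -> is_cube Q ->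
  (`|avg Q b - c|%:E * leb Q <= \int[leb]_(x in Q) `|b x - c|%:E)%E.
Proof.
move=> ib cQ; have mQ := is_cube_measurable cQ.
have iQ := loc_integrable_cube ib cQ.
have mb : measurable_fun (Q : set (Rn R n)) b.
  by apply: measurable_funTS; case: ib.
have Qoo : (leb Q < +oo)%E by rewrite ltey_eq leb_is_cube_fin.
have ic : leb.-integrable (Q : set (Rn R n)) (EFin \o cst c).
  apply/integrableP; split; first by apply/measurable_EFinP; exact: measurable_cst.
  rewrite [X in (X < _)%E](integral_cst leb mQ `|c|%:E).
  by rewrite lte_mul_pinfty// lee_fin.
have mbc : measurable_fun (Q : set (Rn R n))
    (fun x => ((b x)%:E - (cst c x)%:E)%E).
  by apply/measurable_EFinP; apply: measurable_funB.
have := le_abse_integral leb mQ mbc.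
rewrite integralB_EFin// -avgE// [X in (_ - X)%E](_ : _ = (c%:E * leb Q)%E); last first.
  exact: (integral_cst leb mQ c%:E).
rewrite -[leb Q]fineK ?leb_is_cube_fin// -!EFinM -EFinB -mulrBl /=.
by rewrite normrM (ger0_norm (fine_ge0 (measure_ge0 leb Q))).
Qed.

Variables (B : R) (b : V -> R).
Hypotheses (B0 : 0 < B) (ib : loc_integrable b) (bB : (bmo_norm b <= B%:E)%E).

Lemma bmo_bound Q : is_cube Q ->
  (\int[leb]_(x in Q) `|b x - avg Q b|%:E <= B%:E * leb Q)%E.
Proof.
move=> cQ; have : (eavg Q (fun x => `|b x - avg Q b|%:E) <= B%:E)%E.
  by apply: le_trans bB; apply: ereal_sup_ubound; exists Q.
have := fine_leb_cube_gt0 leb_cube_gt0 cQ; have := leb_is_cube_fin cQ.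
rewrite /eavg; case: (leb Q) => //= s _ s0.
by rewrite inver gt_eqF// lee_pdivrMl// muleC.
Qed.

Definition osc_set Q (s : R) : set V := Q `&` [set x | s < `|b x - avg Q b|].

Lemma osc_set_measurable Q s : is_cube Q ->
  measurable (osc_set Q s : set (Rn R n)).
Proof.
move=> cQ; have mQ := is_cube_measurable cQ.
rewrite (_ : osc_set Q s = Q `&` (fun x => `|b x - avg Q b|) @^-1` `]s, +oo[%classic).
  have mf := meas_fun_dist (avg Q b) (D := Q) ib.1.
  exact: (mf mQ _ (measurable_itv _)).
by apply/seteqP; split=> x [Qx /=]; rewrite in_itv/= andbT.
Qed.

(** Chebyshev. In [8 = 2 * 2 * 2] one factor is spent on the open neighbourhood of [stopping_cubes],
    one on its half-filled cells, and the last is the half by which the stopping cubes shrink. *)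
Lemma leb_osc_set Q : is_cube Q ->
  (8%:E * leb (osc_set Q (8 * B)) <= leb Q)%E.
Proof.
move=> cQ; have mQ := is_cube_measurable cQ.
have mE := osc_set_measurable (8 * B) cQ.
have : ((8 * B)%:E * leb (osc_set Q (8 * B)) <= B%:E * leb Q)%E.
  apply: le_trans (bmo_bound cQ); rewrite -integral_cst//.
  apply: (@le_trans _ _
    (\int[leb]_(x in osc_set Q (8 * B)) `|b x - avg Q b|%:E)%E).
    apply: ge0_le_integral_on => x.
      by move=> _; rewrite lee_fin mulr_ge0// ltW.
    by move=> [_ /ltW]; rewrite lee_fin.
  by apply: ge0_le_integral_set => // x [].
by rewrite mulrC EFinM -muleA lee_pmul2l.
Qed.

Local Notation step := (@osc_step R n).

Let step_ge8 : 8 <= step. Proof. by rewrite /osc_step; have := ler0n R (2 ^ n); lra. Qed.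

Let avg_parent P P' : is_cube P -> is_cube P' -> P `<=` P' ->
  (leb P' <= (2 ^ n)%:R%:E * leb P)%E ->
  `|avg P b - avg P' b| <= (2 ^ n)%:R * B.
Proof.
move=> cP cP' PP' PP'2; have lP0 := fine_leb_cube_gt0 leb_cube_gt0 cP.
have : (`|avg P b - avg P' b|%:E * leb P <= ((2 ^ n)%:R * B)%:E * leb P)%E.
  apply: (le_trans (avg_dist_le _ ib cP)).
  apply: (le_trans (ge0_le_integral_set leb (B := P') _ _)) => //.
  apply: (le_trans (bmo_bound cP')).
  by rewrite mulrC EFinM -muleA lee_pmul2l.
move: lP0 (leb_is_cube_fin cP); case: (leb P) => //= s s0 _.
by rewrite -!EFinM lee_fin ler_pM2r.
Qed.

Let avg_half_arith (d p e c : R) : 0 < c -> 0 < p -> 2 * e <= p ->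
  d * (p - e) <= c * p + 8 * c * (p - e) -> d <= 10 * c.
Proof.
move=> c0 p0 ep dp; rewrite leNgt; apply/negP => dc.
have : (d - 8 * c) * (p / 2) <= (d - 8 * c) * (p - e).
  by rewrite ler_wpM2l//; lra.
have : 0 < (d - 10 * c) * p by rewrite mulr_gt0// subr_gt0.
nra.
Qed.

(** On at least half of [P] the function is within [8 B] of its mean over [Q]. Averaging over that
    half costs a factor 2 in the oscillation over [P], whence [2 B + 8 B]. *)
Let avg_half Q P : is_cube Q -> is_cube P -> P `<=` Q ->
  (2%:E * leb (P `&` osc_set Q (8 * B)) <= leb P)%E ->
  `|avg P b - avg Q b| <= 10 * B.
Proof.
move=> cQ cP PQ P2; have lP0 := fine_leb_cube_gt0 leb_cube_gt0 cP.
have mP := is_cube_measurable cP; have mE := osc_set_measurable (8 * B) cQ.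
have lP := leb_is_cube_fin cP; have Poo : (leb P < +oo)%E by rewrite ltey_eq lP.
pose c := `|avg P b - avg Q b|.
pose G := P `\` osc_set Q (8 * B).
have mG : measurable (G : set (Rn R n)) by exact: measurableD.
have lG : leb G \is a fin_num.
  by apply: (@sub_fin_num _ _ leb P) => //; exact: subDsetl.
have lE : leb (P `&` osc_set Q (8 * B)) \is a fin_num.
  by apply: (@sub_fin_num _ _ leb P) => //; exact: measurableI.
have GE : leb G = (leb P - leb (P `&` osc_set Q (8 * B)))%E.
  exact: (measureD mP mE Poo).
have : (c%:E * leb G <= B%:E * leb P + (8 * B)%:E * leb G)%E.
  rewrite -(integral_cst leb mG c%:E) -(integral_cst leb mG (8 * B)%:E).
  apply: (@le_trans _ _
    (\int[leb]_(x in G) (`|b x - avg P b|%:E + cst (8 * B)%:E x))%E).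
    apply: ge0_le_integral_on => x; first by move=> _; rewrite lee_fin /c.
    move=> [Px /=]; rewrite /osc_set/= => nE.
    have xQ : `|b x - avg Q b| <= 8 * B.
      by rewrite leNgt; apply/negP => xE; apply: nE; split => //; exact: PQ.
    rewrite lee_fin /c -(subrKA (b x)) (le_trans (ler_normD _ _))//.
    by rewrite lerD// distrC.
  have mbG : measurable_fun (G : set (Rn R n)) (fun x => `|b x - avg P b|%:E).
    by apply/measurable_EFinP; exact: (meas_fun_dist _ ib.1).
  have b0 (x : Rn R n) : G x -> (0 <= `|b x - avg P b|%:E)%E by rewrite lee_fin.
  have c0 (x : Rn R n) : G x -> (0 <= cst (8 * B)%:E x)%E.
    by move=> _; rewrite lee_fin mulr_ge0// ltW.
  rewrite (ge0_integralD leb mG b0 mbG c0 (measurable_cst _)).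
  rewrite leeD2r// (le_trans _ (bmo_bound cP))//.
  by apply: ge0_le_integral_set => // x [].
move: lP0 P2; rewrite GE -[leb P]fineK// -[leb (P `&` _)]fineK//=.
rewrite -EFinB -!EFinM -EFinD !lee_fin /c => p0 ep dp.
exact: (avg_half_arith B0 p0 ep dp).
Qed.

Let osc_set_step Q P (s : R) : 8 * B <= s -> is_cube Q -> P `<=` Q -> is_cube P ->
  (exists P', [/\ is_cube P', P `<=` P', P' `<=` Q,
    (leb P' <= (2 ^ n)%:R%:E * leb P)%E &
    (2%:E * leb (P' `&` osc_set Q (8 * B)) <= leb P')%E]) ->
  osc_set Q s `&` P `<=` osc_set P (s - step * B).
Proof.
move=> s8 cQ PQ cP [P' [cP' PP' P'Q PP'2 P'E]] x [[Qx /= sx] Px]; split => //=.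
have := avg_parent cP cP' PP' PP'2; have := avg_half cQ cP' P'Q P'E.
have : `|b x - avg Q b| <= `|b x - avg P b| + `|avg P b - avg P' b| +
    `|avg P' b - avg Q b|.
  rewrite -(subrKA (avg P' b)) (le_trans (ler_normD _ _))// lerD2r.
  by rewrite -(subrKA (avg P b)) ler_normD.
rewrite /osc_step; lra.
Qed.

(** Induction on [j], with [Q] varying. Where [b] is far from its mean over [Q], it is far from its
    mean over the stopping cube, by one [step * B] less; and by [A1_measure_half] the stopping cubes
    carry at most the fraction [1 - 1 / (2 a)] of [nu Q]. The height of a step does not depend on
    [a]. *)
Lemma john_nirenberg (a : R) nu (j : nat) Q : 1 <= a -> A1_measure a nu ->
  is_cube Q ->
  (nu (osc_set Q (step * B *+ j)) <= ((1 - (2 * a)^-1) ^+ j)%:E * nu Q)%E.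
Proof.
move=> a1 A1; have a0 : 0 < a by exact: lt_le_trans a1.
have th0 : 0 <= 1 - (2 * a)^-1.
  by rewrite subr_ge0 invf_le1 ?mulr_gt0//; lra.
elim: j Q => [|j ih] Q cQ.
  rewrite expr0 mul1e le_measure ?inE//; last by move=> x [].
    exact: osc_set_measurable.
  exact: is_cube_measurable.
have := stopping_cubes leb_cube_gt0 cQ (osc_set_measurable (8 * B) cQ) _ (leb_osc_set cQ).
case; first by move=> x [].
move=> S [cS tS ES S2 Scube].
have mS P : S P -> measurable (P : set (Rn R n)).
  by case/Scube => cP _ _; exact: is_cube_measurable.
have s8 : 8 * B <= step * B *+ j.+1.
  apply: (@le_trans _ _ (step * B)); first by rewrite ler_pM2r//; exact: step_ge8.
  by rewrite mulrSr lerDr mulrn_wge0// mulr_ge0 ?ltW// (lt_le_trans _ step_ge8).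
have sub : osc_set Q (step * B *+ j.+1) `<=`
    \bigcup_(P in S) osc_set P (step * B *+ j).
  move=> x [Qx /= sx]; have [|P SP Px] := ES x.
    by split => //=; exact: le_lt_trans sx.
  exists P => //; have [cP PQ PP'] := Scube _ SP.
  have := @osc_set_step Q P _ s8 cQ PQ cP PP' x (conj (conj Qx sx) Px).
  by rewrite mulrSr addrK.
have mO P : S P -> measurable (osc_set P (step * B *+ j) : set (Rn R n)).
  by case/Scube => cP _ _; exact: osc_set_measurable.
apply: (@le_trans _ _ (\esum_(P in S) nu (osc_set P (step * B *+ j)))%E).
  apply: le_trans (measure_countable_bigcup_le nu cS mO).
  apply: le_measure; rewrite ?inE//; first exact: osc_set_measurable.
  exact: countable_bigcup_measurable.
apply: (@le_trans _ _ (\esum_(P in S) (((1 - (2 * a)^-1) ^+ j)%:E * nu P))%E).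
  by apply: le_esum => P /Scube[cP _ _]; exact: ih.
rewrite esumZl ?exprn_ge0// -(measure_countable_bigcup nu cS mS tS).
rewrite exprSr EFinM -muleA lee_wpmul2l ?lee_fin ?exprn_ge0//.
apply: (A1_measure_half leb_cube_gt0) => //.
  exact: countable_bigcup_measurable.
by move=> x [P /Scube[_ PQ _]]; exact: PQ.
Qed.

End mean_oscillation.

(** * Exponential integrability of the oscillation *)

Section exponential_integrability.
Context {R : realType}.

Lemma nneseries_ge_term (u : nat -> \bar R) j : (forall k, 0 <= u k)%E ->
  (u j <= \sum_(0 <= k <oo) u k)%E.
Proof.
move=> u0; apply: (@le_trans _ _ (\sum_(0 <= k < j.+1) u k)%E).
  by rewrite big_nat_recr//= leeDr// sume_ge0.
by apply: nneseries_lim_ge.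
Qed.

Lemma nneseries_geometric_le (c q : R) : 0 <= c -> 0 < q -> q < 1 ->
  (\sum_(0 <= k <oo) (c * q ^+ k)%:E <= (c / (1 - q))%:E)%E.
Proof.
move=> c0 q0 q1; apply: lime_le.
  apply: is_cvg_nneseries => k _ _.
  by rewrite lee_fin mulr_ge0// exprn_ge0// ltW.
apply: nearW => k; rewrite sumEFin lee_fin.
by apply: (geometric_le_lim k c0 q0); rewrite ger0_norm// ltW.
Qed.

Context {n : nat}.
Local Notation V := 'rV[R]_n.
Implicit Types (Q P E : set V).
Hypothesis leb_cube_gt0 : forall Q, is_cube Q -> (0 < leb Q)%E.
Variables (B : R) (b : V -> R).
Hypotheses (B0 : 0 < B) (ib : loc_integrable b) (bB : (bmo_norm b <= B%:E)%E).
Local Notation step := (@osc_step R n).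

Lemma osc_step_gt0 : 0 < step. Proof. by rewrite ltr_pwDl. Qed.

(** For [k = 1 / (4 a)] the John-Nirenberg decay factor is [1 - 2 k], so after multiplication by the
    growth [expR k] per layer the series still has ratio at most [1 - k]. The proof compares
    [1 - 2 k <= (1 - k)^2] with [expR k <= 1 / (1 - k)]. *)
Let kappa_bound (k : R) : 0 < k -> k <= 4^-1 ->
  expR k * (1 - 2 * k) <= 1 - k /\ expR k <= 4 / 3.
Proof.
move=> k0 k4; have : 1 - k <= expR (- k) by rewrite (le_trans _ (expR_ge1Dx _)).
rewrite expRN => ek; have ek0 := expR_gt0 k.
have {}ek : expR k * (1 - k) <= 1 by rewrite -ler_pdivlMl// mulr1.
split; last by nra.
have : expR k * (1 - 2 * k) <= expR k * ((1 - k) * (1 - k)).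
  by rewrite ler_pM2l//; nra.
by rewrite mulrA => /le_trans; apply; nra.
Qed.

(** The shift to [j.+2] reflects the strict inequality in [osc_set]: if [y] lies between [(j+1) T]
    and [(j+2) T], possibly at the lower end, it is strictly above [j T], and the exponential is
    below its value at [j+2]. *)
Let exp_layers (k T y : R) : 0 <= k -> 0 < T -> 0 <= y ->
  ((expR (k * (y / T)))%:E <= (expR k)%:E + \sum_(0 <= j <oo)
     ((expR (k * j.+2%:R))%:E * ((T *+ j < y)%R%:R)%:E))%E.
Proof.
move=> k0 T0 y0; have yT : 0 <= y / T by rewrite divr_ge0// ltW.
have s0 j : (0 <= (expR (k * j.+2%:R))%:E * ((T *+ j < y)%R%:R)%:E)%E.
  by rewrite mule_ge0// lee_fin ?expR_ge0.
have /andP[] := truncn_itv yT; case: (Num.trunc _) => [|j] j1 j2.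
  apply: (@le_trans _ _ (expR k)%:E).
    by rewrite lee_fin ler_expR -[leRHS]mulr1 ler_wpM2l// ltW.
  by rewrite leeDl// nneseries_ge0.
apply: (@le_trans _ _ ((expR (k * j.+2%:R))%:E * ((T *+ j < y)%R%:R)%:E)%E).
  have -> : (T *+ j < y)%R.
    apply: (@lt_le_trans _ _ (T *+ j.+1)); first by rewrite mulrSr ltrDl.
    by move: j1; rewrite ler_pdivlMr// mulr_natl.
  by rewrite mule1 lee_fin ler_expR ler_wpM2l// ltW.
apply: (le_trans (nneseries_ge_term j s0)).
by rewrite leeDr// lee_fin expR_ge0.
Qed.

(** Summing over layers of height [step * B] gives a geometric series of ratio [1 - k] and sum of
    order [1 / k = 4 a]: both the exponent and the bound depend linearly on [a]. *)
Lemma john_nirenberg_exp (a : R) nu Q : 1 <= a -> A1_measure a nu ->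
  is_cube Q ->
  (\int[nu]_(x in Q) (expR (`|b x - avg Q b| / (4 * a * step * B)))%:E <=
   (9 * a)%:E * nu Q)%E.
Proof.
move=> a1 A1 cQ; have mQ := is_cube_measurable cQ.
have a0 : 0 < a by exact: lt_le_trans a1.
have T0 : 0 < step * B by rewrite mulr_gt0// osc_step_gt0.
pose k := (4 * a)^-1; have k0 : 0 < k by rewrite invr_gt0 mulr_gt0.
have k4 : k <= 4^-1 by rewrite lef_pV2 ?posrE ?mulr_gt0//; lra.
have [kq k43] := kappa_bound k0 k4.
pose g j x : \bar R :=
  ((expR (k * j.+2%:R))%:E * (\1_(osc_set b Q (step * B *+ j)) x)%:E)%E.
have mE j := osc_set_measurable ib (step * B *+ j) cQ.
have mg j : measurable_fun (Q : set (Rn R n)) (g j).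
  apply: measurable_funTS; apply/measurable_EFinP.
  apply: measurable_funM; first exact: measurable_cst.
  by apply: measurable_indic; exact: mE.
have g0 j x : (0 <= g j x)%E.
  by rewrite mule_ge0// lee_fin ?expR_ge0.
apply: (@le_trans _ _ (\int[nu]_(x in Q)
    ((cst (expR k)%:E x) + \sum_(0 <= j <oo) g j x))%E).
  apply: ge0_le_integral_on => x Qx; first by rewrite lee_fin expR_ge0.
  have := exp_layers (ltW k0) T0 (normr_ge0 (b x - avg Q b)).
  rewrite (_ : k * _ = `|b x - avg Q b| / (4 * a * step * B)); last first.
    by rewrite /k -(mulrA _ step) (invfM (4 * a)) mulrCA mulrA.
  move=> /le_trans; apply; rewrite leeD2l//.
  apply: lee_nneseries => j _ *; first by rewrite mule_ge0// lee_fin ?expR_ge0.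
  rewrite /g indicE lee_wpmul2l ?lee_fin ?expR_ge0// ler_nat.
  by case: ltP => // jx; rewrite mem_set.
have e0 (x : Rn R n) : Q x -> (0 <= cst (expR k)%:E x)%E.
  by move=> _; rewrite lee_fin expR_ge0.
have sg0 (x : Rn R n) : Q x -> (0 <= \sum_(0 <= j <oo) g j x)%E.
  by move=> _; exact: nneseries_ge0.
have msg : measurable_fun (Q : set (Rn R n))
    (fun x => \sum_(0 <= j <oo) g j x)%E.
  by apply: ge0_emeasurable_sum => // j x _ _; exact: g0.
rewrite (ge0_integralD nu mQ e0 (measurable_cst _) sg0 msg).
rewrite integral_cst// integral_nneseries//.
have nuQ0 : (0 <= nu Q)%E by [].
have [nuQoo _] := A1 _ cQ.
have nuQE : nu Q = (fine (nu Q))%:E by rewrite fineK// ge0_fin_numE.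
have N0 : 0 <= fine (nu Q) by exact: fine_ge0.
move: (fine (nu Q)) nuQE N0 => N nuQE N0.
apply: (@le_trans _ _ ((expR k)%:E * nu Q +
    (expR k ^+ 2 / (1 - (1 - k)))%:E * nu Q)%E).
  rewrite leeD2l//.
  apply: (@le_trans _ _ (\sum_(0 <= j <oo)
      ((expR k ^+ 2 * (1 - k) ^+ j)%:E * nu Q))%E); last first.
    rewrite nuQE -EFinM [leRHS](_ : _ = (expR k ^+ 2 * N / (1 - (1 - k)))%:E); last first.
      by congr (_%:E); ring.
    under eq_eseriesr => j _.
      rewrite -EFinM (_ : _ * N = expR k ^+ 2 * N * (1 - k) ^+ j); last by ring.
      over.
    apply: nneseries_geometric_le.
    - by rewrite mulr_ge0// exprn_ge0// expR_ge0.
    - by move: k4; lra.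
    - by lra.
  apply: lee_nneseries => [j _ _|j _]; first exact: integral_ge0.
  rewrite /g ge0_integralZl//; last first.
    by apply/measurable_EFinP; exact: measurable_indic.
  rewrite integral_indic//.
  rewrite (_ : osc_set _ _ _ `&` Q = osc_set b Q (step * B *+ j)); last first.
    by apply/seteqP; split=> [x []//|x [Qx ?]]; split.
  apply: (@le_trans _ _ ((expR (k * j.+2%:R))%:E *
      (((1 - (2 * a)^-1) ^+ j)%:E * nu Q))%E).
    rewrite lee_wpmul2l ?lee_fin ?expR_ge0//.
    exact: (john_nirenberg leb_cube_gt0 B0 ib bB j a1 A1 cQ).
  rewrite muleA -EFinM lee_wpmul2r// lee_fin.
  rewrite (_ : (2 * a)^-1 = 2 * k); last by rewrite /k; field; lra.
  rewrite expRM_natr -(addn2 j) exprD mulrAC -exprMn mulrC.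
  rewrite ler_wpM2l ?exprn_ge0 ?expR_ge0// lerXn2r// nnegrE.
    by rewrite mulr_ge0 ?expR_ge0//; lra.
  by move: k4; lra.
(* With [expR k <= 4/3] the total is at most [4/3 + (16/9) * 4 a], which is below [9 a] since
   [a >= 1]. *)
rewrite nuQE -!EFinM -EFinD lee_fin -mulrDl ler_wpM2r//.
rewrite (_ : 1 - (1 - k) = k); last by ring.
have -> : expR k ^+ 2 / k = expR k ^+ 2 * (4 * a) by rewrite /k invrK.
have : expR k ^+ 2 <= (4 / 3) ^+ 2 by rewrite lerXn2r// nnegrE ?expR_ge0//; lra.
move: k43 a1; rewrite !expr2; move: (expR k) => e; nra.
Qed.

End exponential_integrability.

(** * L(log L) averages *)

Section LlogL.
Context {R : realType} {n : nat}.
Local Notation V := 'rV[R]_n.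
Implicit Types (Q P : set V) (f g b : V -> R).
Hypothesis leb_cube_gt0 : forall Q, is_cube Q -> (0 < leb Q)%E.

Lemma eavg_le Q (g : V -> \bar R) (c : R) : is_cube Q ->
  (eavg Q g <= c%:E)%E = (\int[leb]_(x in Q) g x <= c%:E * leb Q)%E.
Proof.
move=> cQ; have := fine_leb_cube_gt0 leb_cube_gt0 cQ.
have := leb_is_cube_fin cQ.
rewrite /eavg; case: (leb Q) => //= s _ s0.
by rewrite inver gt_eqF// lee_pdivrMl// muleC.
Qed.

Lemma eavg_ge0 Q (g : V -> \bar R) : (forall x, 0 <= g x)%E -> (0 <= eavg Q g)%E.
Proof.
by move=> g0; rewrite mule_ge0 ?inve_ge0 ?leb_outer_ge0// integral_ge0.
Qed.

Lemma phi_ge (s : R) : 0 <= s -> s <= phi s.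
Proof.
move=> s0; rewrite /phi -[leLHS]mulr1 ler_wpM2l//.
by rewrite -[leLHS]expRK ler_ln ?posrE ?lerDl// ?expR_gt0// ltr_wpDr// expR_gt0.
Qed.

Lemma phi_ge0 (s : R) : 0 <= s -> 0 <= phi s.
Proof. by move=> s0; apply: le_trans (phi_ge s0). Qed.

(** Young's inequality by cases: if [y <= ln (e + s)] the first term suffices; otherwise
    [s <= expR y], and the second [expR y] absorbs the factor [y]. *)
Lemma phi_young (s y : R) : 0 <= s -> 0 <= y -> s * y <= phi s + expR (2 * y).
Proof.
move=> s0 y0; have es0 : 0 < expR 1 + s by rewrite ltr_pwDl// expR_gt0.
have [ys|sy] := leP y (ln (expR 1 + s)).
  apply: (@le_trans _ _ (phi s)); first by rewrite ler_wpM2l.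
  by rewrite lerDl expR_ge0.
have ses : s <= expR y.
  move: sy; rewrite -ltr_expR lnK ?posrE// => /ltW; apply: le_trans.
  by rewrite lerDr expR_ge0.
apply: (@le_trans _ _ (expR (2 * y))); last by rewrite lerDr phi_ge0.
rewrite mulr_natl mulr2n expRD ler_pM//.
by rewrite (le_trans _ (expR_ge1Dx _))// lerDr.
Qed.

Lemma phi_small (s : R) : 0 <= s -> s <= 2^-1 -> phi s <= 1.
Proof.
move=> s0 s2; have e2 : expR 1 + s <= expR 2.
  have : expR 2 = expR 1 * expR 1 :> R by rewrite -expRD.
  have := expR_ge1Dx (1 : R); move: (expR 1) => e; nra.
have : ln (expR 1 + s) <= 2.
  by rewrite -[leRHS]expRK ler_ln ?posrE ?expR_gt0// ltr_pwDl// expR_gt0.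
have : 0 <= ln (expR 1 + s).
  by rewrite ln_ge0//; have := expR_ge1Dx (1 : R); lra.
rewrite /phi; nra.
Qed.

Lemma LlogL_norm_ge0 f Q : (0 <= LlogL_norm f Q)%E.
Proof. by apply: le_ereal_inf_tmp => _ [t [t0 _] <-]; rewrite lee_fin ltW. Qed.

Lemma LlogL_norm_fin f Q : bounded_compact_support f -> is_cube Q ->
  (LlogL_norm f Q < +oo)%E.
Proof.
move=> [mf [M fM] _] cQ; have mQ := is_cube_measurable cQ.
(* Then [|f| / t <= 1/2], the range of [phi_small]; the summand 1 keeps [t] positive when [M] is
   0. *)
pose t := 2 * (`|M| + 1); have t0 : 0 < t by rewrite mulr_gt0// ltr_wpDl.
apply: (@le_lt_trans _ _ t%:E); last by rewrite ltry.
apply: ereal_inf_lbound; exists t => //; split => //.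
rewrite eavg_le// -integral_cst//.
apply: ge0_le_integral_on => x _.
  by rewrite lee_fin phi_ge0// divr_ge0// ltW.
rewrite lee_fin phi_small// ?divr_ge0 ?(ltW t0)//.
rewrite ler_pdivrMr// /t mulrA mulVf// mul1r (le_trans (fM x))//.
by rewrite (le_trans (ler_norm _))// lerDl.
Qed.

Lemma meas_fun_norm_div f (t : R) : meas_fun f -> meas_fun (fun x => `|f x| / t).
Proof.
move=> mf; have mn := measurableT_comp (@normr_measurable R setT) mf.
exact: (@measurable_funM _ (Rn R n) R setT _ (cst t^-1) mn (measurable_cst _)).
Qed.

Lemma eavg_le_LlogL f Q : is_cube Q -> meas_fun f ->
  (eavg Q (fun y => `|f y|%:E) <= LlogL_norm f Q)%E.
Proof.
move=> cQ mf; have mQ := is_cube_measurable cQ.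
apply: le_ereal_inf_tmp => _ [t [t0 + <-]]; rewrite !eavg_le// mul1e => ft.
apply: (@le_trans _ _ (t%:E * \int[leb]_(x in Q) (`|f x| / t)%:E)%E); last first.
  rewrite lee_pmul2l//.
  apply: le_trans ft.
  apply: ge0_le_integral_on => x _; first by rewrite lee_fin divr_ge0// ltW.
  by rewrite lee_fin phi_ge// divr_ge0// ltW.
rewrite -ge0_integralZl//; last 3 first.
- by apply/measurable_EFinP; exact: (measurable_funTS (meas_fun_norm_div t mf)).
- by move=> x _; rewrite lee_fin divr_ge0// ltW.
- by rewrite lee_fin ltW.
apply: ge0_le_integral_on => x _; first by rewrite lee_fin.
by rewrite -EFinM lee_fin mulrCA divff ?gt_eqF// mulr1.
Qed.

Lemma meas_fun_phi f (t : R) (D : set (Rn R n)) : meas_fun f ->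
  measurable_fun D (fun x => phi (`|f x| / t)).
Proof.
move=> mf; apply: measurable_funTS; have ms := meas_fun_norm_div t mf.
have me := @measurable_funD _ (Rn R n) R setT (cst (expR 1)) _
  (measurable_cst _) ms.
have ml := measurableT_comp (@measurable_ln R) me.
exact: (@measurable_funM _ (Rn R n) R setT _ _ ms ml).
Qed.

(** [phi_young] is applied to [|f| / t], for [t] admissible in the Luxemburg norm, and to
    [|b - <b>_Q| / K]. The choice [K = 8 step B] turns [2 y] into the exponent of
    [john_nirenberg_exp] at [a = 1]; the two integrals are at most [|Q|] and [9 |Q|], which gives
    [10 K]. *)
Lemma eavg_osc_mul_le (B : R) b f Q : 0 < B -> loc_integrable b ->
  (bmo_norm b <= B%:E)%E -> is_cube Q -> meas_fun f ->
  (eavg Q (fun y => `|(b y - avg Q b) * f y|%:E) <=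
   (80 * osc_step n * B)%:E * LlogL_norm f Q)%E.
Proof.
move=> B0 ib bB cQ mf; have mQ := is_cube_measurable cQ.
set K := 8 * osc_step n * B.
have K0 : 0 < K by rewrite !mulr_gt0// osc_step_gt0.
have -> : 80 * osc_step n * B = 10 * K by rewrite /K; ring.
rewrite -lee_pdivrMl ?mulr_gt0// ?osc_step_gt0//.
apply: le_ereal_inf_tmp => _ [t [t0 ft] <-].
rewrite lee_pdivrMl ?mulr_gt0// ?osc_step_gt0// -EFinM eavg_le//.
rewrite eavg_le// mul1e in ft.
pose g x : R := phi (`|f x| / t) +
  expR (`|b x - avg Q b| / (4 * 1 * osc_step n * B)).
have mg : measurable_fun (Q : set (Rn R n))
    (fun x => expR (`|b x - avg Q b| / (4 * 1 * osc_step n * B))).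
  have mb := meas_fun_dist (avg Q b) (D := Q) ib.1.
  have mbc := @measurable_funM _ (Rn R n) R Q _ (cst (4 * 1 * osc_step n * B)^-1)
    mb (measurable_cst _).
  exact: (measurableT_comp (@measurable_expR R) mbc).
have mph := meas_fun_phi t (D := Q) mf.
apply: (@le_trans _ _ ((t * K)%:E * \int[leb]_(x in Q) (g x)%:E)%E).
  rewrite -ge0_integralZl//; last 3 first.
  - by apply/measurable_EFinP; exact: measurable_funD.
  - move=> x _; rewrite lee_fin addr_ge0// ?expR_ge0// phi_ge0//.
    by rewrite divr_ge0// ltW.
  - by rewrite lee_fin mulr_ge0// ltW.
  apply: ge0_le_integral_on => x _; first by rewrite lee_fin.
  rewrite -EFinM lee_fin normrM.
  have := phi_young (s := `|f x| / t) (y := `|b x - avg Q b| / K).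
  rewrite !divr_ge0 ?(ltW t0) ?(ltW K0)// => /(_ erefl erefl).
  rewrite (_ : 2 * _ = `|b x - avg Q b| / (4 * 1 * osc_step n * B)); last first.
    by rewrite /K; field; rewrite !gt_eqF// osc_step_gt0.
  rewrite -/(g x) => /(ler_wpM2l (ltW (mulr_gt0 t0 K0))); apply: le_trans.
  rewrite le_eqVlt; apply/orP; left; apply/eqP.
  by field; rewrite !gt_eqF.
have gE : (\int[leb]_(x in Q) (g x)%:E <= 10%:E * leb Q)%E.
  under eq_integral do rewrite EFinD.
  rewrite ge0_integralD; last 5 first.
  - exact: mQ.
  - by move=> x _; rewrite lee_fin phi_ge0// divr_ge0// ltW.
  - by apply/measurable_EFinP.
  - by move=> x _; rewrite lee_fin expR_ge0.
  - by apply/measurable_EFinP.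
  rewrite (_ : 10 = 1 + 9 * 1) ?mulr1; last by ring.
  rewrite EFinD ge0_muleDl ?lee_fin// mul1e leeD//.
  have := john_nirenberg_exp leb_cube_gt0 B0 ib bB (lexx 1) leb_A1_measure cQ.
  by rewrite !mulr1.
apply: (@le_trans _ _ ((t * K)%:E * (10%:E * leb Q))%E).
  by rewrite lee_wpmul2l// lee_fin mulr_ge0// ltW.
by rewrite muleA -EFinM (_ : t * K * 10 = 10 * K * t)//; ring.
Qed.

End LlogL.

(** * Sparse families *)

Section sparse_families.
Context {R : realType} {n : nat}.
Local Notation V := 'rV[R]_n.
Implicit Types (Q P : set V) (S D : set (set V)).
Hypothesis n0 : (0 < n)%N.

(** Restarting the grid at one of its own cells shifts all integer parts by a fixed integer, so the
    cells remain the same. *)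
Lemma grid_index_corner (a : V) (h : R) (l j : nat) (x y : V) i : 0 < h ->
  grid_index (grid_corner a h l y) (grid_side h l) j x i =
  grid_index a h (l + j) x i - grid_index a h l y i * 2 ^+ j.
Proof.
move=> h0; rewrite /grid_index mxE -/(grid_index a h l y i).
set I := grid_index a h l y i.
have -> : grid_side (grid_side h l) j = grid_side h (l + j).
  by rewrite /grid_side exprD invfM mulrA.
rewrite [X in Num.floor X](_ : _ = (x ord0 i - a ord0 i) / grid_side h (l + j) +
    (- (I * 2 ^+ j))%:~R).
  by rewrite floorDrz ?intrKfloor// rpred_int_num.
rewrite opprD addrA mulrBl; congr (_ + _).
rewrite rmorphN rmorphM rmorphXn/= /grid_side exprD.
have e2 : (2 : R) ^+ l != 0 by rewrite expf_neq0.
have e2' : (2 : R) ^+ j != 0 by rewrite expf_neq0.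
by field; rewrite e2 e2' gt_eqF.
Qed.

Lemma grid_cell_corner (a : V) (h : R) (l j : nat) (x y : V) : 0 < h ->
  grid_cell (grid_corner a h l y) (grid_side h l) j x = grid_cell a h (l + j) x.
Proof.
move=> h0; apply/seteqP; split=> z xz i.
  by have := xz i; rewrite !grid_index_corner// => /addIr.
by rewrite !grid_index_corner// xz.
Qed.

(** Choose for each [N] a member containing [[-N, N]^n]. Every member lies inside one of these, and
    through a common ancestor it is seen to be a cell of the countable grid of that chosen cube. *)
Lemma dyadic_lattice_countable D : dyadic_lattice D -> countable D.
Proof.
move=> [Dcube _ anc Dexh].
pose K (N : nat) : set V := [set x | forall i, `[- N%:R, N%:R]%classic (x ord0 i)].
have KE N : exists ah : V * R, [/\ 0 < ah.2, D (cube ah.1 ah.2) &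
    K N `<=` cube ah.1 ah.2].
  have [|Q DQ KQ] := Dexh (K N).
    apply: (@rV_compact R n (fun=> `[- N%:R, N%:R]%classic)) => i.
    exact: segment_compact.
  have [a [h [h0 QE]]] := Dcube _ DQ.
  by exists (a, h); rewrite -QE; split.
have [ah ahP] := choice KE.
pose C N := [set P | exists k x, P = grid_cell (ah N).1 (ah N).2 k x].
apply: (@sub_countable _ _ _ (\bigcup_N C N)); last first.
  by apply: bigcup_countable => // N _; exact: grid_cell_countable.
apply: subset_card_le => P DP; have [a [h [h0 PE]]] := Dcube _ DP.
pose N := (\max_(i < n) (Num.bound (`|a ord0 i| + h)))%N.
have [r0 DN KN] := ahP N; exists N => //.
have PN : P `<=` cube (ah N).1 (ah N).2.
  apply: subset_trans KN; rewrite PE => x xa i /=; rewrite in_itv/=.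
  rewrite -ler_norml; have /andP[x1 x2] := xa i.
  apply: (@le_trans _ _ (`|a ord0 i| + h)).
    rewrite ler_norml; have := ler_norm (a ord0 i).
    by have := ler_norm (- a ord0 i); rewrite normrN; lra.
  apply: (@le_trans _ _ (Num.bound (`|a ord0 i| + h))%:R).
    by apply/ltW/archi_boundP; rewrite addr_ge0// ltW.
  by rewrite ler_nat; exact: (@leq_bigmax _ (fun i => Num.bound (`|a ord0 i| + h))).
have [Z DZ [ZP ZQ]] := anc _ _ DP DN.
have [c [s [s0 Zcs]]] := Dcube _ DZ; rewrite Zcs in ZP ZQ.
have [k [x Px]] := dyadic_descendants_grid n0 s0 ZP.
have [l [y Qy]] := dyadic_descendants_grid n0 s0 ZQ.
have := Qy; rewrite grid_cellE// => /cube_inj[//|//||aE hE].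
  exact: grid_side_gt0.
have Qx : grid_cell c s l y x by rewrite -Qy; apply: PN; rewrite Px.
have [kl|lk] := leqP k l.
  (* Here [P] is the coarser cell and yet contained in the chosen cube, so the two coincide. *)
  exists 0%N, x; rewrite grid_cell0//; last by apply: PN; rewrite Px.
  apply/seteqP; split => //; rewrite Qy Px -(grid_cell_eq Qx).
  exact: grid_cell_le.
exists (k - l)%N, x; rewrite aE hE grid_cell_corner// subnKC//.
exact: ltnW.
Qed.

Section one_family.
Variables (S : set (set V)) (eta : R).
Hypotheses (eta0 : 0 < eta) (Ssparse : sparse eta S).
Hypothesis leb_cube_gt0 : forall Q, is_cube Q -> (0 < leb Q)%E.

Lemma sparse_countable : countable S.
Proof.
have [[D DD SD] _] := Ssparse.
by apply: sub_countable (dyadic_lattice_countable DD); exact: subset_card_le.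
Qed.

Lemma sparse_is_cube Q : S Q -> is_cube Q.
Proof. by have [[D [DC _ _ _] SD] _] := Ssparse; move=> /SD /DC. Qed.

Lemma sparse_measurable Q : S Q -> measurable (Q : set (Rn R n)).
Proof. by move=> /sparse_is_cube; exact: is_cube_measurable. Qed.

Lemma sparse_nested P Q : S P -> S Q ->
  [\/ P `<=` Q, Q `<=` P | P `&` Q = set0].
Proof.
have [[D DD SD] _] := Ssparse.
by move=> /SD DP /SD DQ; exact: dyadic_lattice_nested DD DP DQ.
Qed.

(** The customary pairwise disjoint major subsets [E_Q] of a sparse family. *)
Definition sparse_core Q := Q `\` \bigcup_(P in [set P | S P /\ P `<` Q]) P.

Let measurable_below Q :
  measurable (\bigcup_(P in [set P | S P /\ P `<` Q]) P : set (Rn R n)).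
Proof.
apply: (@countable_bigcup_measurable _ _ (Rn R n) _ (fun P => P)).
  by apply: sub_countable sparse_countable; apply: subset_card_le => P [].
by move=> P [SP _]; exact: sparse_measurable.
Qed.

Lemma sparse_core_measurable Q : S Q ->
  measurable (sparse_core Q : set (Rn R n)).
Proof. by move=> SQ; apply: measurableD => //; exact: sparse_measurable. Qed.

Lemma sparse_core_disjoint : trivIset S sparse_core.
Proof.
move=> P Q SP SQ [x [[Px nP] [Qx nQ]]].
have [PQ|QP|PQ0] := sparse_nested SP SQ.
- have [//|PnQ] := pselect (P = Q).
  case: nQ; exists P => //; split => //; split=> // QP.
  by apply: PnQ; apply/seteqP.
- have [//|PnQ] := pselect (P = Q).
  case: nP; exists Q => //; split => //; split=> // PQ.
  by apply: PnQ; apply/seteqP.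
- by have : (P `&` Q) x by []; rewrite PQ0.
Qed.

Lemma leb_sparse_core Q : S Q -> (eta%:E * leb Q <= leb (sparse_core Q))%E.
Proof.
move=> SQ; have cQ := sparse_is_cube SQ; have lQ := leb_is_cube_fin cQ.
have [_ /(_ _ SQ)] := Ssparse; rewrite /sparse_core.
set U := \bigcup_(_ in _) _ => UQ.
have UsQ : U `<=` Q by move=> x [P [_ [PQ _]]]; exact: PQ.
have lU : leb U \is a fin_num.
  have Qoo : (leb Q < +oo)%E by rewrite ltey_eq lQ.
  exact: (sub_fin_num (measurable_below Q) (sparse_measurable SQ) UsQ Qoo).
rewrite (_ : leb (Q `\` U) = (leb Q - leb U)%E); last first.
  have Qoo : (leb Q < +oo)%E by rewrite ltey_eq lQ.
  rewrite [LHS](measureD (mu := leb) (sparse_measurable SQ) (measurable_below Q) Qoo).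
  by congr (_ - leb _)%E; apply/setIidr.
move: UQ; rewrite -[leb Q]fineK// -[leb U]fineK// -EFinB -!EFinM !lee_fin; lra.
Qed.

Variables (a : R) (nu : {measure set (Rn R n) -> \bar R}).
Hypotheses (a0 : 0 < a) (A1 : A1_measure a nu).

Lemma A1_sparse_core Q : S Q -> (nu Q <= (a / eta)%:E * nu (sparse_core Q))%E.
Proof.
move=> SQ; have cQ := sparse_is_cube SQ; have [nuQ A1Q] := A1 cQ.
have mC := sparse_core_measurable SQ; have mQ := sparse_measurable SQ.
have CQ : sparse_core Q `<=` Q by move=> x [].
have lQ := leb_is_cube_fin cQ; have lQ0 := fine_leb_cube_gt0 leb_cube_gt0 cQ.
have lC : leb (sparse_core Q) \is a fin_num.
  by apply: (@sub_fin_num _ _ leb Q) => //; rewrite ltey_eq lQ.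
have nC := sub_fin_num mC mQ CQ nuQ.
have nQ : nu Q \is a fin_num by rewrite ge0_fin_numE.
have := A1Q _ mC CQ; have := leb_sparse_core SQ.
have := fine_ge0 (measure_ge0 nu Q).
move: lQ0; rewrite -[leb Q]fineK// -[leb (sparse_core Q)]fineK//.
rewrite -[nu Q]fineK// -[nu (sparse_core Q)]fineK//= -!EFinM !lee_fin.
move: (fine (leb Q)) (fine (leb (sparse_core Q))) (fine (nu Q))
  (fine (nu (sparse_core Q))).
move=> L e N f L0 N0 eL NL.
rewrite mulrAC ler_pdivlMr// -(ler_pM2r L0).
apply: (@le_trans _ _ (N * e)); first by rewrite -mulrA ler_wpM2l.
by apply: (le_trans NL); rewrite mulrAC.
Qed.

(** Replace each cube by its core, taken relative to the full family [S]: disjointness is inherited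
    by every subfamily, and the cores stay inside its union. *)
Lemma sparse_carleson (S' : set (set V)) : S' `<=` S ->
  (\esum_(Q in S') nu Q <= (a / eta)%:E * nu (\bigcup_(Q in S') Q))%E.
Proof.
move=> S'S; have cS' : countable S'.
  by apply: sub_countable sparse_countable; exact: subset_card_le.
have mC Q : S' Q -> measurable (sparse_core Q : set (Rn R n)).
  by move=> /S'S; exact: sparse_core_measurable.
have ae0 : 0 <= a / eta by rewrite divr_ge0// ltW.
apply: (@le_trans _ _ (\esum_(Q in S') ((a / eta)%:E * nu (sparse_core Q)))%E).
  by apply: le_esum => Q /S'S; exact: A1_sparse_core.
rewrite esumZl// lee_wpmul2l ?lee_fin//.
rewrite -(measure_countable_bigcup nu cS' mC); last first.
  by move=> P Q /S'S SP /S'S SQ; exact: sparse_core_disjoint.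
apply: le_measure; rewrite ?inE.
- exact: (@countable_bigcup_measurable _ _ (Rn R n)).
- apply: (@countable_bigcup_measurable _ _ (Rn R n) _ (fun P => P)) => //.
  by move=> P /S'S; exact: sparse_measurable.
- by move=> x [Q S'Q [Qx _]]; exists Q.
Qed.

End one_family.
End sparse_families.

(** * Level sets of sparse sums *)

Section carleson_families.
Local Open Scope ereal_scope.
Context d (T : measurableType d) (R : realType).
Variables (nu : {measure set T -> \bar R}) (S : set (set T)) (c : R).
Hypotheses (cS : countable S) (mS : forall Q, S Q -> measurable Q).
Hypothesis nested : forall P Q, S P -> S Q ->
  [\/ P `<=` Q, Q `<=` P | P `&` Q = set0].
Hypothesis c0 : (0 <= c)%R.
Hypothesis carleson : forall S' : set (set T), S' `<=` S ->
  \esum_(Q in S') nu Q <= c%:E * nu (\bigcup_(Q in S') Q).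
Implicit Types (Q P : set T) (L : set (set T)).

Let ind Q x : \bar R := (\1_Q x)%:E.

Let ind_ge0 Q x : 0 <= ind Q x. Proof. by rewrite lee_fin. Qed.

Let ind_measurable Q : measurable Q -> measurable_fun [set: T] (ind Q).
Proof. by move=> mQ; apply/measurable_EFinP; exact: measurable_indic. Qed.

Definition overlap L x : \bar R := \esum_(Q in L) (\1_Q x)%:E.

(** The square of [overlap], expanded so that it can be integrated term by term. *)
Definition overlap_pairs L x : \bar R :=
  \esum_(Q in L) \esum_(P in L) (\1_(P `&` Q) x)%:E.

Lemma overlap_ge0 L x : 0 <= overlap L x. Proof. exact: esum_ge0. Qed.

Lemma overlap_pairs_ge0 L x : 0 <= overlap_pairs L x.
Proof. by apply: esum_ge0 => Q _; exact: esum_ge0. Qed.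

Let sub_cS L : L `<=` S -> countable L.
Proof. by move=> LS; apply: sub_countable cS; exact: subset_card_le. Qed.

(* [t <= s + t^2 / s], also for [t = +oo]. *)
Lemma overlap_le_pairs L x (s : R) : L `<=` S -> (0 < s)%R ->
  overlap L x <= s%:E + s^-1%:E * overlap_pairs L x.
Proof.
move=> LS s0; have cL := sub_cS LS.
have p0 := overlap_pairs_ge0 L x; have N0 := overlap_ge0 L x.
have s1 : (0 < s^-1)%R by rewrite invr_gt0.
have pairsE Q : L Q -> \esum_(P in L) (\1_(P `&` Q) x)%:E =
    (if x \in Q then overlap L x else 0).
  move=> LQ; case: ifPn => xQ.
    by apply: eq_esum => P _; rewrite indicI /= [\1_Q x]indicE xQ mulr1.
  by rewrite esum1// => P _; rewrite indicI /= [\1_Q x]indicE (negPf xQ) mulr0.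
(* If the overlap is infinite, some cube contains [x], and its inner sum alone is already the whole
   overlap. *)
have [Noo|Nfin] := eqVneq (overlap L x) +oo.
  suff -> : overlap_pairs L x = +oo by rewrite gt0_muley ?lte_fin// addey// leey.
  apply/eqP; rewrite -leye_eq.
  have [Q [LQ xQ]] : exists Q, L Q /\ x \in Q.
    apply: contrapT => /forallNP nQ; move: Noo.
    rewrite (_ : overlap L x = 0)//; apply: esum1 => Q LQ.
    have [xQ|xQ] := pselect (Q x); last by rewrite indicE memNset.
    by case: (nQ Q); split => //; rewrite mem_set.
  rewrite -Noo -{1}[overlap L x](_ : (if x \in Q then overlap L x else 0) = _).
    rewrite -pairsE//; apply: esum_ge; exists [set Q]; last by rewrite fsbig_set1.
    by split => // _ ->.
  by rewrite xQ.
have fN : overlap L x \is a fin_num by rewrite ge0_fin_numE// ltey.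
have -> : overlap_pairs L x = overlap L x * overlap L x.
  rewrite -{1}[overlap L x]fineK// -esumZl ?fine_ge0//.
  apply: eq_esum => Q LQ; rewrite pairsE// indicE fineK//.
  by case: ifP; rewrite ?mule1 ?mule0.
rewrite -[overlap L x]fineK// -!EFinM -EFinD lee_fin.
move: (fine _) => t; rewrite mulrC -subr_ge0.
have -> : (s + t * t / s - t = ((s - t / 2) ^+ 2 + 3 / 4 * t ^+ 2) / s)%R.
  by field; rewrite gt_eqF.
by rewrite divr_ge0 ?(ltW s0)// addr_ge0 ?sqr_ge0// mulr_ge0 ?sqr_ge0//; lra.
Qed.

Let measurable_inner L Q : L `<=` S -> S Q ->
  measurable_fun [set: T] (fun x => \esum_(P in L) ind (P `&` Q) x).
Proof.
move=> LS SQ; apply: measurable_esum => //; first exact: sub_cS.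
by move=> P /LS SP; apply: ind_measurable; apply: measurableI; exact: mS.
Qed.

Lemma overlap_pairs_measurable L : L `<=` S ->
  measurable_fun [set: T] (overlap_pairs L).
Proof.
move=> LS; apply: measurable_esum => //; first exact: sub_cS.
  by move=> Q x _; exact: esum_ge0.
by move=> Q /LS; exact: measurable_inner.
Qed.

Let esum_swap L (f : set T -> set T -> \bar R) : (forall P Q, 0 <= f P Q) ->
  \esum_(Q in L) \esum_(P in L) f P Q = \esum_(P in L) \esum_(Q in L) f P Q.
Proof.
move=> f0; rewrite !esum_esum//.
rewrite (reindex_esum (L `*`` (fun=> L)) _ (fun x => (x.2, x.1)))//.
split=> [[P Q] []//|[P Q] [P' Q'] _ _ /= [-> ->]//|[P Q] [/= LP LQ]].
by exists (Q, P).
Qed.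

(** By nestedness [P] and [Q] meet in the smaller one or not at all, so the double sum is at most
    twice the sum over [P] inside [Q]; the Carleson bound for the cubes below [Q] then gives
    [c nu(Q)]. *)
Lemma integral_overlap_pairs L : L `<=` S ->
  \int[nu]_x overlap_pairs L x <= (2 * c)%:E * \esum_(Q in L) nu Q.
Proof.
move=> LS; have cL := sub_cS LS.
rewrite /overlap_pairs integral_esum//; last 2 first.
- by move=> Q x _; exact: esum_ge0.
- by move=> Q /LS; exact: measurable_inner.
pose below P Q : \bar R := if `[< P `<=` Q >] then nu P else 0.
have below0 P Q : 0 <= below P Q by rewrite /below; case: ifP.
apply: (@le_trans _ _ (\esum_(Q in L) (\esum_(P in L) below P Q +
    \esum_(P in L) below Q P))).
  apply: le_esum => Q LQ; rewrite integral_esum//; last first.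
    move=> P /LS SP; apply: ind_measurable.
    by apply: measurableI; [exact: mS|apply: mS; exact: LS].
  rewrite -esumD//; apply: le_esum => P LP.
  have SP := LS _ LP; have SQ := LS _ LQ.
  rewrite integral_indic//; last by apply: measurableI; exact: mS.
  rewrite setIT; have [PQ|QP|->] := nested SP SQ; last by rewrite measure0 adde_ge0.
    rewrite setIidl// (_ : below P Q = nu P) ?leeDl//.
    by rewrite /below (asboolT PQ).
  rewrite setIidr// (_ : below Q P = nu Q) ?leeDr//.
  by rewrite /below (asboolT QP).
rewrite esumD//; last 2 first.
- by move=> Q _; exact: esum_ge0.
- by move=> Q _; exact: esum_ge0.
rewrite [X in _ + X](esum_swap L (f := fun P Q => below Q P))//.
have H : \esum_(Q in L) \esum_(P in L) below P Q <= c%:E * \esum_(Q in L) nu Q.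
  rewrite -esumZl//; apply: le_esum => Q LQ.
  pose LQs := [set P | L P /\ P `<=` Q].
  rewrite (_ : \esum_(P in L) below P Q = \esum_(P in LQs) nu P); last first.
    rewrite esum_mkcond [RHS]esum_mkcond; apply: eq_esum => P _.
    rewrite /below /LQs; case: ifPn => [|nL].
      rewrite inE => LP; case: asboolP => PQ; first by rewrite mem_set.
      by case: ifPn => //; rewrite inE => -[_ /PQ].
    by case: ifPn => //; rewrite inE => -[LP _]; rewrite mem_set in nL.
  apply: (@le_trans _ _ (c%:E * nu (\bigcup_(P in LQs) P))).
    by apply: carleson => P [/LS].
  rewrite lee_wpmul2l ?lee_fin//; apply: le_measure; rewrite ?inE.
  - apply: (@countable_bigcup_measurable _ _ T _ (fun P => P)).
      by apply: sub_cS => P [/LS].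
    by move=> P [/LS SP _]; exact: mS.
  - by apply: mS; exact: LS.
  - by move=> x [P [_ PQ] Px]; exact: PQ.
rewrite mulr_natl mulr2n EFinD ge0_muleDl ?lee_fin//; exact: leeD.
Qed.

Section level_sets.
Variables (h : set T -> T -> R) (A : set T -> R) (H lam U0 : R).
Hypotheses (h0 : forall Q x, (0 <= h Q x)%R) (A0 : forall Q, (0 <= A Q)%R).
Hypothesis mh : forall Q, S Q -> measurable_fun [set: T] (h Q).
Hypotheses (H0 : (0 <= H)%R) (lam0 : (0 < lam)%R) (U00 : (0 <= U0)%R).
Hypothesis h2 : forall Q, S Q ->
  \int[nu]_(x in Q) (h Q x ^+ 2)%:E <= H%:E * nu Q.
Hypothesis levels : forall k : nat,
  nu (\bigcup_(Q in [set Q | S Q /\ (lam / 16 ^+ k < A Q)%R]) Q) <=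
  (16 ^+ k * U0)%:E.

Let top : set (set T) := [set Q | S Q /\ (lam < A Q)%R].

(** Cubes with [A Q = 0] belong to no level; their terms vanish. *)
Let level k : set (set T) :=
  [set Q | S Q /\ (lam / 16 ^+ k.+1 < A Q <= lam / 16 ^+ k)%R].

Let levelS k : level k `<=` S. Proof. by move=> Q []. Qed.

Let level_disj : trivIset [set: nat] level.
Proof.
suff K j k Q : (j < k)%N -> level j Q -> level k Q -> False.
  move=> j k _ _ [Q [jQ kQ]]; case: (ltngtP j k) => // jk.
    by case: (K _ _ _ jk jQ kQ).
  by case: (K _ _ _ jk kQ jQ).
move=> jk [_ /andP[jA _]] [_ /andP[_ Ak]].
have := lt_le_trans jA Ak; rewrite ltr_pM2l// ltf_pV2 ?posrE//.
by rewrite ltr_eXn2l ?ltr1n// ltnNge jk.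
Qed.

Let level_exists Q : S Q -> (0 < A Q)%R -> (A Q <= lam)%R ->
  exists k, level k Q.
Proof.
move=> SQ AQ0 AQ; have /ltr_add_invr[k] : (0 < A Q / lam)%R by rewrite divr_gt0.
rewrite add0r => kA.
have ex : exists k, (lam / 16 ^+ k.+1 < A Q)%R.
  exists k; rewrite ltr_pdivrMr// -ltr_pdivrMl//.
  move: kA; rewrite invf_plt ?posrE ?divr_gt0// invf_div mulrC => /lt_le_trans.
  apply; rewrite -natrX ler_nat; exact/ltnW/ltn_expl.
case: (ex_minnP ex) => -[|j] jA jmin.
  by exists 0%N; split => //; rewrite expr0 divr1 AQ andbT.
exists j.+1; split => //; rewrite jA /= leNgt.
by apply/negP => /jmin; rewrite ltnn.
Qed.

Let sq k x : \bar R := \esum_(Q in level k) (h Q x ^+ 2 * \1_Q x)%:E.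

Let sq_ge0 k x : 0 <= sq k x.
Proof. by apply: esum_ge0 => Q _; rewrite lee_fin mulr_ge0// sqr_ge0. Qed.

Let sq_term_measurable k Q : level k Q ->
  measurable_fun [set: T] (fun x => (h Q x ^+ 2 * \1_Q x)%:E).
Proof.
move=> [SQ _]; apply/measurable_EFinP; apply: measurable_funM.
  by apply: measurable_funX; exact: mh.
by apply: measurable_indic; exact: mS.
Qed.

Let sq_measurable k : measurable_fun [set: T] (sq k).
Proof.
apply: measurable_esum => //; first exact: sub_cS (@levelS k).
  by move=> Q x _; rewrite lee_fin mulr_ge0// sqr_ge0.
by move=> Q; exact: sq_term_measurable.
Qed.

(** The quadratic remainder of level [k]: [32 = 16 * 2] for the square of [h], and [32 = 8 * 4] for
    the square of the overlap. *)
Let W k x : \bar R := (32 ^- k)%:E * (sq k x + overlap_pairs (level k) x).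

Let W_ge0 k x : 0 <= W k x.
Proof. by rewrite mule_ge0 ?lee_fin ?invr_ge0 ?exprn_ge0// adde_ge0// overlap_pairs_ge0. Qed.

Let W_measurable k : measurable_fun [set: T] (W k).
Proof.
apply: measurable_funeM; apply: emeasurable_funD; first exact: sq_measurable.
exact: overlap_pairs_measurable (@levelS k).
Qed.

Let integral_W k :
  \int[nu]_x W k x <= ((H + 2 * c) * c * 16 * U0 * (2^-1) ^+ k)%:E.
Proof.
have lS := @levelS k; have cL := sub_cS lS.
have p0 x : 0 <= overlap_pairs (level k) x by exact: overlap_pairs_ge0.
have mp := overlap_pairs_measurable lS.
have ms := sq_measurable k.
have msp := emeasurable_funD ms mp.
have k0 : (0 <= 32 ^- k :> R)%R by rewrite invr_ge0 exprn_ge0.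
have sp0 x : 0 <= sq k x + overlap_pairs (level k) x by rewrite adde_ge0.
rewrite /W (ge0_integralZl_EFin nu measurableT)// ge0_integralD//.
have nuL : \esum_(Q in level k) nu Q <= (c * (16 ^+ k.+1 * U0))%:E.
  apply: (le_trans (carleson lS)); rewrite EFinM lee_wpmul2l ?lee_fin//.
  apply: le_trans (levels k.+1); apply: le_measure; rewrite ?inE.
  - apply: (@countable_bigcup_measurable _ _ T _ (fun P => P)) => //.
    by move=> Q /lS; exact: mS.
  - apply: (@countable_bigcup_measurable _ _ T _ (fun P => P)).
      by apply: sub_cS => Q [].
    by move=> Q [/mS].
  - by move=> x [Q [SQ /andP[AQ _]] Qx]; exists Q.
have sqL : \int[nu]_x sq k x <= H%:E * \esum_(Q in level k) nu Q.
  rewrite /sq integral_esum//; last 2 first.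
  - by move=> Q x _; rewrite lee_fin mulr_ge0// sqr_ge0.
  - by move=> Q; exact: sq_term_measurable.
  rewrite -esumZl//; apply: le_esum => Q LQ.
  apply: le_trans (h2 (lS _ LQ)); rewrite [leRHS]integral_mkcond.
  rewrite le_eqVlt; apply/orP; left; apply/eqP; apply: eq_integral => x _.
  by rewrite /patch indicE; case: ifP; rewrite ?mulr1 ?mulr0.
apply: (@le_trans _ _ ((32 ^- k)%:E * ((H + 2 * c) * (c * (16 ^+ k.+1 * U0)))%:E)).
  rewrite lee_wpmul2l ?lee_fin ?invr_ge0 ?exprn_ge0//.
  apply: (le_trans (leeD sqL (integral_overlap_pairs lS))).
  rewrite -ge0_muleDl ?lee_fin ?mulr_ge0// -EFinD EFinM.
  by rewrite lee_wpmul2l// lee_fin addr_ge0// mulr_ge0.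
rewrite -EFinM lee_fin le_eqVlt; apply/orP; left; apply/eqP.
rewrite (_ : 32 = 16 * 2 :> R)%R; last by ring.
rewrite exprMn exprSr exprVn; field; rewrite !expf_neq0//=.
Qed.

Let Wsum x : \bar R := \sum_(0 <= k <oo) W k x.

Let Wsum_measurable : measurable_fun [set: T] Wsum.
Proof. by apply: ge0_emeasurable_sum => // k _; exact: W_measurable. Qed.

Let integral_Wsum :
  \int[nu]_x Wsum x <= (32 * (H + 2 * c) * c * U0)%:E.
Proof.
rewrite integral_nneseries//.
apply: (@le_trans _ _
    (\sum_(0 <= k <oo) ((H + 2 * c) * c * 16 * U0 * (2^-1) ^+ k)%:E)).
  by apply: lee_nneseries => k *; [exact: integral_ge0|exact: integral_W].
apply: (le_trans (nneseries_geometric_le _ _ _)).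
- by rewrite !mulr_ge0// addr_ge0// mulr_ge0.
- by lra.
- by lra.
rewrite (_ : 1 - 2^-1 = 2^-1 :> R)%R; last by lra.
rewrite invrK (_ : _ * 2 = 32 * (H + 2 * c) * c * U0)%R//; ring.
Qed.

(** With [r = 2^k], the bound [h <= r + h^2 / r] is multiplied by [lam / r^4]; after division by the
    common factor, the difference of the two sides is a sum of squares. *)
Let level_term k Q x : level k Q ->
  (h Q x * A Q * \1_Q x)%:E <=
  (lam * (8^-1) ^+ k)%:E * (\1_Q x)%:E + (lam * (32 ^- k))%:E * (h Q x ^+ 2 * \1_Q x)%:E.
Proof.
move=> [_ /andP[_ AQ]]; rewrite -!EFinM -EFinD lee_fin mulrA -mulrDl.
rewrite ler_wpM2r//; apply: (@le_trans _ _ (h Q x * (lam / 16 ^+ k))%R).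
  by rewrite ler_wpM2l.
pose r : R := (2 ^+ k)%R; have r0 : (0 < r)%R by rewrite exprn_gt0.
have -> : (16 ^+ k = r ^+ 4 :> R)%R by rewrite -exprM mulnC exprM; congr (_ ^+ _)%R; ring.
have -> : ((8^-1) ^+ k = r ^- 3 :> R)%R.
  by rewrite exprVn -exprM mulnC exprM; congr (_ ^- _)%R; ring.
have -> : (32 ^- k = r ^- 5 :> R)%R.
  by rewrite -exprM mulnC exprM; congr (_ ^- _)%R; ring.
rewrite -subr_ge0.
have -> : (lam / r ^+ 3 + lam / r ^+ 5 * h Q x ^+ 2 - h Q x * (lam / r ^+ 4) =
  lam / r ^+ 5 * ((r - h Q x / 2) ^+ 2 + 3 / 4 * h Q x ^+ 2))%R.
  by field; rewrite gt_eqF.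
rewrite mulr_ge0 ?divr_ge0 ?exprn_ge0 ?(ltW lam0) ?(ltW r0)// addr_ge0 ?sqr_ge0//.
by rewrite mulr_ge0 ?sqr_ge0//; lra.
Qed.

(** The part [8^-k N_k] left by [level_term] is split once more with [s = 4^k], into [2^-k] and
    [32^-k N_k^2]. *)
Let level_sum k x : \esum_(Q in level k) (h Q x * A Q * \1_Q x)%:E <=
  lam%:E * (((2^-1) ^+ k)%:E + W k x).
Proof.
have lS := @levelS k; have cL := sub_cS lS.
apply: (le_trans (le_esum (fun Q => @level_term k Q x))).
rewrite esumD; last 2 first.
- by move=> Q _; rewrite -EFinM lee_fin !mulr_ge0 ?exprn_ge0 ?invr_ge0 ?(ltW lam0).
- move=> Q _; rewrite -EFinM lee_fin !mulr_ge0 ?exprn_ge0 ?invr_ge0 ?exprn_ge0 ?(ltW lam0)//.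
rewrite !esumZl//; last 3 first.
- by rewrite mulr_ge0 ?invr_ge0 ?exprn_ge0 ?(ltW lam0).
- by move=> Q _; rewrite lee_fin mulr_ge0// sqr_ge0.
- by rewrite mulr_ge0 ?exprn_ge0 ?invr_ge0 ?(ltW lam0).
have p0 := overlap_pairs_ge0 (level k) x.
have q0 := sq_ge0 k x.
rewrite /W; apply: (@le_trans _ _ ((lam * (8^-1) ^+ k)%:E *
   ((4 ^+ k)%:E + (4 ^+ k)^-1%:E * overlap_pairs (level k) x) +
   (lam * 32 ^- k)%:E * sq k x)).
  rewrite leeD2r// lee_wpmul2l//.
    by rewrite lee_fin mulr_ge0 ?exprn_ge0 ?invr_ge0 ?(ltW lam0).
  by apply: overlap_le_pairs => //; rewrite exprn_gt0.
have i0 : (0 <= (4 ^+ k)^-1 :> R)%R by rewrite invr_ge0 exprn_ge0.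
have j0 : (0 <= 32 ^- k :> R)%R by rewrite invr_ge0 exprn_ge0.
have t0 : (0 <= 4 ^+ k :> R)%R by rewrite exprn_ge0.
have u0 : (0 <= 2^-1 ^+ k :> R)%R by rewrite exprn_ge0// invr_ge0.
have qp0 : 0 <= sq k x + overlap_pairs (level k) x by rewrite adde_ge0.
rewrite (_ : lam%:E * _ = (lam * 2^-1 ^+ k)%:E +
    ((lam * 32 ^- k)%:E * sq k x + (lam * 32 ^- k)%:E * overlap_pairs (level k) x)); last first.
  rewrite ge0_muleDr ?lee_fin// ?mule_ge0 ?lee_fin// -EFinM muleA -EFinM.
  by rewrite ge0_muleDr.
rewrite ge0_muleDr ?lee_fin// ?mule_ge0 ?lee_fin// -EFinM muleA -EFinM.
rewrite (_ : lam * 8^-1 ^+ k * 4 ^+ k = lam * 2^-1 ^+ k)%R; last first.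
  by rewrite -mulrA -exprMn; congr (_ * _ ^+ _)%R; lra.
rewrite (_ : lam * 8^-1 ^+ k / 4 ^+ k = lam * 32 ^- k)%R; last first.
  by rewrite -mulrA -!exprVn -exprMn; congr (_ * _ ^+ _)%R; lra.
by rewrite -addeA leeD2l// addeC.
Qed.

(* The terms of one level are linearised by [h <= 2^k + h^2 / 2^k] and
   [N <= 4^k + N^2 / 4^k], so that one application of Chebyshev's inequality
   to the sum of the quadratic remainders is enough. *)
Lemma sparse_sum_level_set : exists D : set T,
  [/\ measurable D,
      forall x, (3 * lam)%:E < \esum_(Q in S) (h Q x * A Q * \1_Q x)%:E -> D x &
      nu D <= ((1 + 32 * (H + 2 * c) * c) * U0)%:E].
Proof.
pose D1 := \bigcup_(Q in top) Q.
pose D2 := [set: T] `&` [set x | 1%:E <= Wsum x].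
have mD1 : measurable D1.
  apply: (@countable_bigcup_measurable _ _ T _ (fun P => P)).
    by apply: sub_cS => Q [].
  by move=> Q [/mS].
have mD2 : measurable D2 by exact: emeasurable_fun_c_infty.
exists (D1 `|` D2); split; first exact: measurableU.
- move=> x; apply: contraPP => /not_orP[nD1 nD2]; apply/negP; rewrite -leNgt.
  have t0 Q : 0 <= (h Q x * A Q * \1_Q x)%:E.
    by rewrite lee_fin !mulr_ge0.
  apply: (@le_trans _ _ (\esum_(Q in \bigcup_k level k) (h Q x * A Q * \1_Q x)%:E)).
    rewrite esum_mkcond [leRHS]esum_mkcond; apply: le_esum => Q _.
    case: ifPn => [|_]; last by case: ifP.
    rewrite inE => SQ; case: ifPn => // nl.
    have [xQ|xQ] := pselect (Q x); last first.
      by rewrite indicE memNset// mulr0.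
    have [AQ|AQ] := ltP 0%R (A Q); last first.
      by rewrite (_ : A Q = 0%R) ?mulr0 ?mul0r//; apply/eqP; rewrite eq_le AQ A0.
    have [lA|Al] := ltP lam (A Q); first by case: nD1; exists Q.
    have [k lk] := level_exists SQ AQ Al.
    by rewrite mem_set in nl => //; exists k.
  rewrite nneseries_sum_bigcup//.
  apply: (@le_trans _ _ (\sum_(0 <= k <oo) (lam%:E * (((2^-1) ^+ k)%:E + W k x)))).
    by apply: lee_nneseries => k *; [exact: esum_ge0|exact: level_sum].
  have g0 k : 0 <= (2^-1 ^+ k)%:E :> \bar R.
    by rewrite lee_fin exprn_ge0// invr_ge0.
  rewrite nneseriesZl; last by move=> k _; rewrite adde_ge0.
  rewrite nneseriesD// (mulrC 3%R) EFinM lee_pmul2l//.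
  (* The 2 is the sum of the [2^-k]; the 1 is the bound on [Wsum] outside [D2]. *)
  rewrite (_ : 3%R = (2 + 1)%R); last by ring.
  rewrite EFinD leeD//; last by rewrite leNgt; apply/negP => /ltW ?; apply: nD2.
  under eq_eseriesr do rewrite -[(_ ^+ _)%R]mul1r.
  have q0 : (0 < 2^-1 :> R)%R by lra.
  have q1 : (2^-1 < 1 :> R)%R by lra.
  apply: (le_trans (nneseries_geometric_le ler01 q0 q1)).
  rewrite (_ : 1 - 2^-1 = 2^-1 :> R)%R; last by lra.
  by rewrite mul1r invrK.
- apply: (le_trans (measureU2 nu mD1 mD2)).
  rewrite mulrDl mul1r EFinD leeD//.
    by have := levels 0; rewrite expr0 divr1 mul1r.
  apply: le_trans integral_Wsum.
  apply: (@le_trans _ _ (\int[nu]_(x in D2) cst 1 x)).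
    by rewrite integral_cst// mul1e.
  apply: (@le_trans _ _ (\int[nu]_(x in D2) Wsum x)).
    by apply: ge0_le_integral_on => x // [_].
  by apply: ge0_le_integral_set => // x; exact: nneseries_ge0.
Qed.

End level_sets.
End carleson_families.

(** * Square integrability of products of oscillations *)

Section oscillation_product.
Context {R : realType} {n l : nat}.
Local Notation V := 'rV[R]_n.
Implicit Types (Q : set V).
Local Notation step := (@osc_step R n).

(** Every factor is at most the largest one. This decouples the functions [b_s] without a
    multilinear Hoelder inequality. *)
Lemma prod_le_sum_exp (z : 'I_l -> R) : (0 < l)%N -> (forall s, 0 <= z s) ->
  \prod_(s < l) z s <= \sum_(s < l) z s ^+ l.
Proof.
move=> l0 z0; case: (arg_maxP z (erefl : xpredT (Ordinal l0))) => s _ zs.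
apply: (@le_trans _ _ (z s ^+ l)).
  rewrite -[X in _ ^+ X]card_ord -prodr_const; apply: ler_prod => t _.
  by rewrite z0; exact: zs.
rewrite (bigD1 s)//= lerDl sumr_ge0// => t _; exact: exprn_ge0.
Qed.

Lemma exprn_le_expR (x : R) (k : nat) : 0 <= x -> (0 < k)%N ->
  x ^+ k <= k%:R ^+ k * expR x.
Proof.
move=> x0 k0; have kR : 0 < k%:R :> R by rewrite ltr0n.
have : (x / k%:R) ^+ k <= expR (x / k%:R) ^+ k.
  rewrite lerXn2r ?nnegrE ?expR_ge0 ?divr_ge0//.
  by rewrite (le_trans _ (expR_ge1Dx _))// lerDr.
rewrite -expRM_natr divfK ?gt_eqF// exprMn exprVn ler_pdivrMr ?exprn_gt0//.
by rewrite mulrC.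
Qed.

Variables (b : 'I_l -> V -> R) (B : 'I_l -> R).

(* The constant [80 * step] comes from [eavg_osc_mul_le], so that [osc_prod]
   dominates the sparse factors for all choices of [gamma] at once. *)
Definition osc_prod Q (x : V) : R :=
  \prod_(s < l) (80 * step + `|b s x - avg Q (b s)| / B s).

(** The three factors stem from the common scale of the oscillations, from
    [x^(2l) <= (2l)^(2l) expR x] at [x = 1 + y], and from [l] exponential integrals bounded by [9 a]
    each; the powers of [a] are kept apart. *)
Definition osc_prod_const : R :=
  (80 * step) ^+ (2 * l) * ((2 * l)%:R ^+ (2 * l) * expR 1) * (l%:R * 9).

Hypothesis leb_cube_gt0 : forall Q, is_cube Q -> (0 < leb Q)%E.
Hypotheses (l0 : (0 < l)%N) (B0 : forall s, 0 < B s).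
Hypotheses (ib : forall s, loc_integrable (b s)).
Hypothesis bB : forall s, (bmo_norm (b s) <= (B s)%:E)%E.

Let step_gt0 : 0 < step. Proof. exact: osc_step_gt0. Qed.

Lemma osc_prod_const_gt0 : 0 < osc_prod_const.
Proof.
have l2 : 0 < (2 * l)%:R :> R by rewrite ltr0n muln_gt0.
have s80 : 0 < 80 * step by rewrite mulr_gt0.
rewrite mulr_gt0//; last by rewrite mulr_gt0// ltr0n.
by rewrite mulr_gt0 ?exprn_gt0// mulr_gt0 ?exprn_gt0 ?expR_gt0.
Qed.

Lemma osc_prod_ge0 Q x : 0 <= osc_prod Q x.
Proof.
by apply: prodr_ge0 => s _;
  rewrite addr_ge0 ?divr_ge0 ?mulr_ge0 ?normr_ge0 ?(ltW (B0 s)) ?(ltW step_gt0).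
Qed.

Lemma osc_prod_measurable Q :
  measurable_fun [set: Rn R n] (osc_prod Q : Rn R n -> R).
Proof.
apply: (@measurable_prod _ (Rn R n) R setT 'I_l _ (fun s x =>
  80 * step + `|b s x - avg Q (b s)| / B s)) => s _.
have mb := meas_fun_dist (avg Q (b s)) (D := setT) (ib s).1.
have mbB := @measurable_funM _ (Rn R n) R setT _ (cst (B s)^-1) mb (measurable_cst _).
exact: (@measurable_funD _ (Rn R n) R setT (cst (80 * step)) _ (measurable_cst _) mbB).
Qed.

(** Each factor is at most [80 a step (1 + y_s)], where [y_s] is the exponent that
    [john_nirenberg_exp] controls. The product of the squares is then reduced to a sum of powers
    [2 l], and these to exponentials. *)
Lemma osc_prod_sq_le (a : R) Q x : 1 <= a ->
  osc_prod Q x ^+ 2 <= a ^+ (2 * l) * (80 * step) ^+ (2 * l) *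
   ((2 * l)%:R ^+ (2 * l) * expR 1) *
   \sum_(s < l) expR (`|b s x - avg Q (b s)| / (4 * a * step * B s)).
Proof.
move=> a1; have a0 : 0 < a by exact: lt_le_trans a1.
pose y s := `|b s x - avg Q (b s)| / (4 * a * step * B s).
have y0 s : 0 <= y s by rewrite divr_ge0 ?mulr_ge0 ?normr_ge0 ?(ltW (B0 s)) ?(ltW step_gt0) ?(ltW a0).
have y10 s : 0 <= 1 + y s by rewrite addr_ge0.
rewrite -mulrA -exprMn; set k := a * _.
have k0 : 0 <= k by rewrite !mulr_ge0 ?(ltW step_gt0) ?(ltW a0).
have hk : osc_prod Q x <= k ^+ l * \prod_(s < l) (1 + y s).
  rewrite -[X in _ ^+ X]card_ord -prodr_const -big_split/=.
  apply: ler_prod => s _; rewrite addr_ge0 ?divr_ge0 ?mulr_ge0 ?normr_ge0 ?(ltW (B0 s)) ?(ltW step_gt0)//=.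
  have -> : `|b s x - avg Q (b s)| / B s = 4 * a * step * y s.
    by rewrite /y; field; rewrite !gt_eqF.
  rewrite [leRHS](mulrDr k) mulr1 lerD//.
    by rewrite /k ler_peMl ?mulr_ge0 ?(ltW step_gt0).
  rewrite ler_wpM2r// /k mulrCA -mulrA ler_wpM2r ?mulr_ge0 ?(ltW step_gt0) ?(ltW a0)//.
  by lra.
apply: (@le_trans _ _ ((k ^+ l * \prod_(s < l) (1 + y s)) ^+ 2)).
  by rewrite lerXn2r// nnegrE ?osc_prod_ge0// mulr_ge0 ?exprn_ge0 ?prodr_ge0.
rewrite exprMn -exprM mulnC -[X in _ * _ * X]/(\sum_(s < l) expR (y s)).
rewrite -mulrA ler_wpM2l ?exprn_ge0// -prodrXl.
apply: (le_trans (prod_le_sum_exp l0 (fun s => sqr_ge0 (1 + y s)))).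
rewrite mulrA mulr_sumr; apply: ler_sum => s _; rewrite -exprM.
by rewrite -mulrA -expRD; apply: exprn_le_expR => //; rewrite muln_gt0.
Qed.

Lemma integral_osc_prod_sq (a : R) nu Q : 1 <= a -> A1_measure a nu ->
  is_cube Q ->
  (\int[nu]_(x in Q) (osc_prod Q x ^+ 2)%:E <=
   (osc_prod_const * a ^+ (2 * l).+1)%:E * nu Q)%E.
Proof.
move=> a1 A1 cQ; have mQ := is_cube_measurable cQ.
have a0 : 0 < a by exact: lt_le_trans a1.
pose K := a ^+ (2 * l) * (80 * step) ^+ (2 * l) * ((2 * l)%:R ^+ (2 * l) * expR 1).
have K0 : 0 <= K.
  by rewrite !mulr_ge0 ?exprn_ge0 ?mulr_ge0 ?expR_ge0 ?(ltW a0) ?(ltW step_gt0).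
pose e s x := expR (`|b s x - avg Q (b s)| / (4 * a * step * B s)).
have me s : measurable_fun (Q : set (Rn R n)) (EFin \o e s).
  apply/measurable_EFinP; have mb := meas_fun_dist (avg Q (b s)) (D := Q) (ib s).1.
  have mbB := @measurable_funM _ (Rn R n) R Q _ (cst (4 * a * step * B s)^-1)
    mb (measurable_cst _).
  exact: (measurableT_comp (@measurable_expR R) mbB).
have e0 s x : (0 <= (EFin \o e s) x)%E by rewrite lee_fin expR_ge0.
apply: (@le_trans _ _ (\int[nu]_(x in Q) (K%:E * \sum_(s < l) (EFin \o e s) x))%E).
  apply: ge0_le_integral_on => x _; first by rewrite lee_fin sqr_ge0.
  rewrite sumEFin -EFinM lee_fin; exact: osc_prod_sq_le.
rewrite (ge0_integralZl_EFin nu mQ)//; last 2 first.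
- by move=> x _; exact: sume_ge0.
- by apply: emeasurable_sum => s; exact: me.
rewrite (ge0_integral_sum nu mQ me)//.
apply: (@le_trans _ _ (K%:E * \sum_(s < l) ((9 * a)%:E * nu Q))%E).
  rewrite lee_wpmul2l ?lee_fin//; apply: lee_sum => s _.
  exact: (john_nirenberg_exp leb_cube_gt0 (B0 s) (ib s) (bB s) a1 A1 cQ).
rewrite -ge0_sume_distrl; last by move=> s _; rewrite lee_fin mulr_ge0// ltW.
rewrite sumEFin sumr_const card_ord muleA -EFinM lee_wpmul2r// lee_fin.
rewrite le_eqVlt; apply/orP; left; apply/eqP.
by rewrite /K /osc_prod_const exprS -mulr_natr; ring.
Qed.

End oscillation_product.

(** * The geometric mean of an A_1 vector weight *)

Section geometric_mean_weight.
Context {R : realType} {n : nat}.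
Local Notation V := 'rV[R]_n.
Implicit Types (Q E : set V) (v : V -> R).
Hypothesis leb_cube_gt0 : forall Q, is_cube Q -> (0 < leb Q)%E.

Lemma ae_forall_ord (m : nat) (P : 'I_m -> V -> Prop) :
  (forall i, \forall x \ae leb, P i x) -> \forall x \ae leb, forall i, P i x.
Proof.
move=> aeP; have aeF : Filter (almost_everywhere (@leb R n)) by exact: ae_filter_ringOfSetsType.
exact: (@filter_forall _ _ P _ aeF aeP).
Qed.

Lemma ae_imply (P P' : V -> Prop) : (forall x, P x -> P' x) ->
  (\forall x \ae leb, P x) -> \forall x \ae leb, P' x.
Proof.
have aeF : Filter (almost_everywhere (@leb R n)) by exact: ae_filter_ringOfSetsType.
exact: (@filterS _ _ aeF).
Qed.

Lemma ess_inf_on_le Q v :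
  \forall x \ae leb, Q x -> (ess_inf_on Q v <= (v x)%:E)%E.
Proof.
have := ess_inf_le leb (fun x : Rn R n => if x \in Q then (v x)%:E else +oo%E).
by apply: ae_imply => x + Qx; rewrite mem_set.
Qed.

Lemma le_ess_inf_on Q v (y : \bar R) :
  (\forall x \ae leb, Q x -> (y <= (v x)%:E)%E) -> (y <= ess_inf_on Q v)%E.
Proof.
move=> yv; apply/ess_infP; apply: ae_imply yv => x yv.
by case: ifPn => [|_]; [rewrite inE|rewrite leey].
Qed.

Lemma ess_inf_on_ge0 Q v : (forall x, 0 <= v x) -> (0 <= ess_inf_on Q v)%E.
Proof.
by move=> v0; apply: le_ess_inf_on; apply: aeW => x _; rewrite lee_fin.
Qed.

(** An infinite essential infimum of a real-valued function would make the cube null. *)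
Lemma ess_inf_on_fin Q v : is_cube Q -> (ess_inf_on Q v < +oo)%E.
Proof.
move=> cQ; rewrite ltNge leye_eq; apply/negP => /eqP eoo.
have [N [mN N0 QN]] := ess_inf_on_le Q v.
have : (leb Q <= leb N)%E.
  apply: le_leb_outer => x Qx; apply: QN => /(_ Qx); by rewrite eoo leye_eq.
by rewrite N0 leNgt leb_cube_gt0.
Qed.

Variables (m : nat) (w : 'I_m -> V -> R).
Hypothesis A1w : A1_vec w.
Let u := geom_mean_weight w.
Let w0 i x : 0 <= w i x. Proof. by have [hw _] := A1w; have [_ ->] := hw i. Qed.

Lemma geom_mean_ge0 x : 0 <= u x.
Proof. by apply: prodr_ge0 => i _; exact: powR_ge0. Qed.

Lemma geom_mean_measurable : meas_fun u.
Proof.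
apply: (@measurable_prod _ (Rn R n) R setT 'I_m _
  (fun i x => (w i x) `^ (m%:R^-1))) => i _.
have [hw _] := A1w; have [mw _ _] := hw i.
exact: (measurableT_comp (@measurable_powR R m%:R^-1) mw).
Qed.

Lemma geom_mean_gt0 : \forall x \ae leb, 0 < u x.
Proof.
have [hw _] := A1w.
have : \forall x \ae leb, forall i, 0 < w i x.
  by apply: ae_forall_ord => i; have [_ _] := hw i.
by apply: ae_imply => x wx; apply: prodr_gt0 => i _; exact: powR_gt0.
Qed.

Let e Q := ess_inf_on Q u.

Let ess_inf_real Q : is_cube Q -> exists s : 'I_m -> R,
  forall i, 0 <= s i /\ ess_inf_on Q (w i) = (s i)%:E.
Proof.
move=> cQ; have H i : exists s, 0 <= s /\ ess_inf_on Q (w i) = s%:E; last first.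
  by have [s sP] := choice H; exists s.
have := ess_inf_on_fin (w i) cQ; have := ess_inf_on_ge0 Q (w0 i).
by case: (ess_inf_on Q (w i)) => // r r0 _; exists r.
Qed.

Let prod_le_ess_inf Q (s : 'I_m -> R) : is_cube Q ->
  (forall i, 0 <= s i /\ ess_inf_on Q (w i) = (s i)%:E) ->
  ((\prod_(i < m) s i `^ m%:R^-1)%:E <= e Q)%E.
Proof.
move=> cQ sP; apply: le_ess_inf_on.
have : \forall x \ae leb, forall i, Q x -> (ess_inf_on Q (w i) <= (w i x)%:E)%E.
  by apply: ae_forall_ord => i; exact: ess_inf_on_le.
apply: ae_imply => x wx Qx; rewrite lee_fin; apply: ler_prod => i _.
have [si0 siE] := sP i; rewrite powR_ge0/= ge0_ler_powR ?nnegrE//.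
by have := wx i Qx; rewrite siE lee_fin.
Qed.

(** Clears the inverses under the convention [0^-1 = +oo]: a vanishing [s i] leaves a finite bound
    only if the remaining product is 0, so the conclusion holds with constant 0. *)
Let inv_prod_le (I : Type) (r : seq I) (s : I -> R) (X : \bar R) (c : R) :
  (forall i, 0 <= s i) -> (0 <= X)%E -> 0 <= c ->
  (X * \prod_(i <- r) ((s i)%:E)^-1 <= c%:E)%E ->
  (X <= (c * \prod_(i <- r) s i)%:E)%E.
Proof.
move=> s0 X0; elim: r c => [|i r ih] c c0; first by rewrite !big_nil mule1 mulr1.
rewrite !big_cons muleCA; set P := \big[_/_]_(_ <- _) _ => XPc.
have P0 : (0 <= P)%E.
  by apply: prode_ge0 => j _; rewrite inve_ge0 lee_fin.
have XP0 : (0 <= X * P)%E by exact: mule_ge0.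
have := s0 i; rewrite le_eqVlt => /orP[/eqP si|si0].
  move: XPc; rewrite -si inver eqxx => XPc.
  have : (X * P <= 0%:E)%E.
    rewrite leNgt; apply/negP => XPgt.
    by move: XPc; rewrite gt0_mulye// leye_eq.
  by move=> /(ih 0 (lexx 0)); rewrite !mul0r mulr0.
rewrite mulrA; apply: ih; first by rewrite mulr_ge0// ltW.
by move: XPc; rewrite inver gt_eqF// lee_pdivrMl// -EFinM mulrC.
Qed.

Lemma geom_mean_A1_bound : exists c : R, forall Q, is_cube Q ->
  (eavg Q (EFin \o u) <= c%:E * e Q)%E.
Proof.
have [_] := A1w; set M := ereal_sup _ => Moo.
have MQ Q : is_cube Q -> (eavg Q (EFin \o u) *
    \prod_(i < m) (poweR (ess_inf_on Q (w i)) m%:R^-1)^-1 <= M)%E.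
  by move=> cQ; apply: ereal_sup_ubound; exists Q.
exists (Num.max 0 (fine M)) => Q cQ.
have [s sP] := ess_inf_real cQ.
set c := Num.max _ _; have c0 : 0 <= c by rewrite le_max lexx.
have Mc : (M <= c%:E)%E.
  rewrite /c; case: (M) Moo => [r _|//|_]; last by rewrite leNye.
  by rewrite lee_fin le_max lexx orbT.
have X0 : (0 <= eavg Q (EFin \o u))%E.
  by apply: eavg_ge0 => x; rewrite lee_fin geom_mean_ge0.
have := le_trans (MQ _ cQ) Mc.
rewrite (eq_bigr (fun i => ((s i `^ m%:R^-1)%:E)^-1)%E); last first.
  by move=> i _; have [_ ->] := sP i.
move=> /(inv_prod_le (fun i => powR_ge0 _ _) X0 c0) /le_trans; apply.
by rewrite EFinM lee_wpmul2l ?lee_fin//; exact: prod_le_ess_inf.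
Qed.

Definition geom_mean_measure : {measure set (Rn R n) -> \bar R} :=
  density_measure leb geom_mean_measurable geom_mean_ge0.

Let mEu E : measurable_fun (E : set (Rn R n)) (EFin \o u).
Proof.
apply/measurable_EFinP; exact: (measurable_funTS geom_mean_measurable).
Qed.

Let ess_inf_mul_le Q E : is_cube Q -> measurable (E : set (Rn R n)) ->
  E `<=` Q -> (e Q * leb E <= geom_mean_measure E)%E.
Proof.
move=> cQ mE EQ; have eQ := ess_inf_on_le Q u.
have e0 := ess_inf_on_ge0 Q geom_mean_ge0.
rewrite -(integral_cst leb mE (e Q)).
apply: (ae_ge0_le_integral mE) => //.
- by move=> x _; rewrite lee_fin geom_mean_ge0.
- by apply: ae_imply eQ => x + /EQ; exact.
Qed.

Let geom_mean_cube_gt0 Q : is_cube Q -> (0 < geom_mean_measure Q)%E.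
Proof.
move=> cQ; have mQ := is_cube_measurable cQ.
rewrite lt_neqAle measure_ge0 andbT; apply/negP => /eqP nu0.
have := ae_eq_integral_abs leb mQ (mEu (E := Q)).
case; rewrite (_ : (\int[leb]_(x in Q) `|(EFin \o u) x|)%E = geom_mean_measure Q).
  move=> /(_ (esym nu0)) [N [mN N0 QN]] _.
  have [N' [mN' N'0 uN']] := geom_mean_gt0.
  have : (leb Q <= leb (N `|` N'))%E.
    apply: le_leb_outer => x Qx.
    have [ux|/negP ux] := boolP (0 < u x).
      left; apply: QN => /(_ Qx) /= [ux0].
      by move: ux; rewrite /= ux0 ltxx.
    by right; apply: uN'.
  rewrite leNgt => /negP; apply; apply: (@le_lt_trans _ _ 0%E).
    have NN0 : (leb N + leb N' = 0)%E.
      by rewrite (N0 : leb N = 0%E) (N'0 : leb N' = 0%E) adde0.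
    by have := measureU2 leb mN mN'; rewrite -[X in (_ <= X)%E]/(leb N + leb N')%E NN0.
  exact: leb_cube_gt0.
by apply: eq_integral => x _ /=; rewrite ger0_norm// geom_mean_ge0.
Qed.

Let admissible : set R := [set c : R | forall Q, is_cube Q ->
  (eavg Q (EFin \o u) <= c%:E * e Q)%E].

Let admissible_cube c Q : admissible c -> is_cube Q -> exists E L N : R,
  [/\ e Q = E%:E, leb Q = L%:E & geom_mean_measure Q = N%:E] /\
  [/\ 0 <= E, 0 < L, 0 < N, N <= c * E * L & E * L <= N].
Proof.
move=> Cc cQ; have mQ := is_cube_measurable cQ.
have := ess_inf_mul_le cQ mQ (@subset_refl _ Q).
have := Cc _ cQ; have := geom_mean_cube_gt0 cQ.
have := leb_cube_gt0 cQ; have := leb_is_cube_fin cQ.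
have := ess_inf_on_ge0 Q geom_mean_ge0; have := ess_inf_on_fin u cQ.
rewrite -/(e Q); case eE : (e Q) => [E| |] // _ E0.
rewrite -EFinM eavg_le// -[integral _ _ _]/(geom_mean_measure Q).
case: (leb Q) => // L _ L0; case: (geom_mean_measure Q) => // N N0 NcEL ELN.
by exists E, L, N; split.
Qed.

(** On the unit cube the measure is positive and at least [ess_inf * |Q|], so a constant below 1 is
    contradictory. *)
Let admissible_ge1 c : admissible c -> 1 <= c.
Proof.
move=> Cc; have cQ : is_cube (cube 0 1 : set V) by exists 0, 1.
have [E [L [N [_ [E0 L0 N0 NcEL ELN]]]]] := admissible_cube Cc cQ.
rewrite leNgt; apply/negP => c1.
have EL0 : 0 <= E * L by rewrite mulr_ge0// ltW.
have : c * (E * L) <= E * L by rewrite ler_piMl// ltW.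
rewrite mulrA => cEL.
have : 0 < E * L by exact: lt_le_trans (le_trans NcEL cEL).
move: c1; rewrite -subr_gt0 => c1 /(mulr_gt0 c1); lra.
Qed.

(** [fine] is faithful because the admissible constants form a nonempty set bounded below by 1. The
    comparison is proved for each admissible constant and passes to the infimum after division by
    [|Q| nu(D)]; the case [nu(D) = 0] is treated apart. *)
Lemma geom_mean_A1 : 1 <= fine (A1_const u) /\
  A1_measure (fine (A1_const u)) geom_mean_measure.
Proof.
have [c1 Cc1] := geom_mean_A1_bound.
have A1E : A1_const u = ereal_inf [set c%:E | c in admissible] by [].
have A1fin : A1_const u \is a fin_num.
  rewrite fin_numE; apply/andP; split; apply/eqP => A1oo.
    have : (1%:E <= A1_const u)%E.
      by apply: le_ereal_inf_tmp => _ [c /admissible_ge1 c1' <-]; rewrite lee_fin.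
    by rewrite A1oo.
  have : (A1_const u <= c1%:E)%E by apply: ereal_inf_lbound; exists c1.
  by rewrite A1oo.
split.
  rewrite -lee_fin fineK//.
  by apply: le_ereal_inf_tmp => _ [c /admissible_ge1 c1' <-]; rewrite lee_fin.
move=> Q cQ; have [E [L [N [[eQ lQ nQ] [E0 L0 N0 NcEL ELN]]]]] := admissible_cube Cc1 cQ.
split; first by rewrite nQ ltry.
move=> D mD DQ; have mQ := is_cube_measurable cQ.
have Qoo : (leb Q < +oo)%E by rewrite lQ ltry.
have lD : leb D \is a fin_num by exact: (@sub_fin_num _ _ leb _ _ mD mQ DQ Qoo).
have nD : geom_mean_measure D \is a fin_num.
  by apply: (sub_fin_num mD mQ DQ); rewrite nQ ltry.
have key c : admissible c ->
    N * fine (leb D) <= c * L * fine (geom_mean_measure D).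
  move=> Cc; have c0 : 0 <= c by rewrite (le_trans ler01)// admissible_ge1.
  have [E' [L' [N' [[eQ' lQ' nQ'] [_ _ _ NcEL' _]]]]] := admissible_cube Cc cQ.
  move: eQ' lQ' nQ' NcEL'; rewrite eQ lQ nQ => -[<-] [<-] [<-] NcEL'.
  have := ess_inf_mul_le cQ mD DQ.
  rewrite eQ -[leb D]fineK// -[geom_mean_measure D]fineK// -EFinM lee_fin => EDD.
  have d0 : 0 <= fine (leb D) by rewrite fine_ge0// leb_outer_ge0.
  apply: (le_trans (ler_wpM2r d0 NcEL')).
  rewrite (_ : c * E * L * _ = c * L * (E * fine (leb D))); last by ring.
  by rewrite ler_wpM2l// mulr_ge0// ltW.
rewrite nQ lQ -[leb D]fineK// -[geom_mean_measure D]fineK// -[A1_const u]fineK//=.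
rewrite -!EFinM lee_fin.
set a := fine (A1_const u); set f := fine (geom_mean_measure D).
have f0 : 0 <= f by exact: fine_ge0.
move: f0; rewrite le_eqVlt => /orP[/eqP f0|f0].
  by have := key _ Cc1; rewrite -/f -f0 !mulr0.
have Lf : 0 < L * f by rewrite mulr_gt0.
rewrite -mulrA -ler_pdivrMr// -lee_fin fineK//.
apply: le_ereal_inf_tmp => _ [c Cc <-].
by rewrite lee_fin ler_pdivrMr// mulrA; exact: key.
Qed.

End geometric_mean_weight.

(** * The weak-type bound *)

Section weighted_null_sets.
Context {R : realType} {n : nat}.
Local Notation V := 'rV[R]_n.
Implicit Types (Q E N : set V) (u : V -> R).

(** Countably many translates of a null cube tile the whole space. *)
Lemma leb_null_cube : ~ (forall Q : set V, is_cube Q -> (0 < leb Q)%E) ->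
  leb ([set: V] : set (Rn R n)) = 0%E.
Proof.
move=> /existsNP[Q /not_implyP[[a [h [h0 ->]]] /negP]].
rewrite -leNgt => Q0.
pose S := [set P : set V | exists x, P = grid_cell a h 0 x].
have cS : countable S.
  apply: sub_countable (grid_cell_countable a h); apply: subset_card_le.
  by move=> _ [x ->]; exists 0%N, x.
have S0 P : S P -> leb P = 0%E.
  move=> [x ->]; rewrite grid_cellE// /grid_side expr0 divr1.
  rewrite (leb_cube_translate _ a); apply/eqP.
  by rewrite eq_le Q0 leb_outer_ge0.
have mS P : S P -> measurable (P : set (Rn R n)).
  by move=> [x ->]; rewrite grid_cellE//; exact: cube_measurable.
apply/eqP; rewrite eq_le [X in _ && X]leb_outer_ge0 andbT.
rewrite (_ : setT = \bigcup_(P in S) P).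
  by apply: (le_trans (measure_countable_bigcup_le leb cS mS)); rewrite esum1.
apply/seteqP; split=> // x _; exists (grid_cell a h 0 x) => //; by exists x.
Qed.

(** [E] may be any subset of the null set: level sets are thus handled by monotonicity alone. *)
Lemma weight_meas_null u E N : meas_fun u -> (forall x, 0 <= u x) ->
  measurable (N : set (Rn R n)) -> leb N = 0%E -> E `<=` N ->
  weight_meas u E = 0%E.
Proof.
move=> mu u0 mN N0 EN; apply/eqP; rewrite eq_le; apply/andP; split.
  rewrite -(null_set_integral (mu := leb) (f := EFin \o u) mN _ N0).
    by apply: ge0_le_integral_set => // x; rewrite lee_fin.
  apply/measurable_EFinP; exact: measurable_funTS.
by apply: integral_ge0 => x _; rewrite lee_fin.
Qed.

End weighted_null_sets.

Section powers.
Context {R : realType}.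

(** Absorbs a power of [a] into the exponential factor: if [D <= c a], compare exponents; otherwise
    [a <= c a < D], and [D^D] is a bound free of [a]. *)
Lemma exprn_le_powR (a c : R) (D : nat) : 1 <= a -> 1 <= c ->
  a ^+ D <= (1 + D%:R ^+ D) * (2 * a) `^ (c * a).
Proof.
move=> a1 c1; have a0 : 0 <= a by exact: le_trans a1.
have D0 : 0 <= D%:R ^+ D :> R by rewrite exprn_ge0.
have ca0 : 0 <= c * a by rewrite mulr_ge0// (le_trans _ c1).
have a21 : 1 <= 2 * a by lra.
have p1 : 1 <= (2 * a) `^ (c * a).
  by have := ler_powR a21 ca0; rewrite powRr0.
have [Dca|caD] := leP D%:R (c * a).
  apply: (@le_trans _ _ ((2 * a) `^ (c * a))).
    apply: (@le_trans _ _ ((2 * a) `^ D%:R)); last exact: ler_powR.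
    by rewrite powR_mulrn ?mulr_ge0// lerXn2r ?nnegrE ?mulr_ge0//; lra.
  by rewrite ler_peMl ?powR_ge0// lerDl.
apply: (@le_trans _ _ (D%:R ^+ D)).
  rewrite lerXn2r ?nnegrE// ltW// (le_lt_trans _ caD)//.
  by rewrite ler_peMl.
apply: (@le_trans _ _ (1 + D%:R ^+ D)); first by rewrite lerDr.
by rewrite ler_peMr// addr_ge0.
Qed.

Lemma powR_invn_exprn (x : R) (m : nat) : (0 < m)%N -> 0 <= x ->
  (x `^ m%:R^-1) ^+ m = x.
Proof.
move=> m0 x0; rewrite -powR_mulrn ?powR_ge0// -powRrM mulVf ?powRr1//.
by rewrite pnatr_eq0 -lt0n.
Qed.

End powers.

(** * Termwise bounds for the sparse form *)

Section sparse_form_bounds.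
Context {R : realType} {n m l : nat}.
Local Notation V := 'rV[R]_n.
Implicit Types (Q : set V) (S : set (set V)).
Local Notation step := (@osc_step R n).
Variable hlm : (l <= m)%N.
Hypothesis leb_cube_gt0 : forall Q, is_cube Q -> (0 < leb Q)%E.
Variables (b : 'I_l -> V -> R) (F : 'I_m -> V -> R).
Hypothesis ib : forall s, loc_integrable (b s).
Hypothesis bF : forall i, bounded_compact_support (F i).

Let L Q i : R := fine (LlogL_norm (F i) Q).

Let LE Q i : is_cube Q -> LlogL_norm (F i) Q = (L Q i)%:E.
Proof.
move=> cQ; rewrite /L fineK// ge0_fin_numE ?LlogL_norm_ge0//.
exact: LlogL_norm_fin.
Qed.

Let L0 Q i : 0 <= L Q i. Proof. by rewrite fine_ge0// LlogL_norm_ge0. Qed.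

Let mF i : meas_fun (F i). Proof. by have [] := bF i. Qed.

Let lee_prod_seq (I : Type) (r : seq I) (P : pred I) (f g : I -> \bar R) :
  (forall i, P i -> (0 <= f i <= g i)%E) ->
  (\prod_(i <- r | P i) f i <= \prod_(i <- r | P i) g i)%E.
Proof.
move=> fg.
have : (0 <= \prod_(i <- r | P i) f i)%E /\
    (\prod_(i <- r | P i) f i <= \prod_(i <- r | P i) g i)%E.
  elim/big_ind2 : _ => [|x1 x2 y1 y2 [x10 x12] [y10 y12]|i Pi].
  - by rewrite lee01.
  - by split; [exact: mule_ge0|exact: lee_pmul].
  - by have /andP[] := fg i Pi.
by case.
Qed.

Definition LlogL_prod Q : R := \prod_(i < m) L Q i.

Lemma LlogL_prod_ge0 Q : 0 <= LlogL_prod Q.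
Proof. exact: prodr_ge0. Qed.

Lemma LlogL_prod_le_max Q x : is_cube Q -> Q x ->
  ((LlogL_prod Q)%:E <= max_LlogL F x)%E.
Proof.
move=> cQ Qx; apply: ereal_sup_ubound; exists Q => //.
by rewrite (eq_bigr (fun i => (L Q i)%:E)) ?prodEFin// => i _; exact: LE.
Qed.

Lemma LlogL_prod_split Q : LlogL_prod Q =
  \prod_(s < l) L Q (widen_ord hlm s) * \prod_(i < m | (l <= i)%N) L Q i.
Proof.
rewrite /LlogL_prod (bigID (fun i : 'I_m => (i < l)%N))/= big_ord_narrow.
by congr (_ * _); apply: eq_bigl => i; rewrite -leqNgt.
Qed.

Lemma sparse_factor_ge0 (c : V -> R) f Q gamma x :
  (0 <= sparse_factor c f Q gamma x)%E.
Proof.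
rewrite /sparse_factor; case: gamma; first by apply: eavg_ge0.
by rewrite mule_ge0// eavg_ge0.
Qed.

Section positive_bmo.
Variable B : 'I_l -> R.
Hypothesis B0 : forall s, 0 < B s.
Hypothesis bB : forall s, (bmo_norm (b s) <= (B s)%:E)%E.

Let factor_le s Q gamma x : is_cube Q ->
  (sparse_factor (b s) (F (widen_ord hlm s)) Q gamma x <=
   (B s * (80 * step + `|b s x - avg Q (b s)| / B s) *
    L Q (widen_ord hlm s))%:E)%E.
Proof.
move=> cQ; have s0 : 0 < step by exact: osc_step_gt0.
have Bs := B0 s; rewrite /sparse_factor; case: gamma.
  apply: (le_trans (eavg_osc_mul_le leb_cube_gt0 Bs (ib s) (bB s) cQ (mF _))).
  rewrite LE// -EFinM lee_fin ler_wpM2r// [leRHS]mulrC ler_wpM2r ?(ltW Bs)//.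
  by rewrite lerDl divr_ge0// ltW.
apply: (@le_trans _ _ (`|b s x - avg Q (b s)|%:E * (L Q (widen_ord hlm s))%:E)%E).
  by rewrite lee_wpmul2l// -LE//; exact: eavg_le_LlogL.
rewrite -EFinM lee_fin ler_wpM2r//.
rewrite (_ : B s * _ = 80 * step * B s + `|b s x - avg Q (b s)|); last first.
  by field; rewrite gt_eqF.
by rewrite lerDr !mulr_ge0// ltW.
Qed.

Let term_le S (gamma : {ffun 'I_l -> bool}) Q x : is_cube Q ->
  (((\prod_(s < l) sparse_factor (b s) (F (widen_ord hlm s)) Q (gamma s) x) *
    (\prod_(s < m | (l <= s)%N) eavg Q (fun y => `|F s y|%:E)) *
    (\1_Q x)%:E) <=
   (\prod_(s < l) B s)%:E *
   (osc_prod b B Q x * LlogL_prod Q * \1_Q x)%:E)%E.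
Proof.
move=> cQ.
have H1 : (\prod_(s < l) sparse_factor (b s) (F (widen_ord hlm s)) Q (gamma s) x <=
    (\prod_(s < l) B s * osc_prod b B Q x *
     \prod_(s < l) L Q (widen_ord hlm s))%:E)%E.
  rewrite /osc_prod -!big_split/= -prodEFin; apply: lee_prod_seq => s _.
  by rewrite sparse_factor_ge0 factor_le.
have H2 : (\prod_(s < m | (l <= s)%N) eavg Q (fun y => `|F s y|%:E) <=
    (\prod_(s < m | (l <= s)%N) L Q s)%:E)%E.
  rewrite -prodEFin; apply: lee_prod_seq => i _; rewrite eavg_ge0//= -LE//.
  exact: eavg_le_LlogL.
rewrite -EFinM !mulrA EFinM lee_wpmul2r ?lee_fin//.
rewrite LlogL_prod_split !mulrA EFinM lee_pmul//.
- by apply: prode_ge0 => s _; exact: sparse_factor_ge0.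
- by apply: prode_ge0 => s _; exact: eavg_ge0.
Qed.

Lemma sparse_form_le S (gamma : {ffun 'I_l -> bool}) x : countable S ->
  (forall Q, S Q -> is_cube Q) ->
  (sparse_form hlm b F S gamma x <= (\prod_(s < l) B s)%:E *
   \esum_(Q in S) (osc_prod b B Q x * LlogL_prod Q * \1_Q x)%:E)%E.
Proof.
move=> cS Scube; rewrite -esumZl//.
- by apply: le_esum => Q /Scube cQ; exact: term_le.
- by apply: prodr_ge0 => s _; exact: ltW.
- move=> Q _; rewrite lee_fin !mulr_ge0// ?LlogL_prod_ge0//.
  exact: osc_prod_ge0.
Qed.

End positive_bmo.

(** The function [b_s] equals its mean almost everywhere on each of the countably many cubes. Off
    the resulting null set the first kind of factor is 0; the second kind is 0 because
    [eavg_osc_mul_le] holds for every [B > 0]. *)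
Lemma sparse_form_zero S s : countable S -> (forall Q, S Q -> is_cube Q) ->
  bmo_norm (b s) = 0%E ->
  exists N : set V, [/\ measurable (N : set (Rn R n)), leb N = 0%E &
    forall gamma x, ~ N x -> sparse_form hlm b F S gamma x = 0%E].
Proof.
move=> cS Scube bs0.
have mO Q : S Q -> measurable (osc_set (b s) Q 0 : set (Rn R n)).
  by move=> /Scube cQ; exact: osc_set_measurable.
have O0 Q : S Q -> leb (osc_set (b s) Q 0) = 0%E.
  move=> /Scube cQ; have mQ := is_cube_measurable cQ.
  have bB0 : (bmo_norm (b s) <= 0%:E)%E by rewrite bs0.
  have I0 : (\int[leb]_(x in Q) `|(b s x - avg Q (b s))%:E|)%E = 0%E.
    apply/eqP; rewrite eq_le integral_ge0// andbT.
    by have := bmo_bound leb_cube_gt0 bB0 cQ; rewrite mul0e.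
  have mb : measurable_fun (Q : set (Rn R n))
      (fun x => (b s x - avg Q (b s))%:E).
    apply/measurable_EFinP; apply: measurable_funTS.
    exact: (@measurable_funB _ (Rn R n) R setT (b s) (cst _) (ib s).1 (measurable_cst _)).
  have [/(_ I0) [N [mN N0 QN]] _] := ae_eq_integral_abs leb mQ mb.
  apply/eqP; rewrite eq_le leb_outer_ge0 andbT -N0; apply: le_leb_outer.
  move=> x [Qx /= bx]; apply: QN => /(_ Qx) [bx0].
  by move: bx; rewrite bx0 normr0 ltxx.
exists (\bigcup_(Q in S) osc_set (b s) Q 0); split.
- exact: (@countable_bigcup_measurable _ _ (Rn R n) _ _ cS mO).
- apply/eqP; rewrite eq_le leb_outer_ge0 andbT.
  by apply: (le_trans (measure_countable_bigcup_le leb cS mO)); rewrite esum1.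
move=> gamma x Nx; apply: esum1 => Q SQ; have cQ := Scube _ SQ.
have [Qx|nQx] := pselect (Q x); last by rewrite indicE memNset// mule0.
rewrite (bigD1 s)//= [X in (X * _ * _ * _)%E](_ : _ = 0%E) ?mul0e//.
rewrite /sparse_factor; case: (gamma s); last first.
  rewrite (_ : `|_| = 0) ?mul0e//; apply/eqP; rewrite eq_le normr_ge0 andbT.
  rewrite leNgt; apply/negP => bx; apply: Nx; by exists Q.
apply/eqP; rewrite eq_le; apply/andP; split; last exact: eavg_ge0.
apply/lee_addgt0Pr => e e0; rewrite add0e.
have st0 : 0 < step by exact: osc_step_gt0.
have L10 : 0 < L Q (widen_ord hlm s) + 1 by rewrite ltr_wpDl.
(* Adding 1 avoids a division by zero when the L(log L) average vanishes. *)
pose B := e / (80 * step * (L Q (widen_ord hlm s) + 1)).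
have B0 : 0 < B by rewrite divr_gt0// !mulr_gt0.
have bB : (bmo_norm (b s) <= B%:E)%E by rewrite bs0 lee_fin ltW.
apply: (le_trans (eavg_osc_mul_le leb_cube_gt0 B0 (ib s) bB cQ (mF _))).
rewrite LE// -EFinM lee_fin /B.
set p := 80 * step; set q := L Q _ in L10 *.
have p0 : 0 < p by rewrite mulr_gt0.
rewrite (_ : p * _ * q = e * (q / (q + 1))); last by field; rewrite !gt_eqF.
by rewrite ler_piMr ?(ltW e0)// ler_pdivrMr// mul1r lerDl.
Qed.

End sparse_form_bounds.

Section weak_type_bound.
Context {R : realType} {n m l : nat}.
Local Notation V := 'rV[R]_n.
Implicit Types (Q E : set V) (S : set (set V)).
Hypotheses (n0 : (0 < n)%N) (m0 : (0 < m)%N) (l0 : (0 < l)%N).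
Variable hlm : (l <= m)%N.
Hypothesis leb_cube_gt0 : forall Q, is_cube Q -> (0 < leb Q)%E.
Variables (b : 'I_l -> V -> R) (F : 'I_m -> V -> R) (B : 'I_l -> R).
Hypotheses (ib : forall s, loc_integrable (b s)) (B0 : forall s, 0 < B s).
Hypothesis bB : forall s, (bmo_norm (b s) <= (B s)%:E)%E.
Hypothesis bF : forall i, bounded_compact_support (F i).
Variables (w : 'I_m -> V -> R) (eta N : R).
Hypotheses (A1w : A1_vec w) (eta0 : 0 < eta) (N0 : 0 <= N).
Let u := geom_mean_weight w.
Let a : R := fine (A1_const u).
Let nu := geom_mean_measure A1w.
Hypothesis weakN : (weak_norm m%:R^-1 u (max_LlogL F) <= N%:E)%E.

Let a1 : 1 <= a.
Proof. by have [] := geom_mean_A1 leb_cube_gt0 A1w. Qed.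

Let A1nu : A1_measure a nu.
Proof. by have [] := geom_mean_A1 leb_cube_gt0 A1w. Qed.

(** The weak norm of exponent [1/m] reads [t nu(E)^m <= N]; taking an [m]-th root gives the bound,
    once an infinite [nu E] is ruled out. *)
Let weak_level E (t : R) : 0 < t ->
  (forall x, E x -> (t%:E < max_LlogL F x)%E) ->
  (nu E <= ((N / t) `^ m%:R^-1)%:E)%E.
Proof.
move=> t0 Et.
have nE0 : (0 <= nu E)%E by apply: measure_ge0.
have nuE : (nu E <= weight_meas u [set x | (t%:E < `|max_LlogL F x|)%E])%E.
  apply: ge0_le_integral_set => [x|x /Et tM].
    by rewrite lee_fin; exact: geom_mean_ge0.
  by apply: (lt_le_trans tM); exact: lee_abs.
have tE : (t%:E * poweR (nu E) m%:R <= N%:E)%E.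
  apply: le_trans weakN.
  apply: (@le_trans _ _ (t%:E *
    poweR (weight_meas u [set x | (t%:E < `|max_LlogL F x|)%E]) m%:R)%E).
    rewrite lee_wpmul2l ?lee_fin ?(ltW t0)//.
    apply: gt0_ler_poweR => //; rewrite in_itv/= leey andbT//.
    exact: le_trans nuE.
  by apply: ereal_sup_ubound; exists t => //; rewrite invrK.
have mR : m%:R != 0 :> R by rewrite pnatr_eq0 -lt0n.
case: (nu E) nE0 tE => [r r0|_|//]; last first.
  by rewrite poweRyr// gt0_muley ?lte_fin// leye_eq.
rewrite poweR_EFin powR_mulrn -?lee_fin// -EFinM !lee_fin mulrC -ler_pdivlMr// => rN.
have -> : r = (r ^+ m) `^ m%:R^-1.
  by rewrite -powR_mulrn// -powRrM divff// powRr1.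
by rewrite ge0_ler_powR ?nnegrE ?exprn_ge0 ?divr_ge0 ?invr_ge0 ?(ltW t0).
Qed.

Definition weak_const (c A0 : R) : R :=
  1 + 32 * (@osc_prod_const R n l * A0 ^+ (2 * l).+1 + 2 * c) * c.

Lemma sparse_weak_bound S (lam : R) : sparse eta S -> 0 < lam ->
  exists D : set V, [/\ measurable (D : set (Rn R n)),
    forall x, ((3 * lam)%:E <
      \esum_(Q in S) (osc_prod b B Q x * LlogL_prod F Q * \1_Q x)%:E)%E -> D x &
    (nu D <= (weak_const (a / eta) a * (N / lam) `^ m%:R^-1)%:E)%E].
Proof.
move=> Ssp lam0; have a0 : 0 < a by exact: lt_le_trans a1.
have cS := sparse_countable n0 Ssp.
apply: (@sparse_sum_level_set _ (Rn R n) R nu S (a / eta) cS _ _ _ _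
  (osc_prod b B) (LlogL_prod F)).
- by move=> Q SQ; exact: (sparse_measurable Ssp).
- by move=> P Q; exact: (sparse_nested n0 Ssp).
- by rewrite divr_ge0// ltW.
- by move=> S' S'S; exact: (sparse_carleson n0 eta0 Ssp leb_cube_gt0 a0 A1nu).
- by move=> Q x; exact: osc_prod_ge0.
- by move=> Q; exact: LlogL_prod_ge0.
- by move=> Q _; exact: osc_prod_measurable.
- by rewrite mulr_ge0 ?exprn_ge0 ?(ltW a0)// ltW// osc_prod_const_gt0.
- by [].
- exact: powR_ge0.
- move=> Q /(sparse_is_cube Ssp) cQ.
  exact: (integral_osc_prod_sq leb_cube_gt0 l0 B0 ib bB a1 A1nu cQ).
(* [(16^k)^(1/m) <= 16^k] since [m >= 1]; this is the growth that the weights [32^-k] can afford. *)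
- move=> k.
  have t0 : 0 < lam / 16 ^+ k by rewrite divr_gt0// exprn_gt0.
  apply: (le_trans (weak_level t0 _)).
    move=> x [Q [SQ tQ] Qx].
    apply: (@lt_le_trans _ _ (LlogL_prod F Q)%:E); first by rewrite lte_fin.
    by apply: LlogL_prod_le_max => //; exact: (sparse_is_cube Ssp).
  have NL0 : 0 <= N / lam by rewrite divr_ge0// ltW.
  have k0 : 0 <= 16 ^+ k :> R by rewrite exprn_ge0.
  rewrite lee_fin (_ : N / _ = 16 ^+ k * (N / lam)); last first.
    by field; rewrite !gt_eqF// exprn_gt0.
  rewrite (powRM _ k0 NL0) ler_wpM2r ?powR_ge0//.
  rewrite -[leRHS]powRr1 ?exprn_ge0//; apply: ler_powR.
    by rewrite exprn_ege1// ler1n.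
  by rewrite invf_le1 ?ltr0n// ler1n.
Qed.

End weak_type_bound.

(** * From level sets to the weak norm of the commutator *)

Section final_estimate.
Context {R : realType}.

Lemma weak_const_ge1 (n l : nat) (c A0 : R) : (0 < l)%N -> 0 <= c -> 0 <= A0 ->
  1 <= @weak_const R n l c A0.
Proof.
move=> l0 c0 A00; have M0 := @osc_prod_const_gt0 R n l l0.
rewrite lerDl; apply: mulr_ge0 => //; apply: mulr_ge0 => //.
apply: addr_ge0; last exact: mulr_ge0.
by apply: mulr_ge0; [exact: ltW|exact: exprn_ge0].
Qed.

(** Separates the weight from the constants: [2 l + 1] powers come from the weighted square
    integrals, one more from the Carleson constant [A0 / eta]. *)
Lemma weak_const_le (n l : nat) (eta A0 : R) : (0 < l)%N -> 0 < eta -> 1 <= A0 ->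
  @weak_const R n l (A0 / eta) A0 <=
  @weak_const R n l eta^-1 1 * A0 ^+ (2 * l).+2.
Proof.
move=> l0 eta0 A1; rewrite /weak_const expr1n mulr1.
have M0 := @osc_prod_const_gt0 R n l l0; move: (@osc_prod_const R n l) M0 => M M0.
have e0 : 0 < eta^-1 by rewrite invr_gt0.
have A0' : 0 < A0 by exact: lt_le_trans A1.
set p := A0 ^+ (2 * l).+1.
have p1 : 1 <= p by rewrite exprn_ege1.
have pA : A0 <= p.
  rewrite /p exprS -[leLHS]mulr1; apply: ler_wpM2l; first exact: ltW.
  exact: exprn_ege1.
rewrite exprSr -/p [leRHS]mulrDl mul1r; apply: lerD.
  by rewrite -[leLHS]mulr1 ler_pM.
rewrite -!mulrA ler_wpM2l//.
apply: (@le_trans _ _ ((M * p + 2 * eta^-1 * p) * (eta^-1 * A0))).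
  rewrite [A0 / eta]mulrC ler_wpM2r ?mulr_ge0 ?(ltW e0) ?(ltW A0')//.
  by rewrite lerD2l mulrA ler_wpM2l ?mulr_ge0 ?(ltW e0).
by rewrite -mulrDl !mulrA [_ * p / _]mulrAC.
Qed.

Lemma measure_bigsetU_ord_le d (T : measurableType d)
    (mu : {measure set T -> \bar R}) (k : nat) (D : 'I_k -> set T) :
  (forall j, measurable (D j)) ->
  measurable (\big[setU/set0]_(j < k) D j) /\
  (mu (\big[setU/set0]_(j < k) D j) <= \sum_(j < k) mu (D j))%E.
Proof.
move=> mD; elim/big_ind2 : _ => [|X x Y y [mX Xx] [mY Yy]|j _].
- by rewrite measure0.
- split; first exact: measurableU.
  by apply: (le_trans (measureU2 mu mX mY)); exact: leeD.
- by split.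
Qed.

Lemma bmo_norm_ge0 (n : nat) (c : 'rV[R]_n -> R) : (0 <= bmo_norm c)%E.
Proof.
pose Q : set 'rV[R]_n := cube 0 1.
apply: (@le_trans _ _ (eavg Q (fun x => `|c x - avg Q c|%:E))).
  by apply: eavg_ge0 => x; rewrite lee_fin.
by apply: ereal_sup_ubound; exists Q; [exists 0, 1|].
Qed.

Lemma weak_norm_ge0 (n : nat) q (v : 'rV[R]_n -> R) g : (0 <= weak_norm q v g)%E.
Proof.
apply: (@le_trans _ _ (1%:E * poweR (weight_meas v [set x | (1%:E < `|g x|)%E]) q^-1)%E).
  by rewrite mule_ge0// poweR_ge0.
by apply: ereal_sup_ubound; exists 1 => //; exact: ltr01.
Qed.

(** The value [q = 0] is excluded because [0^-1 = 0] in [R] and the zeroth power of a null measure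
    is 1. *)
Lemma weak_norm_null (n : nat) q (v : 'rV[R]_n -> R) g : q != 0 ->
  (forall t, 0 < t -> weight_meas v [set x | (t%:E < `|g x|)%E] = 0%E) ->
  (weak_norm q v g <= 0)%E.
Proof.
move=> q0 v0; apply: ge_ereal_sup => _ [t t0 <-].
by rewrite v0// poweR0r ?invr_eq0// mule0.
Qed.

Section main.
Variables (n m l : nat).
Hypotheses (n0 : (0 < n)%N) (m0 : (0 < m)%N) (l0 : (0 < l)%N) (hlm : (l <= m)%N).
Variables (C eta : R).
Hypotheses (C0 : 0 < C) (eta0 : 0 < eta).
Local Notation V := 'rV[R]_n.
Hypothesis leb_cube_gt0 : forall Q : set V, is_cube Q -> (0 < leb Q)%E.
Variables (T : ('I_m -> V -> R) -> V -> R) (b : 'I_l -> V -> R).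
Hypothesis ib : forall s, loc_integrable (b s).
Hypothesis sdT : sparse_domination hlm T b C eta.
Variable w : 'I_m -> V -> R.
Hypothesis A1w : A1_vec w.
Let u := geom_mean_weight w.
Let a : R := fine (A1_const u).
Variable F : 'I_m -> V -> R.
Hypothesis bF : forall i, bounded_compact_support (F i).
Let TF := iterated_commutator hlm T b F.

Lemma weak_norm_commutator_zero s : bmo_norm (b s) = 0%E ->
  (weak_norm m%:R^-1 u (EFin \o TF) <= 0)%E.
Proof.
move=> bs0; apply: weak_norm_null; first by rewrite invr_eq0 pnatr_eq0 -lt0n.
move=> t t0; have [S Ssp [Z [mZ Z0 ZP]]] := sdT bF.
have H j : exists N : set V, [/\ measurable (N : set (Rn R n)), leb N = 0%E &
    forall gamma x, ~ N x -> sparse_form hlm b F (S j) gamma x = 0%E].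
  apply: (sparse_form_zero hlm leb_cube_gt0 ib bF _ _ bs0).
    exact: (sparse_countable n0 (Ssp j)).
  by move=> Q; exact: (sparse_is_cube (Ssp j)).
have [N NP] := choice H.
have mN j : measurable (N j : set (Rn R n)) by have [] := NP j.
have [mU leU] := measure_bigsetU_ord_le (@leb R n) mN.
apply: (@weight_meas_null _ _ _ _ (Z `|` \big[setU/set0]_(j < 3 ^ n) N j)).
- exact: (geom_mean_measurable A1w).
- exact: (geom_mean_ge0 w).
- exact: measurableU.
- apply/eqP; rewrite eq_le leb_outer_ge0 andbT.
  apply: (le_trans (measureU2 leb mZ mU)).
  rewrite [X in (X + _)%E](Z0 : leb Z = 0%E) add0e (le_trans leU)// big1// => j _.
  by have [] := NP j.
move=> x /= tx; apply: contrapT => /not_orP[nZ nN].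
have {}nN j : ~ N j x by move=> Nx; apply: nN; rewrite (bigD1 j)//=; left.
move: tx; apply/negP; rewrite -leNgt.
have := contra_notP (@ZP x) nZ; rewrite /TF /= => /le_trans; apply.
rewrite big1 ?mule0 ?lee_fin ?ltW// => j _; apply: big1 => gamma _.
by have [_ _ ->] := NP j.
Qed.

Variables (B : 'I_l -> R) (N : R).
Hypotheses (B0 : forall s, 0 < B s) (N0 : 0 <= N).
Hypothesis bB : forall s, (bmo_norm (b s) <= (B s)%:E)%E.
Hypothesis weakN : (weak_norm m%:R^-1 u (max_LlogL F) <= N%:E)%E.

Let kappa : R := @weak_const R n l (a / eta) a.
(** The ratio between the level [t] of the commutator and the level [lam] of a single sparse sum: if
    each of the [3^n * 2^l] forms is at most [3 lam] times the product of the [B s], the sparse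
    bound is at most [J lam = t]. *)
Let J : R := 3 * C * 2 ^+ l * \prod_(s < l) B s * 3 ^+ n.

Lemma weak_norm_commutator_le :
  (weak_norm m%:R^-1 u (EFin \o TF) <= ((3 ^+ n * kappa) ^+ m * J * N)%:E)%E.
Proof.
have P0 : 0 < \prod_(s < l) B s by exact: prodr_gt0.
have J0 : 0 < J by rewrite !mulr_gt0 ?exprn_gt0.
have a1 : 1 <= a by have [] := geom_mean_A1 leb_cube_gt0 A1w.
have a0 : 0 < a by exact: lt_le_trans a1.
have kappa0 : 0 <= kappa.
  apply: (le_trans ler01); apply: weak_const_ge1 => //; last exact: ltW.
  by rewrite divr_ge0// ltW.
apply: ge_ereal_sup => _ [t t0 <-].
have [S Ssp [Z [mZ Z0 ZP]]] := sdT bF.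
pose lam := t / J; have lam0 : 0 < lam by rewrite divr_gt0.
have [D DP] := choice (fun j => sparse_weak_bound n0 m0 l0 leb_cube_gt0
  ib B0 bB bF A1w eta0 N0 weakN (Ssp j) lam0).
have mD j : measurable (D j : set (Rn R n)) by have [] := DP j.
pose nu := geom_mean_measure A1w.
have [mU leU] := measure_bigsetU_ord_le nu mD.
pose U0 := (N / lam) `^ m%:R^-1.
have sub : [set x | (t%:E < `|(EFin \o TF) x|)%E] `<=`
    Z `|` \big[setU/set0]_(j < 3 ^ n) D j.
  move=> x /= tx; apply: contrapT => /not_orP[nZ nD].
  have {}nD j : ~ D j x by move=> Dx; apply: nD; rewrite (bigD1 j)//=; left.
  move: tx; apply/negP; rewrite -leNgt.
  have := contra_notP (@ZP x) nZ; rewrite /TF /= => /le_trans; apply.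
  apply: (@le_trans _ _ (C%:E * \sum_(j < 3 ^ n) \sum_(gamma : {ffun 'I_l -> bool})
    (\prod_(s < l) B s * (3 * lam))%:E)%E).
    rewrite lee_wpmul2l ?lee_fin ?(ltW C0)//.
    apply: lee_sum => j _; apply: lee_sum => gamma _.
    apply: (le_trans (sparse_form_le hlm leb_cube_gt0 ib bF B0 bB gamma x _ _)).
    - exact: (sparse_countable n0 (Ssp j)).
    - by move=> Q; exact: (sparse_is_cube (Ssp j)).
    rewrite EFinM lee_wpmul2l ?lee_fin ?(ltW P0)// leNgt; apply/negP.
    by have [_ DPj _] := DP j; move=> /DPj; exact: nD.
  under eq_bigr do rewrite sumEFin sumr_const card_ffun card_bool card_ord.
  rewrite sumEFin sumr_const card_ord -EFinM lee_fin.
  rewrite -(mulr_natr (_ *+ _) (3 ^ n)) -(mulr_natr (_ * _) (2 ^ l)) !natrX.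
  rewrite le_eqVlt; apply/orP; left; apply/eqP.
  by rewrite /lam /J; field; rewrite !gt_eqF ?exprn_gt0.
have wU : (weight_meas u [set x | (t%:E < `|(EFin \o TF) x|)%E] <=
    (3 ^+ n * kappa * U0)%:E)%E.
  apply: (@le_trans _ _ (nu (Z `|` \big[setU/set0]_(j < 3 ^ n) D j))).
    apply: ge0_le_integral_set => // x; rewrite lee_fin; exact: geom_mean_ge0.
  apply: (le_trans (measureU2 nu mZ mU)).
  rewrite [X in (X + _)%E](_ : _ = 0%E) ?add0e; last first.
    exact: (weight_meas_null (geom_mean_measurable A1w) (geom_mean_ge0 w) mZ).
  apply: (le_trans leU).
  apply: (@le_trans _ _ (\sum_(j < 3 ^ n) (kappa * U0)%:E)%E).
    by apply: lee_sum => j _; have [] := DP j.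
  by rewrite sumEFin sumr_const card_ord lee_fin -(mulr_natl (_ * _) (3 ^ n)) natrX mulrA.
have U00 : 0 <= U0 by exact: powR_ge0.
have w0 : (0 <= weight_meas u [set x | (t%:E < `|(EFin \o TF) x|)%E])%E.
  by apply: integral_ge0 => x _; rewrite lee_fin; exact: geom_mean_ge0.
have K0 : 0 <= 3 ^+ n * kappa by rewrite mulr_ge0// exprn_ge0.
rewrite invrK; apply: (@le_trans _ _ (t%:E * poweR (3 ^+ n * kappa * U0)%:E m%:R)%E).
  rewrite lee_wpmul2l ?lee_fin ?(ltW t0)//.
  apply: gt0_ler_poweR => //; rewrite in_itv/= leey andbT//.
  by rewrite lee_fin mulr_ge0.
(* Raising to the power [m] undoes the root in [U0], and [t * (N / lam) = J * N] no longer depends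
   on [t]. *)
rewrite poweR_EFin powR_mulrn ?mulr_ge0// -EFinM lee_fin exprMn.
have NL0 : 0 <= N / lam by apply: divr_ge0 => //; exact: ltW.
rewrite powR_invn_exprn//.
rewrite le_eqVlt; apply/orP; left; apply/eqP.
by rewrite /lam; field; rewrite !gt_eqF.
Qed.

End main.
End final_estimate.

Theorem corollary1p13 (R : realType) (n m l : nat) (hn : (1 <= n)%N)
    (hl : (1 <= l)%N) (hlm : (l <= m)%N)
    (C eta : R) (hC : 0 < C) (heta : 0 < eta < 1) :
  exists2 C' : R, 0 < C' &
  forall (X : set ('rV[R]_n -> R))
    (T : ('I_m -> 'rV[R]_n -> R) -> 'rV[R]_n -> R)
    (b : 'I_l -> 'rV[R]_n -> R) (w : 'I_m -> 'rV[R]_n -> R),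
  multilinear_operator X T ->
  (forall f, bounded_compact_support f -> X f) ->
  (forall s f, bounded_compact_support f -> X (fun x => b s x * f x)) ->
  (forall s, BMO (b s)) ->
  sparse_domination hlm T b C eta ->
  A1_vec w ->
  let u := geom_mean_weight w in
  let a : R := fine (A1_const u) in
  forall F : 'I_m -> 'rV[R]_n -> R,
  (forall i, bounded_compact_support (F i)) ->
  (weak_norm m%:R^-1 u (EFin \o iterated_commutator hlm T b F) <=
   C'%:E * ((2 * a) `^ (2 ^+ (n + 7) * m%:R * a))%:E *
   (\prod_(s < l) bmo_norm (b s)) *
   weak_norm m%:R^-1 u (max_LlogL F))%E.
Proof.
have eta0 : 0 < eta by have /andP[] := heta.
have m0 : (0 < m)%N by exact: leq_trans hlm.
pose K : R := @weak_const R n l eta^-1 1.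
(* The degree in [a] of the [m]-th power of the bound in [weak_const_le]. *)
pose D := ((2 * l).+2 * m)%N.
have K0 : 0 < K.
  by apply: (lt_le_trans ltr01); apply: weak_const_ge1; rewrite ?invr_ge0 ?(ltW eta0).
pose C' : R := (3 ^+ n * K) ^+ m * (3 * C * 2 ^+ l * 3 ^+ n) * (1 + D%:R ^+ D).
have C'0 : 0 < C'.
  by rewrite !mulr_gt0 ?exprn_gt0 ?mulr_gt0 ?exprn_gt0// ltr_pwDl// exprn_ge0.
exists C' => // X T b w _ _ _ bBMO sdT A1w u a F bF.
have bmo0 s : (0 <= bmo_norm (b s))%E by exact: bmo_norm_ge0.
have pw0 : 0 <= (2 * a) `^ (2 ^+ (n + 7) * m%:R * a) by exact: powR_ge0.
have prod0 : (0 <= \prod_(s < l) bmo_norm (b s))%E by exact: prode_ge0.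
have rhs0 : (0 <= C'%:E * ((2 * a) `^ (2 ^+ (n + 7) * m%:R * a))%:E *
    (\prod_(s < l) bmo_norm (b s)) * weak_norm m%:R^-1 u (max_LlogL F))%E.
  by rewrite !mule_ge0 ?weak_norm_ge0 ?lee_fin// ltW.
have mVn0 : m%:R^-1 != 0 :> R by rewrite invr_eq0 pnatr_eq0 -lt0n.
(* The measure of a cube is never computed: if some cube is null, then so is the
   whole space and the left-hand side vanishes. *)
have [leb_cube_gt0|/leb_null_cube leb0] :=
    pselect (forall Q : set 'rV[R]_n, is_cube Q -> (0 < leb Q)%E); last first.
  apply: le_trans rhs0; apply: weak_norm_null => // t t0.
  apply: (weight_meas_null (geom_mean_measurable A1w) (geom_mean_ge0 w) _ leb0).
    exact: measurableT.
  exact: subsetT.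
have ib s : loc_integrable (b s) by have [] := bBMO s.
have [[s bs0]|bmo_neq0] := pselect (exists s, bmo_norm (b s) = 0%E).
  apply: le_trans rhs0.
  exact: (weak_norm_commutator_zero hn m0 leb_cube_gt0 ib sdT A1w bF bs0).
have bmo_gt0 s : (0 < bmo_norm (b s))%E.
  rewrite lt_neqAle bmo0 andbT; apply/eqP => bs0.
  by apply: bmo_neq0; exists s.
have bmo_real s : bmo_norm (b s) = (fine (bmo_norm (b s)))%:E.
  by rewrite fineK// ge0_fin_numE//; have [] := bBMO s.
have B0 s : 0 < fine (bmo_norm (b s)) by rewrite -lte_fin -bmo_real.
have bB s : (bmo_norm (b s) <= (fine (bmo_norm (b s)))%:E)%E by rewrite -bmo_real.
have a1 : 1 <= a by have [] := geom_mean_A1 leb_cube_gt0 A1w.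
have a0 : 0 < a by exact: lt_le_trans a1.
have pw_gt0 : 0 < (2 * a) `^ (2 ^+ (n + 7) * m%:R * a).
  by apply: powR_gt0; rewrite mulr_gt0.
rewrite (eq_bigr (fun s => (fine (bmo_norm (b s)))%:E)); last by move=> s _.
have P0 : 0 < \prod_(s < l) fine (bmo_norm (b s)) by exact: prodr_gt0.
rewrite prodEFin -!EFinM.
have := weak_norm_ge0 m%:R^-1 u (max_LlogL F).
(* If the weak norm of the maximal function is infinite, so is the right-hand side, as all its other
   factors are positive. *)
case wE : (weak_norm m%:R^-1 u (max_LlogL F)) => [N| |//] N0; last first.
  by rewrite gt0_muley ?leey// lte_fin mulr_gt0// mulr_gt0.
rewrite lee_fin in N0.
have weakN : (weak_norm m%:R^-1 u (max_LlogL F) <= N%:E)%E by rewrite wE.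
apply: (le_trans (weak_norm_commutator_le hn m0 hl hC eta0 leb_cube_gt0 ib
  sdT A1w bF B0 N0 bB weakN)).
rewrite -EFinM lee_fin ler_wpM2r//; set P := \prod_(_ < _) _ in P0 *.
set kappa := weak_const _ _.
have kappa_le : kappa ^+ m <= K ^+ m * a ^+ D.
  rewrite /D exprM -exprMn; apply: lerXn2r; rewrite ?nnegrE.
  - apply: (le_trans ler01); apply: weak_const_ge1 => //; last exact: ltW.
    by rewrite divr_ge0// ltW.
  - by rewrite mulr_ge0 ?exprn_ge0 ?(ltW K0) ?(ltW a0).
  - exact: weak_const_le.
have aD : a ^+ D <= (1 + D%:R ^+ D) * (2 * a) `^ (2 ^+ (n + 7) * m%:R * a).
  apply: exprn_le_powR => //.
  by rewrite mulr_ege1 ?exprn_ege1 ?ler1n//; lra.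
have {}kappa_le := le_trans kappa_le (ler_wpM2l (exprn_ge0 m (ltW K0)) aD).
have E0 : 0 <= (3 ^+ n) ^+ m * (3 * C * 2 ^+ l * P * 3 ^+ n).
  by rewrite !mulr_ge0 ?exprn_ge0 ?(ltW hC) ?(ltW P0).
rewrite /C' !exprMn mulrAC.
apply: (le_trans (ler_wpM2l E0 kappa_le)).
rewrite le_eqVlt; apply/orP; left; apply/eqP; ring.
Qed.
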